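(* Consider, for each $n$, the random-design linear model $Y_i=\mathbf{X}_i'\boldsymbol{\beta}+\varepsilon_i$, $i=1,\dots,n$, with $p_n$ covariates of which the first $k_n$ have nonzero coefficients and the remaining $m_n=p_n-k_n$ have zero coefficients, and let $\widehat{\boldsymbol{\beta}}_n=(\widehat{\boldsymbol{\beta}}_{1n}',\widehat{\boldsymbol{\beta}}_{2n}')'$ be the LS-SCAD estimator with penalty parameters $\lambda_n>0$ and $a>2$ (all as set out in the context). Let $d$ be a fixed positive integer and let $\{\mathbf{A}_n,n=1,2,\dots\}$ be a sequence of (nonrandom) matrices of dimension $d\times k_n$ with full row rank. Suppose that there exist an absolute constant $M$ such that $\max_{1\le j\le p_n}|X_j|\le M<\infty$ and a constant $\sigma_4$ such that $E[\varepsilon_1^4\,|\,\mathbf{X}_{11}]\le\sigma_4<\infty$ for all $n$, where $\mathbf{X}_{11}$ is the vector of the first $k_n$ covariates of the first observation. Suppose also that: (i) $(\mathbf{X}_i',\varepsilon_i)=(X_{i1},\dots,X_{ip_n},\varepsilon_i)$, $i=1,\dots,n$, are i.i.d., distributed as $(\mathbf{X}',\varepsilon)=(X_1,\dots,X_{p_n},\varepsilon)$, with $E[X_{ij}]=0$, $\mathrm{Var}(X_{ij})=1$, $E[\varepsilon|\mathbf{X}]=0$ and $\mathrm{Var}(\varepsilon|\mathbf{X})=\sigma^2$; (ii) $\lim_{n\to\infty}p_n^2/(n\rho_1^2)=0$ and $\lim_{n\to\infty}k_n\lambda_n^2/\rho_1=0$; (iii) $\lim_{n\to\infty}\sqrt{p_n}/(\sqrt{n\rho_1}\min_{1\le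 j\le k_n}|\beta_j|)=0$ and $\lim_{n\to\infty}\lambda_n\sqrt{k_n}/(\sqrt{\rho_1}\min_{1\le j\le k_n}|\beta_j|)=0$; (iv) $\lim_{n\to\infty}\sqrt{\max(\pi_{k_n},\omega_{m_n})\,p_n}/(\sqrt{n}\,\rho_1\lambda_n)=0$, where $\rho_1$ (which may depend on $n$) is the smallest eigenvalue of $E[\mathbf{X}\mathbf{X}']$, and $\pi_{k_n}$, $\omega_{m_n}$ are the largest eigenvalues of $E[\mathbf{X}_{i1}\mathbf{X}_{i1}']$ and $E[\mathbf{X}_{i2}\mathbf{X}_{i2}']$, respectively. Then $$n^{-1/2}\,\Sigma_n^{-1/2}\mathbf{A}_n\,E^{-1/2}[\mathbf{X}_{i1}\mathbf{X}_{i1}']\sum_{i=1}^n\mathbf{X}_{i1}\mathbf{X}_{i1}'(\widehat{\boldsymbol{\beta}}_{1n}-\boldsymbol{\beta}_1)\xrightarrow{D}N(\mathbf{0}_d,I_d)\quad\text{as }n\to\infty,$$ where $\Sigma_n=\sigma^2\mathbf{A}_n\mathbf{A}_n'$ and $E^{-1/2}[\mathbf{X}_{i1}\mathbf{X}_{i1}']$ denotes $\left(E[\mathbf{X}_{i1}\mathbf{X}_{i1}']\right)^{-1/2}$ (which does not depend on $i$).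
   Context: Setting. For each $n$, observations $(\mathbf{X}_i,Y_i)$, $i=1,\dots,n$, satisfy $Y_i=\mathbf{X}_i'\boldsymbol{\beta}+\varepsilon_i$ (the intercept is taken to be $0$), where $\mathbf{X}_i=(X_{i1},\dots,X_{ip_n})'$ is a random $p_n\times1$ vector, $\varepsilon_i$ is a random error, and $\boldsymbol{\beta}=(\beta_1,\dots,\beta_{p_n})'\in\mathbb{R}^{p_n}$ is nonrandom. The covariates and their law, and the parameters $p_n,k_n,\boldsymbol{\beta},\lambda_n$ may depend on $n$; $a>2$ and $\sigma^2$ (positive, since $\Sigma_n$ is inverted) are fixed. Write $\boldsymbol{\beta}=(\boldsymbol{\beta}_1',\boldsymbol{\beta}_2')'$ with $\boldsymbol{\beta}_1=(\beta_1,\dots,\beta_{k_n})'$ having all components nonzero and $\boldsymbol{\beta}_2=\mathbf{0}_{m_n}$, $m_n=p_n-k_n$. Correspondingly $\mathbf{X}_{i1}=(X_{i1},\dots,X_{ik_n})'$ and $\mathbf{X}_{i2}=(X_{i,k_n+1},\dots,X_{ip_n})'$ (vectors). Let $\mathbf{Y}=(Y_1,\dots,Y_n)'$ and let $\mathbb{X}=(X_{ij})$ be the $n\times p_n$ design matrix. $\|\cdot\|$ is the Euclidean norm, $\xrightarrow{D}$ is convergence in distribution. Conditions with $\rho_1$ in a denominator are understood with $\rho_1>0$. SCAD penalty. For $a>2$, $\lambda>0$: $p_\lambda(\theta;a)=\lambda|\theta|$ if $|\theta|\le\lambda$; $p_\lambda(\theta;a)=-(\theta^2-2a\lambda|\theta|+\lambda^2)/[2(a-1)]$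 if $\lambda<|\theta|\le a\lambda$; $p_\lambda(\theta;a)=(a+1)\lambda^2/2$ if $|\theta|>a\lambda$. LS-SCAD estimator. $\widehat{\boldsymbol{\beta}}_n=\arg\min_{\mathbf{b}\in\mathbb{R}^{p_n}}Q_n(\mathbf{b};\lambda_n,a)$, where $Q_n(\mathbf{b};\lambda_n,a)=\|\mathbf{Y}-\mathbb{X}\mathbf{b}\|^2+n\sum_{j=1}^{p_n}p_{\lambda_n}(b_j;a)$ (a global minimizer). It is partitioned as $\widehat{\boldsymbol{\beta}}_n=(\widehat{\boldsymbol{\beta}}_{1n}',\widehat{\boldsymbol{\beta}}_{2n}')'$ with $\widehat{\boldsymbol{\beta}}_{1n}\in\mathbb{R}^{k_n}$, $\widehat{\boldsymbol{\beta}}_{2n}\in\mathbb{R}^{m_n}$. *)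

(* Defs.v *)
From HB Require Import structures.
From mathcomp Require Import all_boot all_order all_algebra.
From mathcomp Require Import all_classical all_reals all_analysis.
Import Order.TTheory GRing.Theory Num.Theory.
Import numFieldNormedType.Exports.

Set Implicit Arguments.
Unset Strict Implicit.
Unset Printing Implicit Defensive.

Local Open Scope classical_set_scope.
Local Open Scope ring_scope.

Section LinearAlgebra.
Context {R : realType}.

Definition enorm (p : nat) (v : 'cV[R]_p) : R :=
  Num.sqrt (\sum_(i < p) v i 0 ^+ 2).

(* Intended for symmetric matrices of positive size, whose spectrum is finite
   and nonempty; both are 0 for the empty matrix. *)
Definition eig_min (p : nat) (A : 'M[R]_p) : R := inf [set a | eigenvalue A a].
Definition eig_max (p : nat) (A : 'M[R]_p) : R := sup [set a | eigenvalue A a].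

Definition psdmx (p : nat) (A : 'M[R]_p) : Prop :=
  A^T = A /\ forall v : 'cV[R]_p, 0 <= (v^T *m A *m v) 0 0.

(* A positive semidefinite A has exactly one positive semidefinite square
   root; the value is 0 for other A. *)
Definition sqrtmx (p : nat) (A : 'M[R]_p) : 'M[R]_p :=
  xget 0 [set B : 'M[R]_p | psdmx B /\ B *m B = A].

Definition invsqrtmx (p : nat) (A : 'M[R]_p) : 'M[R]_p := invmx (sqrtmx A).

(* For p > 0 the infimum is attained and is min_j |b_j|. *)
Definition min_abs (p : nat) (b : 'cV[R]_p) : R :=
  inf (range (fun j : 'I_p => `|b j 0|)).

End LinearAlgebra.

Section Penalty.
Context {R : realType}.

Definition scad (lambda a theta : R) : R :=
  if `|theta| <= lambda then lambda * `|theta|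
  else if `|theta| <= a * lambda then
    - (theta ^+ 2 - 2 * a * lambda * `|theta| + lambda ^+ 2) / (2 * (a - 1))
  else (a + 1) * lambda ^+ 2 / 2.

Definition scad_objective (n p : nat) (Y : 'cV[R]_n) (X : 'M[R]_(n, p))
    (lambda a : R) (b : 'cV[R]_p) : R :=
  enorm (Y - X *m b) ^+ 2 + n%:R * \sum_(j < p) scad lambda a (b j 0).

End Penalty.

Section RandomVectors.
Context {R : realType} {T : Type}.

(* A family of real functions on T as one vector-valued function: tuples carry
   the product sigma-algebra, column vectors the linear algebra. *)
Definition rvec (p : nat) (f : 'I_p -> T -> R) (w : T) : p.-tuple R :=
  [tuple f j w | j < p].

Definition rcol (p : nat) (f : 'I_p -> T -> R) (w : T) : 'cV[R]_p :=
  \col_j f j w.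

Definition design (n p : nat) (X : 'I_n -> 'I_p -> T -> R) (w : T) :
    'M[R]_(n, p) := \matrix_(i, j) X i j w.

Definition response (n p : nat) (X : 'I_n -> 'I_p -> T -> R)
    (eps : 'I_n -> T -> R) (beta : 'cV[R]_p) (w : T) : 'cV[R]_n :=
  design X w *m beta + rcol eps w.

End RandomVectors.

Section Probability.
Context {d : measure_display} {T : measurableType d} {R : realType}.
Variable P : probability T R.

Definition second_moment (p : nat) (X : 'I_p -> T -> R) : 'M[R]_p :=
  \matrix_(j, l) fine 'E_P[fun w => X j w * X l w].

(* Taking B i = setT gives the product rule for every subfamily. *)
Definition mutually_independent {d' : measure_display} {S : measurableType d'}
    (n : nat) (W : 'I_n -> T -> S) : Prop :=
  forall B : 'I_n -> set S, (forall i, measurable (B i)) ->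
    fine (P [set w | forall i, B i (W i w)]) =
    \prod_(i < n) fine (P (W i @^-1` B i)).

Definition same_law {d' : measure_display} {S : measurableType d'}
    (V W : T -> S) : Prop :=
  forall B : set S, measurable B -> P (V @^-1` B) = P (W @^-1` B).

(* Z is a version of E[Y | W], i.e. of the conditional expectation of Y given
   the sigma-algebra generated by W. *)
Definition cond_exp {d' : measure_display} {S : measurableType d'}
    (W : T -> S) (Y Z : T -> R) : Prop :=
  [/\ P.-integrable setT (EFin \o Y),
      P.-integrable setT (EFin \o Z),
      forall B : set R, measurable B -> g_sigma_algebra_preimage W (Z @^-1` B)
    & forall A : set T, g_sigma_algebra_preimage W A ->
        (\int[P]_(w in A) (Z w)%:E = \int[P]_(w in A) (Y w)%:E)%E].

(* V is a version of Var(Y | W) = E[(Y - E[Y | W])^2 | W]. *)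
Definition cond_var {d' : measure_display} {S : measurableType d'}
    (W : T -> S) (Y V : T -> R) : Prop :=
  exists2 m : T -> R, cond_exp W Y m
    & cond_exp W (fun w => (Y w - m w) ^+ 2) V.

End Probability.

Section StandardNormal.
Context {R : realType}.

Definition cons_tuple (d : nat) (z : measurableTypeR R * d.-tuple R) :
  d.+1.-tuple R := [tuple of z.1 :: z.2].

Lemma measurable_cons_tuple (d : nat) :
  measurable_fun [set: measurableTypeR R * d.-tuple R] (@cons_tuple d).
Proof. exact: (measurable_cons measurable_fst measurable_snd). Qed.

HB.instance Definition _ (d : nat) :=
  isMeasurableFun.Build _ _ _ _ (@cons_tuple d) (@measurable_cons_tuple d).

(* N(0_d, I_d), the d-fold product of N(0, 1). *)
Fixpoint std_normal (d : nat) : probability (d.-tuple R) R :=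
  match d with
  | 0 => dirac [tuple]
  | d'.+1 =>
      distribution (normal_prob (0 : R) 1 \x std_normal d')%E (@cons_tuple d')
  end.

(* Weak convergence of random vectors, which may live on different
   probability spaces, to a law given on tuples. *)
Definition cvg_in_distribution {disp : nat -> measure_display}
    {T : forall n, measurableType (disp n)}
    (P : forall n, probability (T n) R) (d : nat)
    (Z : forall n, T n -> 'cV[R]_d) (nu : probability (d.-tuple R) R) : Prop :=
  forall f : 'cV[R]_d -> R, continuous f ->
    (exists C : R, forall z, `|f z| <= C) ->
    'E_(P n)[f \o Z n]%E @[n --> \oo] -->
    'E_nu[fun t => f (\col_j tnth t j)]%E.

End StandardNormal.

(* Main.v *)
(* The statistic is the oracle score n^{-1/2} B X_1' eps, with
   B = Sigma_n^{-1/2} A_n E^{-1/2}[X_1 X_1'], except on an event of small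
   probability.  Indeed, write G = E[X X'] and suppose that the empirical Gram
   matrix is within rho_1 / 2 of G in Frobenius norm and that
   eps' X G^{-1} X' eps <= K n p.  Comparing the criterion at the minimizer with
   its value at beta bounds the estimation error well below the coefficients of
   beta_1, so that the signal coordinates of the minimizer end up where the
   penalty is flat.  The penalty then cannot favour beta, which improves the bound
   so much that the null coordinates fall where the penalty is linear with slope
   lambda_n; since this slope dominates the score, they vanish.  What remains are
   the least squares equations X_1' X_1 (betahat_1 - beta_1) = X_1' eps.  Both
   conditions fail with small probability by Chebyshev's and Markov's inequalities,
   because E |X'X/n - G|^2 <= p^2 M^4 / n and E[eps' X G^{-1} X' eps] = n p sigma^2.

   For fixed t the oracle score gives t' Z as a normalized sum of i.i.d. centred
   variables with variance |t|^2 and fourth moment O(k_n / rho_1), so its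
   characteristic function converges to the Gaussian one.  Bounded continuous test
   functions are approximated on large cubes by trigonometric polynomials. *)
Require Import Defs.
From HB Require Import structures.
From mathcomp Require Import all_boot all_order all_algebra.
From mathcomp Require Import all_classical all_reals all_analysis.
From mathcomp Require Import measurable_realfun.
From mathcomp Require Import ring lra.
Import Order.TTheory GRing.Theory Num.Theory.
Import numFieldNormedType.Exports.

Set Implicit Arguments.
Unset Strict Implicit.
Unset Printing Implicit Defensive.

Local Open Scope classical_set_scope.
Local Open Scope ring_scope.

(** * Quadratic forms and extreme eigenvalues *)

Section BilinearForms.
Context {R : realType}.

(** The score is measured through G^{-1} because Cauchy-Schwarz then compares noise and curvature in
    one form: (eps' X x)^2 <= S x'Gx with S = eps' X G^{-1} X' eps. The mean of S contains the trace
    of G^{-1} G, so no factor 1/rho_1 is lost there; rho_1 enters only when x'Gx is turned into a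
    bound on coordinates. The constant K cannot depend on n, so the event fails with a probability
    of order sigma^2 / K that does not vanish. Hence the order of choices: test function and
    accuracy, then K, then n. No event is ever given a probability: the difference of the two values
    of the test function is dominated pointwise by a combination of the Gram error and S, and that
    majorant is integrated. Characteristic functions stay real: cos (t x + c) with a free phase c
    carries both cosine and sine, and every induction is over all phases at once. The fourth moment
    of the errors is controlled only given the first k_n covariates of the first observation, so the
    Lyapunov bound is derived there and carried to the other observations by equality in law. *)

Definition bform (p : nat) (G : 'M[R]_p) (x y : 'cV[R]_p) : R :=
  (x^T *m G *m y) 0 0.

Definition dot (p : nat) (x y : 'cV[R]_p) : R := (x^T *m y) 0 0.

Lemma dotE p (x y : 'cV[R]_p) : dot x y = \sum_j x j 0 * y j 0.
Proof. by rewrite /dot mxE; apply: eq_bigr => j _; rewrite mxE. Qed.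

Lemma bformE p (G : 'M[R]_p) x y :
  bform G x y = \sum_j \sum_l G j l * (x j 0 * y l 0).
Proof.
rewrite /bform mxE exchange_big /=; apply: eq_bigr => l _.
rewrite mxE mulr_suml; apply: eq_bigr => j _; rewrite mxE; ring.
Qed.

Lemma bform_dot p (G : 'M[R]_p) x y : bform G x y = dot x (G *m y).
Proof. by rewrite /bform /dot mulmxA. Qed.

Lemma dotC p (x y : 'cV[R]_p) : dot x y = dot y x.
Proof. by rewrite !dotE; apply: eq_bigr => j _; rewrite mulrC. Qed.

Lemma dotDr p (x y z : 'cV[R]_p) : dot x (y + z) = dot x y + dot x z.
Proof. by rewrite /dot mulmxDr mxE. Qed.

Lemma dotDl p (x y z : 'cV[R]_p) : dot (x + y) z = dot x z + dot y z.
Proof. by rewrite dotC dotDr !(dotC z). Qed.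

Lemma dotZr p a (x y : 'cV[R]_p) : dot x (a *: y) = a * dot x y.
Proof. by rewrite /dot -scalemxAr mxE. Qed.

Lemma dotZl p a (x y : 'cV[R]_p) : dot (a *: x) y = a * dot x y.
Proof. by rewrite dotC dotZr dotC. Qed.

Lemma dotNr p (x y : 'cV[R]_p) : dot x (- y) = - dot x y.
Proof. by rewrite -scaleN1r dotZr mulN1r. Qed.

Lemma dotNl p (x y : 'cV[R]_p) : dot (- x) y = - dot x y.
Proof. by rewrite dotC dotNr dotC. Qed.

Lemma dot0l p (x : 'cV[R]_p) : dot 0 x = 0.
Proof. by rewrite /dot trmx0 mul0mx mxE. Qed.

Lemma dot_mull n p (A : 'M[R]_(n, p)) x y : dot (A *m x) y = dot x (A^T *m y).
Proof. by rewrite /dot trmx_mul mulmxA. Qed.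

Lemma dot_ge0 p (x : 'cV[R]_p) : 0 <= dot x x.
Proof. by rewrite dotE sumr_ge0// => j _; rewrite -expr2 sqr_ge0. Qed.

Lemma dot_eq0 p (x : 'cV[R]_p) : dot x x = 0 -> x = 0.
Proof.
rewrite dotE => /eqP; rewrite psumr_eq0; last first.
  by move=> j _; rewrite -expr2 sqr_ge0.
move=> /allP x0; apply/matrixP => j l; rewrite ord1 mxE.
by apply/eqP; rewrite -sqrf_eq0 expr2; apply: x0; rewrite mem_index_enum.
Qed.

Lemma sqr_coord_le_dot p (x : 'cV[R]_p) j : x j 0 ^+ 2 <= dot x x.
Proof.
rewrite dotE (bigD1 j)//= -expr2 lerDl sumr_ge0// => l _.
by rewrite -expr2 sqr_ge0.
Qed.

Lemma enormE p (x : 'cV[R]_p) : enorm x ^+ 2 = dot x x.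
Proof.
rewrite /enorm sqr_sqrtr ?dotE; last by rewrite sumr_ge0// => j _; rewrite sqr_ge0.
by apply: eq_bigr => j _; rewrite expr2.
Qed.

Lemma bformDl p (G : 'M[R]_p) x y z : bform G (x + y) z = bform G x z + bform G y z.
Proof. by rewrite !bform_dot dotDl. Qed.

Lemma bformDr p (G : 'M[R]_p) x y z : bform G z (x + y) = bform G z x + bform G z y.
Proof. by rewrite !bform_dot mulmxDr dotDr. Qed.

Lemma bformZl p (G : 'M[R]_p) a x y : bform G (a *: x) y = a * bform G x y.
Proof. by rewrite !bform_dot dotZl. Qed.

Lemma bformZr p (G : 'M[R]_p) a x y : bform G x (a *: y) = a * bform G x y.
Proof. by rewrite !bform_dot -scalemxAr dotZr. Qed.

Lemma bformC p (G : 'M[R]_p) x y : G^T = G -> bform G x y = bform G y x.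
Proof. by move=> Gs; rewrite !bform_dot dotC dot_mull Gs. Qed.

Lemma bformB p (G H : 'M[R]_p) x y : bform (G - H) x y = bform G x y - bform H x y.
Proof. by rewrite !bform_dot mulmxBl dotDr dotNr. Qed.

Lemma bform_scalar p a (x y : 'cV[R]_p) : bform a%:M x y = a * dot x y.
Proof. by rewrite bform_dot mul_scalar_mx dotZr. Qed.

(** The sign of [c] is not known beforehand. For [c > 0] the minimizer [- b / c] gives the claim;
    for [c = 0] or [c < 0] with [b] nonzero, and for [b = 0] with [c < 0], an explicit [t] makes the
    polynomial negative. *)
Lemma quadratic_discriminant (a b c : R) :
  (forall t, 0 <= a + 2 * t * b + t ^+ 2 * c) -> b ^+ 2 <= a * c.
Proof.
move=> h; have a0 : 0 <= a by have := h 0; rewrite mulr0 mul0r expr0n/= mul0r !addr0.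
have [->|b0] := eqVneq b 0.
  rewrite expr0n/= mulr_ge0//; rewrite leNgt; apply/negP => c0.
  have := h (1 - (a + 2 * `|b| + 1) / c).
  have := h (- (a + 1) / c - 1 ).
  have ac : 0 <= (a + 1) / - c by rewrite divr_ge0//; lra.
  have e : (a + 1) / c = - ((a + 1) / -c) by rewrite invrN mulrN opprK.
  have [b0|b0] := leP b 0.
    rewrite mulNr e opprK; set u := (a + 1) / - c in ac *.
    have uc : u * c = - (a + 1).
      by rewrite /u invrN mulrN mulNr divfK// lt_eqF.
    have := h (u + 1); nra.
  set u := (a + 1) / - c in ac e *.
  have uc : u * c = - (a + 1).
    by rewrite /u invrN mulrN mulNr divfK// lt_eqF.
  have := h (- (u + 1)); nra.
have [c0|c0] := eqVneq c 0.
  have := h (- (a + 1) / (2 * b)); rewrite c0 !mulr0 addr0.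
  have -> : 2 * (- (a + 1) / (2 * b)) * b = - (a + 1) by field; rewrite b0.
  lra.
have := h (- b / c).
have -> : a + 2 * (- b / c) * b + (- b / c) ^+ 2 * c = a - b ^+ 2 / c by field.
have b2 : 0 < b ^+ 2 by rewrite exprn_even_gt0.
have [cp|cn] := ltP 0 c; first by rewrite subr_ge0 ler_pdivrMr.
have {}cn : c < 0 by rewrite lt_neqAle c0.
have := h (- ((a + 1) / b)).
have -> : a + 2 * (- ((a + 1) / b)) * b + (- ((a + 1) / b)) ^+ 2 * c = - a - 2 + ((a+1)/b)^+2 * c by field.
have : ((a + 1) / b) ^+ 2 * c <= 0 by rewrite mulr_ge0_le0// ?sqr_ge0// ltW.
lra.
Qed.

Lemma psd_cauchy_schwarz p (G : 'M[R]_p) x y : psdmx G ->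
  bform G x y ^+ 2 <= bform G x x * bform G y y.
Proof.
move=> [Gs Gp]; apply: quadratic_discriminant => t.
have := Gp (x + t *: y); rewrite -/(bform _ _ _).
rewrite bformDl !bformDr !bformZl !bformZr (bformC y x)//; lra.
Qed.

Lemma psd1 p : psdmx (1%:M : 'M[R]_p).
Proof.
split; first by rewrite trmx1.
by move=> v; rewrite mulmx1 dot_ge0.
Qed.

Lemma dot_cauchy_schwarz p (x y : 'cV[R]_p) :
  dot x y ^+ 2 <= dot x x * dot y y.
Proof. by have := psd_cauchy_schwarz x y (psd1 p); rewrite !bform_scalar !mul1r. Qed.

(** Cauchy-Schwarz between [G *m x] and [x]: the squared norm of [G *m x] is their form. *)
Lemma psd_ker p (G : 'M[R]_p) x : psdmx G -> bform G x x = 0 -> G *m x = 0.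
Proof.
move=> Gp x0; apply: dot_eq0; rewrite -bform_dot.
have := psd_cauchy_schwarz (G *m x) x Gp; rewrite x0 mulr0 => h.
by apply/eqP; rewrite -sqrf_eq0 eq_le h sqr_ge0.
Qed.

Lemma psd_eq0 p (G : 'M[R]_p) : psdmx G -> (forall x, bform G x x = 0) -> G = 0.
Proof.
move=> Gp G0; apply/matrixP => i j; have := psd_ker Gp (G0 (delta_mx j 0)).
by move=> /matrixP/(_ i 0); rewrite -colE !mxE.
Qed.

Lemma mx_norm_le m n (x : 'M[R]_(m, n)) e :
  0 <= e -> (forall i j, `|x i j| <= e) -> `|x| <= e.
Proof.
move=> e0 xe; rewrite [leLHS]/Num.norm /= mx_normrE.
by apply: bigmax_le => [//|[i j] _ /=].
Qed.

(** The form attains a maximum [mu] on the compact unit sphere. Then [mu%:M - G] is positive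
    semidefinite and its form vanishes at the maximizer, which therefore lies in its kernel and is
    an eigenvector. *)
Lemma rayleigh_max p (G : 'M[R]_p.+1) : G^T = G ->
  exists x, exists mu, [/\ dot x x = 1, G *m x = mu *: x &
    forall y, bform G y y <= mu * dot y y].
Proof.
move=> Gs.
pose f (v : 'rV[R]_p.+1) := bform G v^T v^T.
pose S := [set v : 'rV[R]_p.+1 | dot v^T v^T = 1].
have ccoord (j : 'I_p.+1) : continuous (fun v : 'rV[R]_p.+1 => v 0 j).
  exact: coord_continuous.
have cprod (j l : 'I_p.+1) :
    continuous (fun v : 'rV[R]_p.+1 => v 0 j * v 0 l).
  by move=> v; apply: continuousM; exact: ccoord.
have cf : continuous f.
  rewrite (_ : f = fun v => \sum_j \sum_l G j l * (v 0 j * v 0 l)).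
    apply: continuous_big => [|j _]; first exact: add_continuous.
    apply: continuous_big => [|l _]; first exact: add_continuous.
    by move=> v; apply: (@continuousM _ _ (cst (G j l)) (fun v : 'rV[R]_p.+1 => v 0 j * v 0 l) v); [exact: cst_continuous|exact: cprod].
  apply/funext => v; rewrite /f bformE; apply: eq_bigr => j _.
  by apply: eq_bigr => l _; rewrite !mxE.
have cd : continuous (fun v : 'rV[R]_p.+1 => dot v^T v^T).
  rewrite (_ : (fun _ => _) = fun v : 'rV[R]_p.+1 => \sum_j (v 0 j * v 0 j)).
    apply: continuous_big => [|j _]; first exact: add_continuous.
    exact: cprod.
  by apply/funext => v; rewrite dotE; apply: eq_bigr => j _; rewrite !mxE.
have S0 : S !=set0.
  exists (delta_mx 0 0); rewrite /S /= dotE (bigD1 0)//= big1 => [|j j0].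
    by rewrite !mxE !eqxx mulr1 addr0.
  by rewrite !mxE !eqxx (negPf j0) mulr0.
have Sc : compact S.
  apply: bounded_closed_compact.
    exists 1; split=> // y y1 v; rewrite /S /= => vS.
    apply: mx_norm_le => [|i j]; first by rewrite ltW// (lt_trans _ y1).
    rewrite ord1 (le_trans _ (ltW y1))//.
    have := sqr_coord_le_dot v^T j; rewrite vS mxE -real_normK ?num_real//.
    by rewrite expr_le1.
  rewrite (_ : S = (fun v : 'rV[R]_p.+1 => dot v^T v^T) @^-1` [set 1])//.
  by apply: preimage_closed => // v _; exact: cd.
have [c cS cmax] := EVT_max_rV S0 Sc (continuous_subspaceT cf).
have c1 : dot c^T c^T = 1 by rewrite inE in cS.
pose mu := f c.
have ub y : bform G y y <= mu * dot y y.
  have [y0|y0] := eqVneq (dot y y) 0.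
    by rewrite y0 mulr0 (dot_eq0 y0) bform_dot mulmx0 /dot mulmx0 mxE.
  have yp : 0 < dot y y by rewrite lt_neqAle eq_sym y0 dot_ge0.
  pose z := (Num.sqrt (dot y y))^-1 *: y.
  have sq : Num.sqrt (dot y y) ^+ 2 = dot y y by rewrite sqr_sqrtr ?dot_ge0.
  have s0 : Num.sqrt (dot y y) != 0 by rewrite gt_eqF// sqrtr_gt0.
  have : f z^T <= mu.
    apply: cmax; rewrite inE /S /= trmxK /z dotZl dotZr mulrA -expr2 exprVn sq.
    by rewrite mulVf.
  rewrite /f trmxK /z bformZl bformZr mulrA -expr2 exprVn sq.
  by rewrite mulrC ler_pdivrMr.
exists c^T, mu; split=> //.
have Hp : psdmx (mu%:M - G).
  split; first by rewrite linearB /= tr_scalar_mx Gs.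
  by move=> v; rewrite -/(bform _ _ _) bformB bform_scalar subr_ge0.
have : (mu%:M - G) *m c^T = 0.
  by apply: psd_ker => //; rewrite bformB bform_scalar c1 mulr1 subrr.
by rewrite mulmxBl mul_scalar_mx => /eqP; rewrite subr_eq0 => /eqP <-.
Qed.

Lemma eigenvalueP_col p (G : 'M[R]_p) a : G^T = G -> eigenvalue G a ->
  exists2 x : 'cV_p, G *m x = a *: x & 0 < dot x x.
Proof.
move=> Gs /eigenvalueP [v vG v0]; exists v^T.
  by rewrite -{1}Gs -trmx_mul vG linearZ.
rewrite lt_neqAle dot_ge0 andbT eq_sym; apply: contra v0 => /eqP/dot_eq0 v0.
by rewrite -(trmxK v) v0 trmx0.
Qed.

Lemma eigenvalue_col p (G : 'M[R]_p) a (x : 'cV_p) : G^T = G ->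
  G *m x = a *: x -> dot x x != 0 -> eigenvalue G a.
Proof.
move=> Gs Gx x0; apply/eigenvalueP; exists x^T.
  by rewrite -{1}Gs -trmx_mul Gx linearZ.
apply: contra x0 => /eqP x0; by rewrite /dot x0 mul0mx mxE.
Qed.

Lemma dot0 (x y : 'cV[R]_0) : dot x y = 0.
Proof. by rewrite dotE big_ord0. Qed.

(** The Rayleigh maximum is an eigenvalue and bounds all eigenvalues, so the supremum is over a
    nonempty bounded set and not a default value. In dimension 0 both sides are 0. *)
Lemma le_eig_max p (G : 'M[R]_p) y : G^T = G ->
  bform G y y <= eig_max G * dot y y.
Proof.
case: p G y => [|p] G y Gs; first by rewrite bform_dot !dot0 mulr0.
have [x [mu [x1 Gx ub]]] := rayleigh_max Gs.
apply: (le_trans (ub y)); rewrite ler_wpM2r ?dot_ge0//.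
apply: ub_le_sup; last by apply: (eigenvalue_col Gs Gx); rewrite x1 oner_eq0.
exists mu => a /= /(eigenvalueP_col Gs) [z Gz zp].
have := ub z; rewrite bform_dot Gz dotZr.
by rewrite ler_pM2r.
Qed.

Lemma ge_eig_min p (G : 'M[R]_p) y : G^T = G ->
  eig_min G * dot y y <= bform G y y.
Proof.
case: p G y => [|p] G y Gs; first by rewrite bform_dot !dot0 mulr0.
have Ns : (- G)^T = - G by rewrite linearN /= Gs.
have [x [mu [x1 Gx ub]]] := rayleigh_max Ns.
have lb z : - mu * dot z z <= bform G z z.
  have := ub z; rewrite -(sub0r G) bformB bform_dot mul0mx.
  by rewrite dotC dot0l sub0r mulNr lerNl.
apply: le_trans (lb y); rewrite ler_wpM2r ?dot_ge0//.
apply: ge_inf; last first.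
  apply: (@eigenvalue_col _ _ _ x) => //; last by rewrite x1 oner_eq0.
  by rewrite scaleNr -Gx mulNmx opprK.
exists (- mu) => a /= /(eigenvalueP_col Gs) [z Gz zp].
have := lb z; rewrite [bform _ _ _]bform_dot Gz dotZr.
by rewrite ler_pM2r.
Qed.

Lemma trmx_outer p (x : 'cV[R]_p) : (x *m x^T)^T = x *m x^T.
Proof. by rewrite trmx_mul trmxK. Qed.

Lemma outer_mul p (x y : 'cV[R]_p) : x *m x^T *m y = dot x y *: x.
Proof.
by rewrite -mulmxA [x^T *m y]mx11_scalar -/(dot x y) mul_mx_scalar.
Qed.

(** Induction on the rank by deflation: subtracting [mu *: (x *m x^T)] for a top unit eigenvector
    [x] leaves a positive semidefinite matrix of smaller rank. Its root [B] kills [x], so adding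
    [Num.sqrt mu *: (x *m x^T)] creates no cross terms in the square. *)
Lemma psd_sqrt_exists p (G : 'M[R]_p) : psdmx G ->
  exists B, psdmx B /\ B *m B = G.
Proof.
case: p G => [|p] G Gp.
  exists G; split=> //; by apply/matrixP => -[].
elim: (\rank G) {-2}G (leqnn (\rank G)) Gp => {G} [|r IH] G rG Gp.
  have G0 : G = 0 by apply/eqP; rewrite -mxrank_eq0 -leqn0.
  exists 0; rewrite mul0mx G0; split=> //; split; first by rewrite trmx0.
  by move=> v; rewrite mulmx0 mul0mx mxE.
have [Gs Gpos] := Gp.
have [x [mu [x1 Gx ub]]] := rayleigh_max Gs.
have mu0 : 0 <= mu.
  by have := Gpos x; rewrite -/(bform _ _ _) bform_dot Gx dotZr x1 mulr1.
(* A zero maximum forces [G = 0], so the rank bound of the induction holds trivially. *)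
have [mu00|munz] := eqVneq mu 0.
  apply: (IH G) => //; rewrite (@psd_eq0 _ G) ?mxrank0// => y.
  by apply/eqP; rewrite eq_le Gpos andbT (le_trans (ub y))// mu00 mul0r.
pose H := G - mu *: (x *m x^T).
have Hs : H^T = H by rewrite /H linearB /= linearZ /= trmx_outer Gs.
have Hx : H *m x = 0.
  by rewrite /H mulmxBl -scalemxAl outer_mul x1 scale1r Gx subrr.
have Gdot y : dot x (G *m y) = mu * dot x y.
  by rewrite -{1}Gs -dot_mull Gx dotZl.
have HE y : H *m y = G *m y - (mu * dot x y) *: x.
  by rewrite /H mulmxBl -scalemxAl outer_mul scalerA.
have Hp : psdmx H.
  split=> // v; rewrite -/(bform _ _ _).
  (* The form of [H] at [v] is the form of [G] at the projection of [v] orthogonal to [x]. *)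
  have := Gpos (v - dot x v *: x); rewrite -/(bform _ _ _) bform_dot.
  rewrite mulmxBr -scalemxAr Gx dotDl !dotDr !dotNl !dotNr !dotZl !dotZr Gdot x1.
  rewrite bform_dot HE dotDr dotNr !dotZr (dotC v x); lra.
have [|B [[Bs Bp] BB]] := IH H _ Hp.
  rewrite -ltnS; apply: leq_trans rG.
  (* The rank drops because the kernel grows by [x]: a kernel vector of [G] is orthogonal to [x]
     since [mu] is nonzero, hence stays in the kernel of [H]. *)
  have : (kermx G < kermx H)%MS.
    rewrite ltmxE; apply/andP; split.
      apply/rV_subP => v /sub_kermxP vG; apply/sub_kermxP.
      have Gv : G *m v^T = 0 by rewrite -{1}Gs -trmx_mul vG trmx0.
      have xv : dot x v^T = 0.
        have := Gdot v^T; rewrite Gv {1}/dot mulmx0 mxE => /esym/eqP.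
        by rewrite mulf_eq0 (negPf munz) => /eqP.
      apply: trmx_inj; rewrite trmx_mul Hs HE Gv xv mulr0 scale0r subr0 trmx0 //.
    apply/negP => /rV_subP/(_ x^T).
    have xH : (x^T <= kermx H)%MS.
      by apply/sub_kermxP; apply: trmx_inj; rewrite trmx_mul Hs trmxK Hx trmx0.
    move=> /(_ xH)/sub_kermxP xG.
    have : G *m x = 0 by rewrite -{1}Gs -{1}(trmxK x) -trmx_mul xG trmx0.
    rewrite Gx => /(congr1 (dot x)); rewrite dotZr x1 mulr1 {1}/dot mulmx0 mxE.
    by move/eqP; apply/negP.
  by move=> /rank_ltmx; rewrite !mxrank_ker ltn_sub2lE ?rank_leq_row.
have Bx : B *m x = 0.
  by apply: dot_eq0; rewrite dot_mull mulmxA Bs BB Hx /dot mulmx0 mxE.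
have xB : x^T *m B = 0 by rewrite -Bs -trmx_mul Bx trmx0.
have xx : x *m x^T *m (x *m x^T) = x *m x^T.
  by rewrite mulmxA outer_mul x1 scale1r.
exists (B + Num.sqrt mu *: (x *m x^T)); split.
  split; first by rewrite linearD /= linearZ /= trmx_outer Bs.
  move=> v; rewrite -/(bform _ _ _) bform_dot mulmxDl -scalemxAl outer_mul.
  rewrite dotDr -bform_dot addr_ge0//; first exact: Bp.
  rewrite !dotZr mulr_ge0 ?sqrtr_ge0// (dotC v) -expr2 sqr_ge0 //.
rewrite mulmxDl !mulmxDr BB -!scalemxAr -!scalemxAl xx scalerA -expr2.
rewrite sqr_sqrtr// mulmxA Bx mul0mx -mulmxA xB mulmx0 !scaler0 addr0 add0r.
by rewrite /H subrK.
Qed.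

Lemma sqrtmxP p (G : 'M[R]_p) : psdmx G ->
  psdmx (sqrtmx G) /\ sqrtmx G *m sqrtmx G = G.
Proof.
move=> /psd_sqrt_exists [B hB].
rewrite /sqrtmx; case: xgetP => [C -> //|/(_ B)]; by case.
Qed.

Lemma invsqrtmxP p (G : 'M[R]_p) : psdmx G -> G \in unitmx ->
  (invsqrtmx G)^T = invsqrtmx G /\ invsqrtmx G *m G *m invsqrtmx G = 1%:M.
Proof.
move=> /sqrtmxP [[Bs _] BB] uG; rewrite /invsqrtmx; set B := sqrtmx G in Bs BB *.
have uB : B \in unitmx by move: uG; rewrite -BB unitmx_mul => /andP[].
split; first by rewrite trmx_inv Bs.
by rewrite -BB mulmxA mulVmx// mul1mx mulmxV.
Qed.

Lemma posdef_unitmx p (G : 'M[R]_p) : G^T = G ->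
  (forall x, 0 < dot x x -> 0 < bform G x x) -> G \in unitmx.
Proof.
move=> Gs Gp; rewrite -row_free_unit -kermx_eq0; apply/eqP/row_matrixP => i.
rewrite row0; set v := row i _.
have vG : v *m G = 0 by rewrite /v -row_mul mulmx_ker row0.
have Gv : G *m v^T = 0 by rewrite -{1}Gs -trmx_mul vG trmx0.
have [v0|v0] := eqVneq (dot v^T v^T) 0.
  by apply: trmx_inj; rewrite (dot_eq0 v0) trmx0.
have /Gp : 0 < dot v^T v^T by rewrite lt_neqAle eq_sym v0 dot_ge0.
by rewrite bform_dot Gv /dot mulmx0 mxE ltxx.
Qed.

(** Cauchy-Schwarz for [G] between [invmx G *m v] and [x]. In its use [v] is the score and [x] an
    estimation error or a direction. *)
Lemma inv_form_cauchy_schwarz p (G : 'M[R]_p) v x : psdmx G -> G \in unitmx ->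
  dot v x ^+ 2 <= bform (invmx G) v v * bform G x x.
Proof.
move=> Gp uG; have [Gs _] := Gp.
have -> : dot v x = bform G (invmx G *m v) x.
  by rewrite bform_dot dot_mull trmx_inv Gs mulKmx.
have -> : bform (invmx G) v v = bform G (invmx G *m v) (invmx G *m v).
  by rewrite !bform_dot mulKVmx// dotC.
exact: psd_cauchy_schwarz.
Qed.

End BilinearForms.

(** * Deterministic analysis of the SCAD minimizer *)

Section ScadOracle.
Context {R : realType}.
Implicit Types (lambda a theta : R).

Lemma scad0 lambda a : 0 < lambda -> scad lambda a 0 = 0.
Proof. by move=> l0; rewrite /scad normr0 ltW// mulr0. Qed.

Lemma scad_small lambda a theta : `|theta| <= lambda ->
  scad lambda a theta = lambda * `|theta|.
Proof. by rewrite /scad => ->. Qed.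

Lemma scad_large lambda a theta : 2 < a -> 0 < lambda ->
  a * lambda < `|theta| -> scad lambda a theta = (a + 1) * lambda ^+ 2 / 2.
Proof.
move=> a2 l0 h; rewrite /scad leNgt (lt_trans _ h)/=; last by nra.
by rewrite leNgt h.
Qed.

Lemma scad_bounds lambda a theta : 2 < a -> 0 < lambda ->
  0 <= scad lambda a theta <= (a + 1) * lambda ^+ 2 / 2.
Proof.
move=> a2 l0; rewrite /scad; set t := `|theta|.
have t0 : 0 <= t by exact: normr_ge0.
rewrite -[theta ^+ 2]real_normK ?num_real// -/t.
have la : 0 <= lambda ^+ 2 * (a - 2) by rewrite mulr_ge0 ?sqr_ge0//; lra.
have l2 : 0 <= lambda ^+ 2 by exact: sqr_ge0.
have [tl|ltt] := leP t lambda.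
  have llt : 0 <= lambda * (lambda - t) by apply: mulr_ge0; [exact: ltW|rewrite subr_ge0].
  by apply/andP; split; [rewrite mulr_ge0// ltW|lra].
have [ta|at_] := leP t (a * lambda); last by apply/andP; split; lra.
have a1 : 0 < 2 * (a - 1) by lra.
apply/andP; split.
  rewrite divr_ge0 ?(ltW a1)//.
  (* The numerator of the middle branch is the sum of this product and the next one. *)
  have : 0 <= (t - lambda) * (a * lambda - t) by rewrite mulr_ge0// subr_ge0// ltW.
  have : 0 <= lambda * (a - 1) * (t + lambda).
    by apply: mulr_ge0; [apply: mulr_ge0|]; lra.
  lra.
rewrite ler_pdivrMr// -subr_ge0.
have -> : (a + 1) * lambda ^+ 2 / 2 * (2 * (a - 1)) -
   - (t ^+ 2 - 2 * a * lambda * t + lambda ^+ 2) = (t - a * lambda) ^+ 2 by field.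
exact: sqr_ge0.
Qed.

(** Near 0 the linear term dominates. For [s] at most [|B| / (|A| + 1)] the point [s * Num.sg B]
    gives at most [s * |B| - 2 * s * |B|], which is negative unless [B = 0]. *)
Lemma quadratic_stationary (delta A B : R) : 0 < delta ->
  (forall t, `|t| <= delta -> 0 <= t ^+ 2 * A - 2 * t * B) -> B = 0.
Proof.
move=> d0 h; apply/eqP; rewrite -normr_le0 leNgt; apply/negP => B0.
pose s := Num.min delta (`|B| / (`|A| + 1)).
have A1 : 0 < `|A| + 1 by rewrite ltr_wpDl.
have s0 : 0 < s by rewrite lt_min d0 divr_gt0.
have sA : s * `|A| <= `|B|.
  apply: (@le_trans _ _ (`|B| / (`|A| + 1) * `|A|)).
    by rewrite ler_wpM2r// ge_min lexx orbT.
  rewrite -mulrA ler_piMr// mulrC ler_pdivrMr ?mul1r ?lerDl//.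
have := h (s * Num.sg B).
rewrite normrM normr_sg -normr_gt0 B0 mulr1 ger0_norm ?(ltW s0)// ge_min lexx.
move=> /(_ isT).
rewrite exprMn sqr_sg -normr_gt0 B0 mulr1.
rewrite (_ : 2 * (s * Num.sg B) * B = 2 * s * `|B|); last first.
  by rewrite -mulrA -(mulrA s) -normrEsg mulrA.
have := ler_norm A; nra.
Qed.

(** The limit as [t] tends to 0, with an explicit small [t] in place of a limit argument. *)
Lemma le_of_le_add_mul (x y z : R) :
  (forall t, 0 < t <= 1 -> x <= t * y + z) -> x <= z.
Proof.
move=> h; rewrite leNgt; apply/negP => zx.
pose s := Num.min 1 ((x - z) / (2 * (`|y| + 1))).
have y1 : 0 < 2 * (`|y| + 1) by rewrite mulr_gt0// ltr_wpDl.
have s0 : 0 < s by rewrite lt_min ltr01 divr_gt0// subr_gt0.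
have : s * (2 * (`|y| + 1)) <= x - z by rewrite -ler_pdivlMr// ge_min lexx orbT.
have := h s; rewrite s0 ge_min lexx => /(_ isT).
have := ler_norm y; nra.
Qed.

Lemma sumsq_le_sqrsum (n : nat) (x : 'cV[R]_n) :
  dot x x <= (\sum_j `|x j 0|) ^+ 2.
Proof.
rewrite dotE expr2 mulr_suml; apply: ler_sum => j _.
rewrite -expr2 -real_normK ?num_real// expr2 ler_wpM2l//.
by rewrite (bigD1 j)//= lerDl sumr_ge0.
Qed.

Lemma dot_delta p (x : 'cV[R]_p) j : dot x (delta_mx j 0) = x j 0.
Proof.
rewrite dotE (bigD1 j)//= big1 ?addr0 => [|i ij].
  by rewrite mxE !eqxx mulr1.
by rewrite mxE (negPf ij) mulr0.
Qed.

Definition scad_penalty p lambda a (b : 'cV[R]_p) := \sum_(j < p) scad lambda a (b j 0).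

(** Minimality on a line through [bh]: the right side is the exact change of the residual sum of
    squares. Minimality is later used only through this inequality, along the total error, along the
    null coordinates, and along single signal coordinates. *)
Lemma minimizer_direction n p (Y : 'cV[R]_n) (X : 'M[R]_(n, p)) lambda a bh :
  (forall b, scad_objective Y X lambda a bh <= scad_objective Y X lambda a b) ->
  forall h t, n%:R * (scad_penalty lambda a bh - scad_penalty lambda a (bh + t *: h))
    <= t ^+ 2 * dot (X *m h) (X *m h) - 2 * t * dot (Y - X *m bh) (X *m h).
Proof.
move=> hmin h t; have := hmin (bh + t *: h).
rewrite /scad_objective -!/(scad_penalty _ _ _) !enormE mulmxDr -scalemxAr.
rewrite opprD addrA; move: (Y - X *m bh) (X *m h) => r u.
rewrite dotDl !dotDr !dotNl !dotNr !dotZl !dotZr (dotC u r).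
lra.
Qed.

(** Among the numerical hypotheses, [N1] brings the first error bound below [b / 2] in every
    coordinate, [N2] then places the signal coordinates beyond [a * lambda], [N3] brings the
    improved bound below [lambda], and [N4] makes the slope of the penalty exceed the score on the
    null block. [S] stands for the squared norm of the score in the inverse form of [G], and [mu]
    bounds [G] on the null block. *)
Lemma scad_oracle_normal_equations (n k m : nat) (X : 'M[R]_(n, k + m))
    (eps : 'cV[R]_n) (beta bh : 'cV[R]_(k + m)) (G : 'M[R]_(k + m))
    (a lambda rho mu b S : R) :
  2 < a -> 0 < lambda -> (0 < n)%N -> 0 < rho ->
  dsubmx beta = 0 -> (forall j, b <= `|usubmx beta j 0|) ->
  (forall c, scad_objective (X *m beta + eps) X lambda a bh <=
             scad_objective (X *m beta + eps) X lambda a c) ->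
  (forall x, rho * dot x x <= bform G x x) ->
  (forall x, n%:R * bform G x x / 2 <= dot (X *m x) (X *m x)) ->
  (forall x2 : 'cV[R]_m, dot (X *m col_mx 0 x2) (X *m col_mx 0 x2) <=
     2 * n%:R * mu * dot x2 x2) ->
  (forall x2 : 'cV[R]_m, bform G (col_mx 0 x2) (col_mx 0 x2) <= mu * dot x2 x2) ->
  0 <= S -> (forall x, dot (X^T *m eps) x ^+ 2 <= S * bform G x x) ->
  16 * S / n%:R ^+ 2 + 2 * k%:R * (a + 1) * lambda ^+ 2 < rho * b ^+ 2 / 4 ->
  0 < b -> a * lambda < b / 2 ->
  16 * S / n%:R ^+ 2 < rho * lambda ^+ 2 ->
  100 * S * mu < n%:R ^+ 2 * lambda ^+ 2 ->
  dsubmx bh = 0 /\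
  (lsubmx X)^T *m lsubmx X *m (usubmx bh - usubmx beta) = (lsubmx X)^T *m eps.
Proof.
move=> a2 l0 n0 rho0 beta2 bmin hmin Grho E1 E1' G2 S0 CS N1 b0 N2 N3 N4.
have N0 : 0 < n%:R :> R by rewrite ltr0n.
set N : R := n%:R in E1 E1' N1 N3 N4 N0 *.
pose th := bh - beta; pose v := X^T *m eps.
pose q := bform G th th; pose Q := dot (X *m th) (X *m th); pose c := dot v th.
have resE : X *m beta + eps - X *m bh = eps - X *m th.
  by rewrite /th mulmxBr opprB addrAC addrA addrC addrA.
have dvX x : dot eps (X *m x) = dot v x by rewrite dotC dot_mull dotC.
have q0 : 0 <= q by apply: le_trans (Grho th); rewrite mulr_ge0 ?dot_ge0 ?(ltW rho0).
have cS : c ^+ 2 <= S * q by exact: CS.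
have qQ : N * q / 2 <= Q by exact: E1.
have thq j : rho * (th j 0) ^+ 2 <= q.
  by apply: le_trans (Grho th); rewrite ler_wpM2l ?(ltW rho0)// sqr_coord_le_dot.
(* The step [t = -1] along [th] leads from [bh] to [beta]. *)
have dir1 : N * (scad_penalty lambda a bh - scad_penalty lambda a beta) <= 2 * c - Q.
  have := minimizer_direction hmin th (-1).
  have -> : bh + -1 *: th = beta by rewrite scaleN1r /th opprB addrC subrK.
  rewrite resE dotDl dotNl dvX -/c -/Q -/N.
  lra.
have hth j : bh j 0 = beta j 0 + th j 0 by rewrite /th !mxE; ring.
have penS (w : 'cV[R]_(k + m)) : scad_penalty lambda a w =
    \sum_j scad lambda a (w (lshift m j) 0) + \sum_j scad lambda a (w (rshift k j) 0).
  by rewrite /scad_penalty big_split_ord.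
have beta2j j : beta (rshift k j) 0 = 0.
  by have /matrixP/(_ j 0) := beta2; rewrite !mxE.
have bmin' j : b <= `|beta (lshift m j) 0| by have := bmin j; rewrite mxE.
have sb := scad_bounds _ a2 l0.
(* AM-GM applied to [c ^+ 2 <= S * q] *)
have cub : c <= 2 * S / N + N * q / 8.
  rewrite leNgt; apply/negP => h.
  have z0 : 0 <= 2 * S / N by rewrite divr_ge0 ?mulr_ge0// ltW.
  have z1 : 0 <= N * q / 8 by rewrite divr_ge0 ?mulr_ge0// ltW.
  have : (2 * S / N + N * q / 8) ^+ 2 < c ^+ 2 by rewrite ltr_pXn2r// nnegrE ?addr_ge0// (le_trans _ (ltW h))// addr_ge0.
  have -> : (2 * S / N + N * q / 8) ^+ 2 = (2 * S / N - N * q / 8) ^+ 2 + S * q.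
    by field; rewrite gt_eqF.
  have := sqr_ge0 (2 * S / N - N * q / 8); lra.
have pen1 : scad_penalty lambda a beta - scad_penalty lambda a bh <= k%:R * ((a + 1) * lambda ^+ 2 / 2).
  rewrite !penS.
  have -> : \sum_j scad lambda a (beta (rshift k j) 0) = 0.
    by rewrite big1// => j _; rewrite beta2j scad0.
  have h1 : \sum_j scad lambda a (beta (lshift m j) 0) <= k%:R * ((a + 1) * lambda ^+ 2 / 2).
    rewrite mulr_natl; apply: (@le_trans _ _ (\sum_(j < k) (a + 1) * lambda ^+ 2 / 2)).
      by apply: ler_sum => j _; have /andP[] := sb (beta (lshift m j) 0).
    by rewrite sumr_const card_ord.
  have h2 : 0 <= \sum_j scad lambda a (bh (lshift m j) 0).
    by apply: sumr_ge0 => j _; have /andP[] := sb (bh (lshift m j) 0).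
  have h3 : 0 <= \sum_j scad lambda a (bh (rshift k j) 0).
    by apply: sumr_ge0 => j _; have /andP[] := sb (bh (rshift k j) 0).
  lra.
(* By [cub], [2 * c] costs at most [N * q / 4], half of the available curvature [N * q / 2];
   multiplying what is left by 4 gives the constants. *)
have q1 : q <= 16 * S / N ^+ 2 + 2 * k%:R * (a + 1) * lambda ^+ 2.
  have h : N * q <= N * (16 * S / N ^+ 2 + 2 * k%:R * (a + 1) * lambda ^+ 2).
    have -> : N * (16 * S / N ^+ 2 + 2 * k%:R * (a + 1) * lambda ^+ 2) =
      8 * (2 * S / N) + 4 * (N * (k%:R * ((a + 1) * lambda ^+ 2 / 2))).
      by field; rewrite gt_eqF.
    have : N * (scad_penalty lambda a beta - scad_penalty lambda a bh) <= N * (k%:R * ((a + 1) * lambda ^+ 2 / 2)).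
      by rewrite ler_wpM2l// ltW.
    lra.
  by rewrite ler_pM2l in h.
have thb j : `|th j 0| < b / 2.
  rewrite ltNge; apply/negP => h.
  have : (b / 2) ^+ 2 <= th j 0 ^+ 2.
    rewrite -[leRHS]real_normK ?num_real// ler_pXn2r// nnegrE//.
    by rewrite divr_ge0// ltW.
  have := thq j; move=> h1 h2.
  have : rho * (b / 2) ^+ 2 <= q by apply: le_trans h1; rewrite ler_wpM2l// ltW.
  rewrite (_ : rho * (b / 2) ^+ 2 = rho * b ^+ 2 / 4); last by field.
  lra.
have al0 : 0 < a * lambda by rewrite mulr_gt0//; lra.
have bigb j : a * lambda < `|bh (lshift m j) 0|.
  rewrite hth; have := lerB_normD (beta (lshift m j) 0) (th (lshift m j) 0).
  have := bmin' j; have := thb (lshift m j); lra.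
(* The signal coordinates of [bh] and of [beta] both lie where the penalty is flat. *)
have pen2 : 0 <= scad_penalty lambda a bh - scad_penalty lambda a beta.
  rewrite !penS.
  have -> : \sum_j scad lambda a (beta (rshift k j) 0) = 0.
    by rewrite big1// => j _; rewrite beta2j scad0.
  have -> : \sum_j scad lambda a (beta (lshift m j) 0) =
            \sum_j scad lambda a (bh (lshift m j) 0).
    apply: eq_bigr => j _; rewrite !scad_large//.
    have := bmin' j; lra.
  have h3 : 0 <= \sum_j scad lambda a (bh (rshift k j) 0).
    by apply: sumr_ge0 => j _; have /andP[] := sb (bh (rshift k j) 0).
  lra.
have Q2c : Q <= 2 * c.
  have : 0 <= N * (scad_penalty lambda a bh - scad_penalty lambda a beta).
    by rewrite mulr_ge0// ltW.
  lra.
have Q0 : 0 <= Q by exact: dot_ge0.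
have q2 : q <= 2 * Q / N.
  by rewrite ler_pdivlMr//; lra.
(* Once the penalty terms are gone, [Q <= 2 * c], [c ^+ 2 <= S * q] and [q <= 2 * Q / N] close up to
   [Q ^+ 2 <= 8 * S / N * Q], a bound free of [lambda]. *)
have QS : Q <= 8 * S / N.
  have [Qz|Qz] := eqVneq Q 0; first by rewrite Qz divr_ge0 ?mulr_ge0// ltW.
  have Qp : 0 < Q by rewrite lt_neqAle eq_sym Qz.
  have h : Q ^+ 2 <= 8 * S / N * Q.
    have -> : 8 * S / N * Q = 4 * (S * (2 * Q / N)) by field; rewrite gt_eqF.
    have : S * q <= S * (2 * Q / N) by rewrite ler_wpM2l.
    have : Q ^+ 2 <= (2 * c) ^+ 2 by rewrite ler_pXn2r// nnegrE// (le_trans Q0).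
    by rewrite exprMn; lra.
  by rewrite expr2 ler_pM2r in h.
have qS : q <= 16 * S / N ^+ 2.
  apply: (le_trans q2); rewrite ler_pdivrMr//.
  have -> : 16 * S / N ^+ 2 * N = 2 * (8 * S / N) by field; rewrite gt_eqF.
  lra.
have thl j : `|th j 0| <= lambda.
  rewrite leNgt; apply/negP => h.
  have : lambda ^+ 2 <= th j 0 ^+ 2.
    by rewrite -[leRHS]real_normK ?num_real// ler_pXn2r// ?nnegrE// ltW.
  move=> h2; have : rho * lambda ^+ 2 <= q.
    by apply: le_trans (thq j); rewrite ler_wpM2l// ltW.
  lra.
have th2 j : th (rshift k j) 0 = bh (rshift k j) 0 by rewrite hth beta2j add0r.
pose x2 := dsubmx bh.
have x2E j : x2 j 0 = bh (rshift k j) 0 by rewrite mxE.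
pose h := col_mx (0 : 'cV[R]_k) x2; pose u := X *m h.
pose L := \sum_j `|x2 j 0|.
have hl j : h (lshift m j) 0 = 0 by rewrite /h col_mxEu mxE.
have hr j : h (rshift k j) 0 = x2 j 0 by rewrite /h col_mxEd.
have shiftE (y : 'cV[R]_(k + m)) t i : (bh + t *: y) i 0 = bh i 0 + t * y i 0.
  by rewrite !mxE.
(* Shrink the null coordinates of [bh], which lie where the penalty is linear. *)
have first : N * (lambda * L) <= 2 * (dot v h - dot (X *m th) u).
  apply: le_of_le_add_mul (dot u u) _ _ => t /andP[t0 t1].
  have := minimizer_direction hmin h (- t).
  rewrite resE dotDl dotNl dvX -/u -/N.
  have -> : scad_penalty lambda a bh - scad_penalty lambda a (bh + - t *: h) =
      t * (lambda * L).
    rewrite !penS.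
    rewrite (_ : \sum_j scad lambda a ((bh + - t *: h) (lshift m j) 0) =
      \sum_j scad lambda a (bh (lshift m j) 0)); last first.
      by apply: eq_bigr => j _; rewrite shiftE hl mulr0 addr0.
    rewrite opprD addrACA subrr add0r -sumrB /L !mulr_sumr.
    apply: eq_bigr => j _; rewrite shiftE hr -x2E.
    have xl : `|x2 j 0| <= lambda by rewrite x2E -th2.
    have -> : x2 j 0 + - t * x2 j 0 = (1 - t) * x2 j 0 by ring.
    rewrite !scad_small//.
      rewrite normrM (ger0_norm (x := 1 - t)); last by rewrite subr_ge0.
      ring.
    rewrite normrM (ger0_norm (x := 1 - t)); last by rewrite subr_ge0.
    have := normr_ge0 (x2 j 0); nra.
  move=> H; rewrite -(ler_pM2l t0); apply: le_trans (le_trans _ H) _; lra.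
have L0 : 0 <= L by exact: sumr_ge0.
(* The right side of [first] is at most [2 * (w + 4 * w) = 10 * w]: the score contributes [w], and
   the fitted error contributes [4 * w] by [QS] and [E1']. Since the Euclidean norm of [x2] is at
   most [L], squaring contradicts [N4], whose constant is [10 ^+ 2], unless [L = 0]. *)
have x20 : x2 = 0.
  pose w := Num.sqrt (S * mu * dot x2 x2).
  have mt0 : 0 <= mu * dot x2 x2.
    by apply: le_trans (G2 x2); apply: le_trans (Grho _); rewrite mulr_ge0 ?dot_ge0 ?(ltW rho0).
  have w0 : 0 <= w by exact: sqrtr_ge0.
  have w2 : w ^+ 2 = S * mu * dot x2 x2 by rewrite sqr_sqrtr// -mulrA mulr_ge0.
  have c1 : `|dot v h| <= w.
    rewrite -(ler_pXn2r (n := 2))// ?nnegrE// real_normK ?num_real// w2 -mulrA.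
    by apply: (le_trans (CS h)); rewrite ler_wpM2l//; exact: G2.
  have c2 : `|dot (X *m th) u| <= 4 * w.
    rewrite -(ler_pXn2r (n := 2))// ?nnegrE ?mulr_ge0// real_normK ?num_real//.
    rewrite exprMn w2.
    apply: (le_trans (dot_cauchy_schwarz _ _)).
    apply: (@le_trans _ _ (8 * S / N * (2 * N * mu * dot x2 x2))).
      by apply: ler_pM => //; [exact: dot_ge0|exact: E1'].
    by rewrite le_eqVlt; apply/orP; left; apply/eqP; field; rewrite gt_eqF.
  have c3 : N * (lambda * L) <= 10 * w.
    have := ler_norm (dot v h); have := ler_norm (- dot (X *m th) u).
    rewrite normrN; lra.
  have c4 : (N * (lambda * L)) ^+ 2 <= 100 * (S * mu * dot x2 x2).
    rewrite -w2 (_ : 100 * w ^+ 2 = (10 * w) ^+ 2); last by ring.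
    by rewrite ler_pXn2r// ?nnegrE ?mulr_ge0// ltW.
  have Lz : L = 0.
    apply/eqP; rewrite -sqrf_eq0.
    apply: contraT => Ln.
    have Lp : 0 < L ^+ 2 by rewrite lt_neqAle eq_sym Ln sqr_ge0.
    have [Sm|Sm] := leP 0 (S * mu).
      have : S * mu * dot x2 x2 <= S * mu * L ^+ 2 by rewrite ler_wpM2l// sumsq_le_sqrsum.
      have : 100 * S * mu * L ^+ 2 < N ^+ 2 * lambda ^+ 2 * L ^+ 2 by rewrite ltr_pM2r.
      move: c4; rewrite !exprMn; lra.
    have : S * mu * dot x2 x2 <= 0 by rewrite mulr_le0_ge0 ?dot_ge0// ltW.
    have : 0 < N ^+ 2 * lambda ^+ 2 * L ^+ 2 by apply: mulr_gt0 => //; apply: mulr_gt0; exact: exprn_gt0.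
    move: c4; rewrite !exprMn; lra.
  apply: dot_eq0; apply/eqP; rewrite eq_le dot_ge0 andbT.
  by apply: (le_trans (sumsq_le_sqrsum x2)); rewrite -/L Lz expr0n.
split=> //.
have X1E (y : 'cV[R]_k) : lsubmx X *m y = X *m col_mx y 0.
  by rewrite -{2}(hsubmxK X) mul_row_col mulmx0 addr0.
have thE : th = col_mx (usubmx bh - usubmx beta) 0.
  rewrite /th -{1}(vsubmxK bh) -{1}(vsubmxK beta) -/x2 x20 beta2.
  by rewrite opp_col_mx add_col_mx subr0.
(* Small moves of a signal coordinate leave the penalty unchanged. *)
have stat j : dot (eps - X *m th) (lsubmx X *m delta_mx j 0) = 0.
  rewrite X1E; pose hj := col_mx (delta_mx j (0 : 'I_1)) (0 : 'cV[R]_m).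
  (* Half the margin to the edge of the flat region, so that every allowed move stays inside it. *)
  pose dlt := (`|bh (lshift m j) 0| - a * lambda) / 2.
  have d0 : 0 < dlt by rewrite divr_gt0// subr_gt0.
  apply: (quadratic_stationary d0) => t td.
  have := minimizer_direction hmin hj t; rewrite resE.
  have -> : scad_penalty lambda a (bh + t *: hj) = scad_penalty lambda a bh.
    apply: eq_bigr => i _; rewrite shiftE.
    have [ilt|mi] := ltnP i k.
      have -> : i = lshift m (Ordinal ilt) by apply/val_inj.
      rewrite /hj col_mxEu mxE eqxx andbT; case: eqP => [ej|_]; last by rewrite mulr0 addr0.
      rewrite mulr1 ej !scad_large//.
      have := lerB_normD (bh (lshift m j) 0) t; move: td; rewrite /dlt.
      have := bigb j; lra.
    have imk : (i - k < m)%N by rewrite ltn_subLR.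
    have -> : i = rshift k (Ordinal imk) by apply/val_inj => /=; rewrite subnKC.
    by rewrite /hj col_mxEd mxE mulr0 addr0.
  by rewrite subrr mulr0; apply.
have : (lsubmx X)^T *m (eps - X *m th) = 0.
  apply/matrixP => j z; rewrite ord1 [RHS]mxE -(stat j).
  by rewrite [RHS]dotC dot_mull dotC dot_delta.
rewrite thE -X1E mulmxBr mulmxA => /eqP; rewrite subr_eq0 => /eqP ->.
by [].
Qed.

End ScadOracle.

(** * Expectation, independence and conditional expectation *)

Section Expectation.
Context {d : measure_display} {T : measurableType d} {R : realType}.
Variable P : probability T R.
Implicit Types f g h : T -> R.

Definition integ (f : T -> R) := P.-integrable setT (EFin \o f).
Definition Ex (f : T -> R) : R := \int[P]_w f w.

Lemma integ_meas f : integ f -> measurable_fun setT f.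
Proof. by move=> /integrableP[/measurable_EFinP]. Qed.

Lemma integ_le f g : measurable_fun setT f -> (forall w, `|f w| <= `|g w|) ->
  integ g -> integ f.
Proof.
move=> mf fg; apply: le_integrable => //; first exact/measurable_EFinP.
by move=> w _ /=; rewrite lee_fin.
Qed.

Lemma integ_le_ae f g : measurable_fun setT f ->
  {ae P, forall w, `|f w| <= `|g w|} -> integ g -> integ f.
Proof.
move=> mf fg /integrableP[/measurable_EFinP mg goo]; apply/integrableP.
split; first exact/measurable_EFinP.
apply: le_lt_trans goo; apply: ae_ge0_le_integral => //.
- by apply/measurable_EFinP; apply: measurableT_comp.
- by apply/measurable_EFinP; apply: measurableT_comp.
- by apply: filterS fg => w h _ /=; rewrite lee_fin.
Qed.

Lemma integ_cst c : integ (cst c).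
Proof. exact: finite_measure_integrable_cst. Qed.

Lemma integ_bounded f C : measurable_fun setT f -> (forall w, `|f w| <= C) -> integ f.
Proof.
move=> mf fC; apply: (@integ_le _ (cst C)) => //; last exact: integ_cst.
by move=> w; apply: le_trans (fC w) (ler_norm _).
Qed.

Lemma integD f g : integ f -> integ g -> integ (fun w => f w + g w).
Proof. by move=> fi gi; exact: (integrableD measurableT fi gi). Qed.

Lemma integB f g : integ f -> integ g -> integ (fun w => f w - g w).
Proof. by move=> fi gi; exact: (integrableB measurableT fi gi). Qed.

Lemma integZ c f : integ f -> integ (fun w => c * f w).
Proof. by move=> fi; exact: (integrableZl measurableT c fi). Qed.

Lemma integ_sum I (s : seq I) (F : I -> T -> R) :
  (forall i, integ (F i)) -> integ (fun w => \sum_(i <- s) F i w).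
Proof.
move=> Fi; elim: s => [|i s IH].
  by under eq_fun do rewrite big_nil; exact: integ_cst.
by under eq_fun do rewrite big_cons; exact: (integD (Fi i) IH).
Qed.

Lemma integ_norm f : integ f -> integ (fun w => `|f w|).
Proof.
move=> fi; apply: (integ_le _ _ fi) => [|w]; last by rewrite normr_id.
by apply: measurableT_comp => //; exact: integ_meas.
Qed.

Lemma integ_mulbl h C f : measurable_fun setT h -> (forall w, `|h w| <= C) ->
  integ f -> integ (fun w => h w * f w).
Proof.
move=> mh hC fi; apply: (@integ_le _ (fun w => C * f w)); last exact: integZ.
  by apply: measurable_funM => //; exact: integ_meas.
by move=> w; rewrite !normrM ler_wpM2r// (le_trans (hC w)) ?ler_norm.
Qed.

Lemma ExD f g : integ f -> integ g -> Ex (fun w => f w + g w) = Ex f + Ex g.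
Proof. by move=> fi gi; rewrite /Ex RintegralD. Qed.

Lemma ExB f g : integ f -> integ g -> Ex (fun w => f w - g w) = Ex f - Ex g.
Proof. by move=> fi gi; rewrite /Ex RintegralB. Qed.

Lemma ExZ c f : integ f -> Ex (fun w => c * f w) = c * Ex f.
Proof. by move=> fi; rewrite /Ex RintegralZl. Qed.

Lemma Ex_cst c : Ex (cst c) = c.
Proof. by rewrite /Ex Rintegral_cst// [X in fine X]probability_setT mulr1. Qed.

Lemma Ex_sum I (s : seq I) (F : I -> T -> R) : (forall i, integ (F i)) ->
  Ex (fun w => \sum_(i <- s) F i w) = \sum_(i <- s) Ex (F i).
Proof.
move=> Fi; elim: s => [|i s IH].
  by under [X in Ex X]eq_fun do rewrite big_nil; rewrite big_nil Ex_cst.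
under [X in Ex X]eq_fun do rewrite big_cons.
by rewrite big_cons ExD ?IH//; exact: integ_sum.
Qed.

Lemma Ex_le f g : integ f -> integ g -> (forall w, f w <= g w) -> Ex f <= Ex g.
Proof. by move=> fi gi fg; apply: le_Rintegral. Qed.

Lemma Ex_ge0 f : (forall w, 0 <= f w) -> 0 <= Ex f.
Proof. by move=> f0; apply: Rintegral_ge0. Qed.

Lemma Ex_norm f : integ f -> `|Ex f| <= Ex (fun w => `|f w|).
Proof. by move=> fi; apply: le_normr_Rintegral. Qed.

Lemma Ex_norm_le f C : integ f -> (forall w, `|f w| <= C) -> `|Ex f| <= C.
Proof.
move=> fi fC; apply: (le_trans (Ex_norm fi)); rewrite -[leRHS]Ex_cst.
by apply: Ex_le => //; [exact: integ_norm|exact: integ_cst].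
Qed.

Lemma Ex_ae_eq f g : measurable_fun setT f -> measurable_fun setT g ->
  {ae P, forall w, f w = g w} -> Ex f = Ex g.
Proof.
move=> mf mg fg; rewrite /Ex /Rintegral; congr fine; apply: ae_eq_integral => //.
- exact/measurable_EFinP.
- exact/measurable_EFinP.
- by apply: filterS fg => w -> _.
Qed.

(** The maximum of [f] and [g] equals [g] almost everywhere and dominates [f] everywhere. *)
Lemma Ex_ae_le f g : integ f -> integ g -> {ae P, forall w, f w <= g w} ->
  Ex f <= Ex g.
Proof.
move=> fi gi fg; have mf := integ_meas fi; have mg := integ_meas gi.
have -> : Ex g = Ex (fun w => Num.max (f w) (g w)).
  apply: Ex_ae_eq => //; first exact: measurable_maxr.
  by apply: filterS fg => w h; rewrite max_r.
apply: Ex_le => // [|w]; last by rewrite le_max lexx.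
apply: (@integ_le _ (fun w => `|f w| + `|g w|)).
- exact: measurable_maxr.
- move=> w; rewrite [leRHS]ger0_norm ?addr_ge0//.
  by case: (leP (f w) (g w)) => _; rewrite ?lerDl ?lerDr.
- by apply: integD; exact: integ_norm.
Qed.

Lemma Ex_dominated (F : nat -> T -> R) f g :
  (forall n, measurable_fun setT (F n)) -> measurable_fun setT f ->
  (forall w, F n w @[n --> \oo] --> f w) ->
  integ g -> (forall n w, `|F n w| <= g w) ->
  Ex (F n) @[n --> \oo] --> Ex f.
Proof.
move=> mF mf Ff gi Fg.
have [||||| fi _ h] := @dominated_convergence _ _ _ P _ measurableT
  (fun n => EFin \o F n) (EFin \o f) (EFin \o g).
- by move=> n; exact/measurable_EFinP.
- exact/measurable_EFinP.
- by apply: aeW => w _; exact/cvg_EFin/Ff/nearW.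
- exact: gi.
- by apply: aeW => w n _ /=; rewrite lee_fin.
- apply: fine_cvg; rewrite fineK//; exact: integrable_fin_num.
Qed.

Lemma Ex_indic A : measurable A -> Ex (\1_A) = fine (P A).
Proof. by move=> mA; rewrite /Ex /Rintegral integral_indic// setIT. Qed.

Lemma Rintegral_restrict A f : measurable A ->
  \int[P]_(w in A) f w = Ex (fun w => \1_A w * f w).
Proof.
move=> mA; rewrite Rintegral_mkcond /Ex; congr Rintegral; apply/funext => w.
by rewrite /patch indicE; case: ifP => _; rewrite ?mul1r ?mul0r.
Qed.

Lemma measurable_gt f c : measurable_fun setT f -> measurable [set w | c < f w].
Proof.
move=> mf; rewrite (_ : [set w | _] = setT `&` f @^-1` `]c, +oo[%classic).
  exact: mf.
by rewrite setTI; apply/seteqP; split=> w /=; rewrite in_itv/= andbT.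
Qed.

Lemma expectationE f : integ f -> ('E_P[f] = (Ex f)%:E)%E.
Proof. by move=> fi; rewrite unlock /Ex /Rintegral fineK//; exact: integrable_fin_num. Qed.

Lemma second_moment_of_variance f :
  ('E_P[f] = 0)%E -> ('V_P[f] = 1)%E -> Ex (fun w => f w ^+ 2) = 1.
Proof.
move=> E0; rewrite /variance covariance.unlock E0 expectation.unlock => V1.
rewrite /Ex /Rintegral -[RHS](_ : fine 1%E = 1)// -V1; congr fine.
by apply: eq_integral => w _; rewrite !fctE /= subr0 expr2.
Qed.

Import HBNNSimple.

Section Orthogonality.
Context {d' : measure_display} {S : measurableType d'}.

(** This is E[Y | V] = 0, tested on events of V. Conditional means, conditional variances and
    independence are all brought to this form, so that one extension from indicators to functions of
    V serves them all. *)
Definition orthog (V : T -> S) (Y : T -> R) :=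
  integ Y /\ forall B, measurable B -> Ex (fun w => \1_B (V w) * Y w) = 0.

Lemma measurable_indic_comp (V : T -> S) (B : set S) :
  measurable_fun setT V -> measurable B -> measurable_fun setT (fun w => \1_B (V w) : R).
Proof. by move=> mV mB; apply: (measurableT_comp (measurable_indic mB) mV). Qed.

(** Increasing simple functions approximate [h], and dominated convergence applies with the assumed
    integrable product itself as majorant, so [h] may be unbounded. *)
Lemma orthog_nneg (V : T -> S) Y (h : S -> R) : measurable_fun setT V ->
  orthog V Y -> measurable_fun setT h -> (forall s, 0 <= h s) ->
  integ (fun w => h (V w) * Y w) -> Ex (fun w => h (V w) * Y w) = 0.
Proof.
move=> mV [Yi Y0] mh h0 hYi.
have mh' : measurable_fun setT (EFin \o h) by exact/measurable_EFinP.
pose g := nnsfun_approx measurableT mh'.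
have gh s : g n s @[n --> \oo] --> h s.
  have h0' x : [set: S] x -> (0 <= (EFin \o h) x)%E by rewrite lee_fin.
  exact: (fine_cvg (cvg_nnsfun_approx measurableT mh' h0' (x := s) I)).
have gle n s : g n s <= h s.
  have nd : nondecreasing_seq (fun n => g n s).
    by move=> a b ab; have /lefP := nd_nnsfun_approx measurableT mh' ab; apply.
  rewrite -(cvg_lim (@Rhausdorff R) (gh s)); apply: nondecreasing_cvgn_le => //.
  by apply/cvg_ex; exists (h s).
have mY := integ_meas Yi.
have g0 n : Ex (fun w => g n (V w) * Y w) = 0.
  pose s := fset_set (g n @` setT).
  under [X in Ex X]eq_fun do rewrite fimfunEord mulr_suml.
  rewrite Ex_sum => [|i].
    rewrite big1// => i _; under [X in Ex X]eq_fun do rewrite -mulrA.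
    rewrite ExZ ?Y0 ?mulr0//.
    by apply: (@integ_mulbl _ 1) => //; [exact: measurable_indic_comp|move=> w; rewrite indicE; case: (_ \in _); rewrite ?normr1 ?normr0].
  under eq_fun do rewrite -mulrA.
  apply: integZ.
  by apply: (@integ_mulbl _ 1) => //; [exact: measurable_indic_comp|move=> w; rewrite indicE; case: (_ \in _); rewrite ?normr1 ?normr0].
have mgV n : measurable_fun setT (fun w => g n (V w)) by exact: measurableT_comp.
have := @Ex_dominated (fun n w => g n (V w) * Y w) (fun w => h (V w) * Y w)
  (fun w => `|h (V w) * Y w|).
move=> /(_ (fun n => measurable_funM (mgV n) mY) (integ_meas hYi)).
move=> /(_ _ (integ_norm hYi) _) H.
have {}H : Ex (fun w => g n (V w) * Y w) @[n --> \oo] --> Ex (fun w => h (V w) * Y w).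
  apply: H => [w|n w].
    by apply: cvgM; [exact: gh|exact: cvg_cst].
  rewrite !normrM ler_wpM2r// ger0_norm// ?ger0_norm//.
have : Ex (fun w => g n (V w) * Y w) @[n --> \oo] --> (0 : R).
  by under eq_fun do rewrite g0; exact: cvg_cst.
by apply: cvg_unique H.
Qed.

Lemma orthog_mul (V : T -> S) Y (h : S -> R) : measurable_fun setT V ->
  orthog V Y -> measurable_fun setT h ->
  integ (fun w => h (V w) * Y w) -> Ex (fun w => h (V w) * Y w) = 0.
Proof.
move=> mV YV mh hi; have [Yi _] := YV; have mY := integ_meas Yi.
pose hp s := Num.max (h s) 0; pose hn s := Num.max (- h s) 0.
have mhp : measurable_fun setT hp by exact: measurable_maxr.
have mhn : measurable_fun setT hn.
  by apply: measurable_maxr => //; exact: measurableT_comp.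
have ip : integ (fun w => hp (V w) * Y w).
  apply: (integ_le _ _ hi) => [|w].
    by apply: measurable_funM => //; exact: measurableT_comp.
  rewrite !normrM ler_wpM2r// /hp; case: (leP (h (V w)) 0) => // _.
  by rewrite normr0.
have in_ : integ (fun w => hn (V w) * Y w).
  apply: (integ_le _ _ hi) => [|w].
    by apply: measurable_funM => //; exact: measurableT_comp.
  rewrite !normrM ler_wpM2r// /hn; case: (leP (- h (V w)) 0) => // _.
    by rewrite normr0.
  by rewrite normrN.
rewrite (_ : (fun w => _) = fun w => hp (V w) * Y w - hn (V w) * Y w).
  rewrite ExB// !orthog_nneg ?subrr// => s; by rewrite le_max lexx orbT.
apply/funext => w; rewrite -mulrBl; congr (_ * _); rewrite /hp /hn.
by case: (leP (h (V w)) 0) => h0; case: (leP (- h (V w)) 0) => h1; lra.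
Qed.

End Orthogonality.
End Expectation.

(** * Transport along equality in law *)

Section Transport.
Context {d : measure_display} {T : measurableType d} {R : realType}.
Variable P : probability T R.
Context {d' : measure_display} {S : measurableType d'}.
Variables V W : T -> S.
Hypotheses (mV : measurable_fun setT V) (mW : measurable_fun setT W).
Hypothesis VW : same_law P V W.

Let Vm : {mfun T >-> S} := HB.pack V (isMeasurableFun.Build _ _ _ _ V mV).
Let Wm : {mfun T >-> S} := HB.pack W (isMeasurableFun.Build _ _ _ _ W mW).

Lemma same_law_integral (h : S -> R) : measurable_fun setT h ->
  (forall s, 0 <= h s) ->
  (\int[P]_w (h (V w))%:E = \int[P]_w (h (W w))%:E)%E.
Proof.
move=> mh h0; have mh' : measurable_fun setT (EFin \o h) by exact/measurable_EFinP.
have h0' y : (0 <= (EFin \o h) y)%E by rewrite lee_fin.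
rewrite -[LHS](@ge0_integral_distribution _ _ _ _ _ P Vm (EFin \o h))//.
rewrite -[RHS](@ge0_integral_distribution _ _ _ _ _ P Wm (EFin \o h))//.
by apply: eq_measure_integral => A mA _; exact: VW.
Qed.

Lemma same_law_integ (h : S -> R) : measurable_fun setT h ->
  integ P (h \o V) -> integ P (h \o W).
Proof.
move=> mh /integrableP[_ hoo]; apply/integrableP; split.
  by apply/measurable_EFinP; exact: measurableT_comp.
have := @same_law_integral (fun s => `|h s|).
have mh' : measurable_fun setT (fun s => `|h s|) by exact: measurableT_comp.
by move=> /(_ mh' (fun=> normr_ge0 _)) <-.
Qed.

Lemma same_law_Ex (h : S -> R) : measurable_fun setT h ->
  integ P (h \o V) -> Ex P (h \o V) = Ex P (h \o W).
Proof.
move=> mh hV; have hW := same_law_integ mh hV.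
pose hp s := Num.max (h s) 0; pose hn s := Num.max (- h s) 0.
have mhp : measurable_fun setT hp by exact: measurable_maxr.
have mhn : measurable_fun setT hn.
  by apply: measurable_maxr => //; exact: measurableT_comp.
have hpE U : measurable_fun setT U -> integ P (h \o U) ->
    [/\ integ P (hp \o U), integ P (hn \o U) & h \o U = fun w => hp (U w) - hn (U w)].
  move=> mU hU; split.
  - apply: (integ_le _ _ hU) => [|w]; first exact: measurableT_comp.
    rewrite /= /hp; case: (leP (h (U w)) 0) => // _; by rewrite normr0.
  - apply: (integ_le _ _ hU) => [|w]; first exact: measurableT_comp.
    rewrite /= /hn; case: (leP (- h (U w)) 0) => // _; first by rewrite normr0.
    by rewrite normrN.
  - apply/funext => w; rewrite /= /hp /hn.
    by case: (leP (h (U w)) 0) => h0; case: (leP (- h (U w)) 0) => h1; lra.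
have [pV nV ->] := hpE _ mV hV; have [pW nW ->] := hpE _ mW hW.
rewrite !ExB// /Ex /Rintegral !(same_law_integral) //.
- by move=> s; rewrite le_max lexx orbT.
- by move=> s; rewrite le_max lexx orbT.
Qed.

Lemma same_law_ae (Q : set S) : measurable Q ->
  {ae P, forall w, Q (V w)} -> {ae P, forall w, Q (W w)}.
Proof.
move=> mQ [N [mN N0 QN]]; exists (W @^-1` (~` Q)); split.
- by rewrite -[X in measurable X]setTI; apply: mW => //; exact: measurableC.
- rewrite -VW; last exact: measurableC.
  have mVQ : measurable (V @^-1` (~` Q)).
    by rewrite -[X in measurable X]setTI; apply: mV => //; exact: measurableC.
  apply/eqP; rewrite eq_le measure_ge0 andbT -N0.
  by apply: le_measure; rewrite ?inE.
- by move=> w.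
Qed.

End Transport.

(** * From independence of events to independence of functions *)

Section Independence.
Context {d : measure_display} {T : measurableType d} {R : realType}.
Variable P : probability T R.
Context {d' : measure_display} {S : measurableType d'} {n : nat}.
Variable W : 'I_n -> T -> S.
Hypothesis mW : forall i, measurable_fun setT (W i).
Hypothesis indW : mutually_independent P W.

Lemma measurable_preim (V : T -> S) B : measurable_fun setT V -> measurable B ->
  measurable (V @^-1` B).
Proof. by move=> mV mB; rewrite -[X in measurable X]setTI; exact: mV. Qed.

Lemma indicE_comp (V : T -> S) B w : \1_B (V w) = \1_(V @^-1` B) w :> R.
Proof. by rewrite !indicE; congr (_%:R); congr nat_of_bool; apply/idP/idP; rewrite !inE. Qed.

Lemma Ex_indic_comp (V : T -> S) B : measurable_fun setT V -> measurable B ->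
  Ex P (fun w => \1_B (V w)) = fine (P (V @^-1` B)).
Proof.
move=> mV mB; under [X in Ex _ X]eq_fun do rewrite indicE_comp.
by rewrite Ex_indic//; exact: measurable_preim.
Qed.

Lemma norm_indic_le1 (U : Type) (B : set U) s : `|\1_B s : R| <= 1.
Proof. by rewrite indicE; case: (_ \in _); rewrite ?normr1 ?normr0. Qed.

Lemma norm_prod_le1 (I : Type) (s : seq I) (p : pred I) (F : I -> R) :
  (forall i, `|F i| <= 1) -> `|\prod_(i <- s | p i) F i| <= 1.
Proof.
move=> F1; elim/big_rec : _ => [|i x _ x1]; first by rewrite normr1.
by rewrite normrM mulr_ile1.
Qed.

Lemma indep_prod_indic (B : 'I_n -> set S) : (forall i, measurable (B i)) ->
  Ex P (fun w => \prod_i \1_(B i) (W i w)) = \prod_i Ex P (fun w => \1_(B i) (W i w)).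
Proof.
move=> mB.
rewrite (_ : (fun w => _) = \1_(\bigcap_(i in [set: 'I_n]) (W i @^-1` B i))).
  rewrite Ex_indic; last first.
    apply: fin_bigcap_measurable => // i _; exact: measurable_preim.
  under eq_bigr do rewrite Ex_indic_comp//.
  rewrite -(indW mB); congr (fine (P _)).
  by apply/seteqP; split => w /= h => [i|i _]; exact: h.
apply/funext => w; rewrite [RHS]indicE; case: (boolP (w \in _)) => [|nin].
  rewrite inE => h; rewrite big1// => i _.
  by rewrite indicE mem_set//; exact: h.
have /existsNP[i Bi] : ~ (forall i, B i (W i w)).
  by move=> h; move/negP: nin; apply; rewrite inE => i _; exact: h.
by rewrite (bigD1 i)//= indicE memNset// mul0r.
Qed.

(** Indicators are exchanged for functions one coordinate at a time. The product [F] over the other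
    coordinates, minus the product [c] of their means, is orthogonal to the current coordinate by
    the induction hypothesis, and [orthog_mul] then admits any bounded function there. *)
Lemma indep_prod (h : 'I_n -> S -> R) : (forall i, measurable_fun setT (h i)) ->
  (forall i s, `|h i s| <= 1) ->
  Ex P (fun w => \prod_i h i (W i w)) = \prod_i Ex P (fun w => h i (W i w)).
Proof.
move=> mh h1.
(* Here [r] is the number of leading coordinates that already carry arbitrary functions; at [r = 0]
   all factors are indicators. *)
suff : forall r, (r <= n)%N -> forall h : 'I_n -> S -> R,
    (forall i, measurable_fun setT (h i)) -> (forall i s, `|h i s| <= 1) ->
    (forall i : 'I_n, (r <= i)%N -> exists2 B, measurable B & h i = \1_B) ->
    Ex P (fun w => \prod_i h i (W i w)) = \prod_i Ex P (fun w => h i (W i w)).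
  move=> /(_ n (leqnn n) h mh h1); apply => i; by rewrite leqNgt ltn_ord.
elim=> [_|r IH rn] {mh h1}h mh h1 hB.
  have /boolp.choice[B /= hB'] : forall i, exists B, measurable B /\ h i = \1_B.
    by move=> i; have [B mB ->] := hB i (leq0n _); exists B.
  have -> : h = fun i => \1_(B i) by apply/funext => i; have [] := hB' i.
  by apply: indep_prod_indic => i; have [] := hB' i.
pose i0 := Ordinal rn; pose V := W i0.
have mV : measurable_fun setT V by exact: mW.
pose F w := \prod_(i | i != i0) h i (W i w).
pose c := \prod_(i | i != i0) Ex P (fun w => h i (W i w)).
have mF : measurable_fun setT F.
  rewrite /F; under eq_fun do rewrite big_mkcond.
  apply: measurable_prod => i _; case: (i != i0) => //.
  exact: measurableT_comp.
have F1 w : `|F w| <= 1 by apply: norm_prod_le1.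
have Fi : integ P F by exact: (integ_bounded P mF F1).
have keyB B : measurable B -> Ex P (fun w => \1_B (V w) * F w) = fine (P (V @^-1` B)) * c.
  move=> mB; pose hB' i := if i == i0 then \1_B else h i.
  have := IH (ltnW rn) hB'.
  have E w : \prod_i hB' i (W i w) = \1_B (V w) * F w.
    rewrite (bigD1 i0)//= /hB' eqxx; congr (_ * _); apply: eq_bigr => i ne.
    by rewrite (negPf ne).
  have E' : \prod_i Ex P (fun w => hB' i (W i w)) = fine (P (V @^-1` B)) * c.
    rewrite (bigD1 i0)//= /hB' eqxx Ex_indic_comp//; congr (_ * _).
    by apply: eq_bigr => i ne; rewrite (negPf ne).
  rewrite E'; under [X in Ex _ X]eq_fun do rewrite E.
  apply.
  - by move=> i; rewrite /hB'; case: eqP => // _; exact: measurable_indic.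
  - by move=> i s; rewrite /hB'; case: eqP => // _; exact: norm_indic_le1.
  - move=> i ri; rewrite /hB'; case: eqP => [_|ne]; first by exists B.
    apply: hB; rewrite ltn_neqAle ri andbT; apply/eqP => e.
    by apply: ne; apply/val_inj.
have cE : Ex P F = c.
  have := keyB setT measurableT; rewrite preimage_setT.
  rewrite [X in fine X * _]probability_setT mul1r => <-.
  by congr (Ex _ _); apply/funext => w; rewrite indicE in_setT mul1r.
have Yo : orthog P V (fun w => F w - c).
  split; first by apply: integB => //; exact: integ_cst.
  move=> B mB; under [X in Ex _ X]eq_fun do rewrite mulrBr.
  have mi : measurable_fun setT (fun w => \1_B (V w) : R) by exact: (measurable_indic_comp (mW i0) mB).
  rewrite ExB.
  - rewrite keyB//; under [X in Ex _ X]eq_fun do rewrite mulrC.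
    rewrite ExZ ?Ex_indic_comp// ?[c * _]mulrC ?subrr//.
    by apply: (integ_bounded P mi) => w; exact: norm_indic_le1.
  - by apply: (integ_mulbl mi) Fi => w; exact: norm_indic_le1.
  - by apply: (integ_mulbl mi) (integ_cst P c) => w; exact: norm_indic_le1.
have mhV : measurable_fun setT (fun w => h i0 (V w)) by exact: measurableT_comp.
have hVb w : `|h i0 (V w)| <= 1 by [].
have := orthog_mul (mW i0) Yo (mh i0).
under [X in integ _ X -> _]eq_fun do rewrite mulrBr.
under [X in Ex _ X]eq_fun do rewrite mulrBr.
have i1 := integ_mulbl mhV hVb Fi.
have i2 := integ_mulbl mhV hVb (integ_cst P c).
move=> /(_ (integB i1 i2)); rewrite ExB//.
under [X in _ - Ex _ X]eq_fun do rewrite mulrC.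
rewrite ExZ; last exact: (integ_bounded P mhV hVb).
move/eqP; rewrite subr_eq0 => /eqP key.
rewrite [RHS](bigD1 i0)//= -/V -/c [RHS]mulrC -key.
by congr (Ex _ _); apply/funext => w; rewrite (bigD1 i0).
Qed.

(** The same exchange for two coordinates, one factor after the other, now with integrable factors:
    the products of covariates and errors are unbounded. *)
Lemma indep_pair (i l : 'I_n) (u v : S -> R) : i != l ->
  measurable_fun setT u -> measurable_fun setT v ->
  integ P (fun w => u (W i w)) -> integ P (fun w => v (W l w)) ->
  integ P (fun w => u (W i w) * v (W l w)) ->
  Ex P (fun w => u (W i w) * v (W l w)) =
  Ex P (fun w => u (W i w)) * Ex P (fun w => v (W l w)).
Proof.
move=> il mu mv iu iv iuv.
have mi j A : measurable A -> measurable_fun setT (fun w => \1_A (W j w) : R).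
  by move=> mA; exact: measurable_indic_comp.
have ii j A : measurable A -> integ P (fun w => \1_A (W j w)).
  by move=> mA; apply: (integ_bounded P (mi j A mA)) => w; exact: norm_indic_le1.
have indAB A B : measurable A -> measurable B ->
    Ex P (fun w => \1_A (W i w) * \1_B (W l w)) =
    fine (P (W i @^-1` A)) * fine (P (W l @^-1` B)).
  move=> mA mB.
  pose C j := if j == i then A else if j == l then B else setT.
  have li : (l == i) = false by rewrite eq_sym (negPf il).
  have E w : \prod_j \1_(C j) (W j w) = \1_A (W i w) * \1_B (W l w) :> R.
    rewrite (bigD1 i)//= (bigD1 l) ?li//= /C eqxx li eqxx big1 ?mulr1// => j.
    move=> /andP[ji jl]; rewrite (negPf ji) (negPf jl) indicE in_setT //.
  have <- : Ex P (fun w => \prod_j \1_(C j) (W j w)) =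
      Ex P (fun w => \1_A (W i w) * \1_B (W l w)).
    by congr (Ex _ _); apply/funext => w; exact: E.
  rewrite indep_prod_indic; last first.
    by move=> j; rewrite /C; case: ifP => // _; case: ifP.
  rewrite (bigD1 i)//= (bigD1 l) ?li//= /C eqxx li eqxx !Ex_indic_comp//.
  rewrite big1 ?mulr1// => j /andP[ji jl]; rewrite (negPf ji) (negPf jl).
  rewrite -[RHS](Ex_cst P); congr (Ex _ _); apply/funext => w.
  by rewrite indicE in_setT.
have step A : measurable A ->
    Ex P (fun w => \1_A (W i w) * v (W l w)) =
    fine (P (W i @^-1` A)) * Ex P (fun w => v (W l w)).
  move=> mA; pose a := fine (P (W i @^-1` A)).
  have Yo : orthog P (W l) (fun w => \1_A (W i w) - a).
    split; first by apply: integB; [exact: ii|exact: integ_cst].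
    move=> B mB; under [X in Ex _ X]eq_fun do rewrite mulrBr mulrC [X in _ - X]mulrC.
    have i1 : integ P (fun w => \1_A (W i w) * \1_B (W l w)).
      by apply: (integ_mulbl (mi i A mA)) (ii l B mB) => w; exact: norm_indic_le1.
    rewrite ExB//; last by apply: integZ; exact: ii.
    by rewrite indAB// ExZ ?Ex_indic_comp ?subrr//; exact: ii.
  have i1 : integ P (fun w => v (W l w) * \1_A (W i w)).
    under eq_fun do rewrite mulrC.
    by apply: (integ_mulbl (mi i A mA)) iv => w; exact: norm_indic_le1.
  have i2 : integ P (fun w => a * v (W l w)) by exact: integZ.
  have := orthog_mul (mW l) Yo mv.
  under [X in integ _ X -> _]eq_fun do rewrite mulrBr [X in _ - X]mulrC.
  under [X in Ex _ X]eq_fun do rewrite mulrBr [X in _ - X]mulrC.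
  move=> /(_ (integB i1 i2)); rewrite ExB// ExZ// => /eqP; rewrite subr_eq0 => /eqP <-.
  by congr (Ex _ _); apply/funext => w; rewrite mulrC.
pose b := Ex P (fun w => v (W l w)).
have Yo : orthog P (W i) (fun w => v (W l w) - b).
  split; first by apply: integB => //; exact: integ_cst.
  move=> A mA; under [X in Ex _ X]eq_fun do rewrite mulrBr [X in _ - X]mulrC.
  rewrite ExB.
  - by rewrite step// ExZ ?Ex_indic_comp// ?[b * _]mulrC ?subrr//; exact: ii.
  - by apply: (integ_mulbl (mi i A mA)) iv => w; exact: norm_indic_le1.
  - by apply: integZ; exact: ii.
have i2 : integ P (fun w => b * u (W i w)) by exact: integZ.
have := orthog_mul (mW i) Yo mu.
under [X in integ _ X -> _]eq_fun do rewrite mulrBr [X in _ - X]mulrC.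
under [X in Ex _ X]eq_fun do rewrite mulrBr [X in _ - X]mulrC.
move=> /(_ (integB iuv i2)); rewrite ExB// ExZ// => /eqP; rewrite subr_eq0 => /eqP ->.
by rewrite mulrC.
Qed.

End Independence.

(** * Conditional mean and variance as orthogonality relations *)

Section ConditionalExpectation.
Context {d : measure_display} {T : measurableType d} {R : realType}.
Variable P : probability T R.
Context {d' : measure_display} {S : measurableType d'}.
Variable W : T -> S.
Hypothesis mW : measurable_fun setT W.

Lemma cond_exp_orthog Y Z : cond_exp P W Y Z -> orthog P W (fun w => Y w - Z w).
Proof.
move=> [Yi Zi _ YZ]; split; first exact: integB.
move=> B mB.
have mA : measurable (W @^-1` B) by exact: measurable_preim.
have gA : g_sigma_algebra_preimage W (W @^-1` B) by exists B => //; rewrite setTI.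
have := YZ _ gA => /(congr1 fine) e.
under [X in Ex _ X]eq_fun do rewrite indicE_comp.
rewrite -Rintegral_restrict// RintegralB//.
- by rewrite /Rintegral -e subrr.
- exact: (integrableS measurableT).
- exact: (integrableS measurableT).
Qed.

Lemma Ex_nneg_eq0 (f : T -> R) : integ P f -> (forall w, 0 <= f w) -> Ex P f = 0 ->
  {ae P, forall w, f w = 0}.
Proof.
move=> fi f0 Ef.
have mf : measurable_fun setT (EFin \o f) by apply/measurable_EFinP; exact: (integ_meas fi).
have /(ae_eq_integral_abs P measurableT mf) h : (\int[P]_w `|(EFin \o f) w| = 0)%E.
  under eq_integral do rewrite gee0_abs ?lee_fin//.
  rewrite -[LHS]fineK; last exact: integrable_fin_num.
  by congr EFin.
by apply: filterS h => w /(_ I) [].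
Qed.

(** [cond_var] centres at some version [m] of the conditional mean, so [m] must be identified with
    0. The events where [m] is positive or negative belong to the sigma-algebra of [W], hence [m]
    integrates to 0 over each; [s] selects the sign. *)
Lemma cond_exp0_ae Y m : cond_exp P W Y (cst 0) -> cond_exp P W Y m ->
  {ae P, forall w, m w = 0}.
Proof.
move=> [Yi _ _ Y0] [_ mi mm Ym].
have half (s : R) : (s = 1) \/ (s = -1) -> {ae P, forall w, Num.max (s * m w) 0 = 0}.
  move=> s1; pose D := [set y : R | 0 < s * y].
  have mD : measurable D.
    apply: (@measurable_gt _ _ R (fun y => s * y) 0).
    by apply: measurable_funM.
  have [B mB eB] := mm D mD.
  rewrite setTI in eB.
  have mA : measurable (m @^-1` D) by rewrite -eB; exact: measurable_preim.
  have gA : g_sigma_algebra_preimage W (m @^-1` D) by exact: mm.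
  have E0 : Ex P (fun w => \1_(m @^-1` D) w * m w) = 0.
    rewrite -Rintegral_restrict// /Rintegral Ym// -Y0//.
    by rewrite integral0.
  have mi1 : integ P (fun w => \1_(m @^-1` D) w * m w).
    apply: (integ_mulbl (measurable_indic mA)) mi => w; exact: norm_indic_le1.
  have maxE w : Num.max (s * m w) 0 = s * (\1_(m @^-1` D) w * m w).
    rewrite indicE; case: (boolP (w \in _)) => [|].
      by rewrite inE /= => h; rewrite mul1r max_l// ltW.
    move=> /negP; rewrite inE /= => /negP; rewrite -leNgt => h.
    by rewrite mul0r mulr0 max_r.
  apply: Ex_nneg_eq0.
  - by under eq_fun do rewrite maxE; exact: integZ.
  - by move=> w; rewrite le_max lexx orbT.
  - by under [X in Ex _ X]eq_fun do rewrite maxE; rewrite ExZ// E0 mulr0.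
have := half 1 (or_introl erefl); have := half (-1) (or_intror erefl).
apply: filterS2 => w h1 h2; move: h1 h2; rewrite mulN1r mul1r.
by case: (leP (m w) 0) => a; case: (leP (- m w) 0) => b; lra.
Qed.

Lemma cond_var_orthog Y V : cond_exp P W Y (cst 0) -> cond_var P W Y V ->
  orthog P W (fun w => Y w ^+ 2 - V w).
Proof.
move=> Y0 [m Ym Vm]; have m0 := cond_exp0_ae Y0 Ym.
have [Yi _ _ _] := Y0; have [_ mi _ _] := Ym; have [Y2i Vi _ _] := Vm.
have mY := integ_meas Yi.
have YY : {ae P, forall w, (Y w - m w) ^+ 2 = Y w ^+ 2}.
  by apply: filterS m0 => w ->; rewrite subr0.
have mY2 : measurable_fun setT (fun w => Y w ^+ 2) by exact: measurable_funX.
have Y2 : integ P (fun w => Y w ^+ 2).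
  by apply: (integ_le_ae mY2 _ Y2i); apply: filterS YY => w ->.
split; first exact: integB.
move=> B mB; have [_ /(_ _ mB) <-] := cond_exp_orthog Vm.
have mi1 : measurable_fun setT (fun w => \1_B (W w) : R) by exact: measurable_indic_comp.
apply: Ex_ae_eq.
- by apply: measurable_funM => //; apply: measurable_funB; [exact: mY2|exact: (integ_meas Vi)].
- by apply: measurable_funM => //; apply: measurable_funB; [exact: (integ_meas Y2i)|exact: (integ_meas Vi)].
- by apply: filterS YY => w ->.
Qed.

End ConditionalExpectation.

(** * Characteristic functions and the Lyapunov bound *)

Section TrigonometricBounds.
Context {R : realType}.
Implicit Types x y : R.

(** Applied in turn, each time with the previous inequality as the sign of the derivative, this
    produces the alternating Taylor bounds for sine and cosine on the half line. *)
Lemma nonneg_of_derivative (g g' : R -> R) : g 0 = 0 ->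
  (forall x, is_derive x 1 g (g' x)) -> (forall x, 0 <= x -> 0 <= g' x) ->
  forall x, 0 <= x -> 0 <= g x.
Proof.
move=> g0 dg g'0 x x0; rewrite -g0.
have dx z : derivable g z 1 by have [] := dg z.
have cg : continuous g.
  by move=> z; apply/differentiable_continuous/derivable1_diffP.
have cg' : {within `[0, +oo[, continuous g} by exact: continuous_subspaceT.
apply: (@ger0_derive1_ndecry R g 0) => // z.
rewrite in_itv/= andbT => z0; rewrite derive1E.
by have [_ ->] := dg z; apply: g'0; exact: ltW.
Qed.

Lemma sin_le_id x : 0 <= x -> sin x <= x.
Proof.
move=> x0; rewrite -subr_ge0.
apply: (nonneg_of_derivative (g := fun z => z - sin z) (g' := fun z => 1 - cos z)) x0 => //.
by rewrite sin0 subrr.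
Qed.

Lemma cos_ge_quadratic x : 0 <= x -> 1 - x ^+ 2 / 2 <= cos x.
Proof.
move=> x0; rewrite -subr_ge0.
apply: (nonneg_of_derivative (g := fun z => cos z - (1 - z ^+ 2 / 2))
  (g' := fun z => z - sin z)) x0 => //.
- by rewrite cos0 expr0n/= mul0r subr0 subrr.
- by move=> z; apply: is_derive_eq; rewrite /GRing.scale /=; field.
- by move=> z z0; rewrite subr_ge0 sin_le_id.
Qed.

Lemma sin_ge_cubic x : 0 <= x -> x - x ^+ 3 / 6 <= sin x.
Proof.
move=> x0; rewrite -subr_ge0.
apply: (nonneg_of_derivative (g := fun z => sin z - (z - z ^+ 3 / 6))
  (g' := fun z => cos z - (1 - z ^+ 2 / 2))) x0 => //.
- by rewrite sin0 expr0n/= mul0r subr0 subrr.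
- by move=> z; apply: is_derive_eq; rewrite /GRing.scale /=; field.
- by move=> z z0; rewrite subr_ge0 cos_ge_quadratic.
Qed.

Lemma cos_le_quartic x : 0 <= x -> cos x <= 1 - x ^+ 2 / 2 + x ^+ 4 / 24.
Proof.
move=> x0; rewrite -subr_ge0.
apply: (nonneg_of_derivative (g := fun z => 1 - z ^+ 2 / 2 + z ^+ 4 / 24 - cos z)
  (g' := fun z => sin z - (z - z ^+ 3 / 6))) x0 => //.
- by rewrite cos0 !expr0n/= !mul0r subr0 addr0 subrr.
- by move=> z; apply: is_derive_eq; rewrite /GRing.scale /=; field.
- by move=> z z0; rewrite subr_ge0 sin_ge_cubic.
Qed.

Lemma cos_taylor x : `|cos x - (1 - x ^+ 2 / 2)| <= x ^+ 4 / 24.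
Proof.
rewrite -(cos_norm x) -(real_normK (num_real x)) (_ : x ^+ 4 = `|x| ^+ 4); last first.
  by rewrite (exprM x 2 2) (exprM _ 2 2) real_normK ?num_real.
have h := normr_ge0 x; have h1 := cos_ge_quadratic h; have h2 := cos_le_quartic h.
have h4 : 0 <= `|x| ^+ 4 by rewrite exprn_ge0.
by rewrite ler_norml; apply/andP; split; lra.
Qed.

Lemma sin_taylor x : `|sin x - x| <= `|x| ^+ 3 / 6.
Proof.
wlog x0 : x / 0 <= x.
  move=> H; have [/H //|x0] := leP 0 x.
  have := H (- x); rewrite oppr_ge0 (ltW x0) sinN normrN -opprD normrN; exact.
rewrite (ger0_norm x0); have h1 := sin_ge_cubic x0; have h2 := sin_le_id x0.
have h3 : 0 <= x ^+ 3 by rewrite exprn_ge0.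
by rewrite ler_norml; apply/andP; split; lra.
Qed.

(** [expR (- x)] lies between [1 - x] and [1 / (1 + x)], and these differ by [x ^+ 2 / (1 + x)]. *)
Lemma expRN_taylor x : 0 <= x -> `|expR (- x) - (1 - x)| <= x ^+ 2.
Proof.
move=> x0; have h1 := expR_ge1Dx (- x).
rewrite ger0_norm; last by rewrite subr_ge0.
have h2 := expR_ge1Dx x.
have e0 := expR_gt0 (- x).
have e1 : expR x * expR (- x) = 1 by rewrite -expRD subrr expR0.
have h3 : (1 + x) * expR (- x) <= 1.
  by rewrite -[leRHS]e1; apply: ler_wpM2r => //; exact: ltW.
rewrite lerBlDr.
have x1 : 0 < 1 + x by lra.
rewrite -(ler_pM2l x1).
apply: (le_trans h3).
have : 0 <= x ^+ 3 by rewrite exprn_ge0.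
lra.
Qed.

End TrigonometricBounds.

(** * The Gaussian characteristic function through its differential equation *)

Section GaussianCharacteristicFunction.
Context {R : realType}.
Local Notation mu := (@lebesgue_measure R).
Local Notation gauss := (normal_prob (0 : R) 1).
Local Notation phi := (normal_pdf (0 : R) 1).

Lemma integral_normal_prob (f : R -> R) :
  gauss.-integrable setT (EFin \o f) ->
  \int[gauss]_x f x = \int[mu]_x (f x * phi x).
Proof.
move=> fi; rewrite /Rintegral; congr fine.
have nd : gauss `<< mu by exact: normal_prob_dominates.
rewrite -(Radon_Nikodym_change_of_variables nd)//=.
have mf := measurable_int _ fi.
transitivity (\int[mu]_x ((EFin \o f) x * (EFin \o phi) x))%E; last by [].
apply: ae_eq_integral => //.
- by apply: emeasurable_funM.
- have mfp : measurable_fun setT (fun x : measurableTypeR R => f x * phi x).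
    by apply: measurable_funM; [exact/measurable_EFinP|exact: measurable_normal_pdf].
  by apply/measurable_EFinP.
- apply: ae_eqe_mul2l => /=.
  rewrite Radon_NikodymE//=.
  case: cid => /= h [h1 h2 h3].
  apply: integral_ae_eq => //=.
  + by apply/measurable_EFinP; exact: measurable_normal_pdf.
  + by move=> E E01 mE; rewrite -h3.
Qed.

Let K : R := normal_peak 1.

Lemma std_normal_pdfE x : phi x = K * expR (- (x ^+ 2 / 2)).
Proof.
rewrite normal_pdfE ?oner_eq0// /normal_fun subr0 expr1n; congr (_ * expR _).
by rewrite mulNr mulr2n.
Qed.

Lemma is_derive_std_normal_pdf (x : R) : is_derive x (1 : R) phi (- x * phi x).
Proof.
rewrite (_ : phi = fun z => K * expR (- (z ^+ 2 / 2))); last first.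
  by apply/funext => z; exact: std_normal_pdfE.
by apply: is_derive_eq; rewrite /GRing.scale /=; field.
Qed.

(** Half of the exponent absorbs the factor: [|x| <= 1 + x ^+ 2 / 4 <= expR (x ^+ 2 / 4)]. What
    remains is a multiple of the normal density with standard deviation [Num.sqrt 2]. The function
    serves as majorant when differentiating under the integral. *)
Lemma integrable_abs_mul_pdf :
  mu.-integrable setT (EFin \o (fun x : measurableTypeR R => `|x| * phi x)).
Proof.
pose s : R := Num.sqrt 2.
have s2 : s ^+ 2 = 2 by rewrite sqr_sqrtr.
have s0 : s != 0 by rewrite gt_eqF// sqrtr_gt0.
have := integrable_normal_pdf (0 : R) s.
move=> /(integrableZl measurableT (K / normal_peak s)).
apply: le_integrable => //.
  apply/measurable_EFinP; apply: measurable_funM; last exact: measurable_normal_pdf.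
  exact: normr_measurable.
move=> x _ /=; rewrite lee_fin std_normal_pdfE normal_pdfE//.
have ps : normal_peak s != 0 by rewrite gt_eqF// normal_peak_gt0.
rewrite [K / _ * _]mulrA divfK// /normal_fun subr0 s2 !normrM normr_id.
rewrite mulrCA ler_wpM2l// !(ger0_norm (expR_ge0 _)).
have -> : - (x ^+ 2 / 2) = - (x ^+ 2 / 4) + - (x ^+ 2 / 4) by field.
rewrite (_ : - x ^+ 2 / (2 *+ 2) = - (x ^+ 2 / 4)); last first.
  by rewrite mulNr; congr (- (_ / _)); ring.
rewrite expRD mulrA ler_piMl ?expR_ge0//.
have := expR_ge1Dx (x ^+ 2 / 4).
rewrite expRN -ler_pdivlMr ?invr_gt0 ?expR_gt0// invrK mul1r; apply: le_trans.
rewrite -[x ^+ 2]real_normK ?num_real//.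
have := sqr_ge0 (`|x| / 2 - 1); lra.
Qed.

Section FixedPhase.
Variable c : R.

Let I (t : R) := \int[mu]_x (cos (t * x + c) * phi x).
Let J (t : R) := \int[mu]_x (x * sin (t * x + c) * phi x).

Lemma measurable_cos_affine t : measurable_fun [set: measurableTypeR R] (fun x => cos (t * x + c)).
Proof.
apply: continuous_measurable_fun => x; apply: (@continuous_comp _ _ _ (fun x => t * x + c) cos).
  by apply: cvgD; [apply: cvgM; [exact: cvg_cst|exact: cvg_id]|exact: cvg_cst].
exact: continuous_cos.
Qed.

Lemma measurable_sin_affine t : measurable_fun [set: measurableTypeR R] (fun x => sin (t * x + c)).
Proof.
apply: continuous_measurable_fun => x; apply: (@continuous_comp _ _ _ (fun x => t * x + c) sin).
  by apply: cvgD; [apply: cvgM; [exact: cvg_cst|exact: cvg_id]|exact: cvg_cst].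
exact: continuous_sin.
Qed.

Lemma integrable_cos_pdf t :
  mu.-integrable setT (EFin \o (fun x : measurableTypeR R => cos (t * x + c) * phi x)).
Proof.
have := integrable_normal_pdf (0 : R) 1; apply: le_integrable => //.
  apply/measurable_EFinP; apply: measurable_funM; last exact: measurable_normal_pdf.
  exact: measurable_cos_affine.
by move=> x _ /=; rewrite lee_fin normrM ler_piMl// cos_max.
Qed.

Lemma integrable_sin_pdf t :
  mu.-integrable setT (EFin \o (fun x : measurableTypeR R => x * sin (t * x + c) * phi x)).
Proof.
have := integrable_abs_mul_pdf; apply: le_integrable => //.
  apply/measurable_EFinP; apply: measurable_funM; last exact: measurable_normal_pdf.
  by apply: measurable_funM => //; exact: measurable_sin_affine.
move=> x _ /=; rewrite lee_fin !normrM normr_id ler_wpM2r//.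
by rewrite ler_piMr// sin_max.
Qed.

Lemma derive_cos_affine (x t : R) : is_derive t (1 : R) (fun s => cos (s * x + c) * phi x)
  (- (x * sin (t * x + c) * phi x)).
Proof. by apply: is_derive_eq; rewrite /GRing.scale /=; ring. Qed.

Lemma derive_I (t : R) : is_derive t (1 : R) I (- J t).
Proof.
have At : `]t - 1, t + 1[%classic t by rewrite /= in_itv/= ltrBlDr !ltrDl ltr01.
have d1 x s : partial1of2 (fun s x => cos (s * x + c) * phi x) s x =
    - (x * sin (s * x + c) * phi x).
  by rewrite partial1of2E; have [_ ->] := derive_cos_affine x s.
have dI := @derivable_under_integral R _ (measurableTypeR R) mu
  (fun s x => cos (s * x + c) * phi x) setT measurableT t (t - 1) (t + 1) At
  (fun s _ => integrable_cos_pdf s)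
  (fun s x _ _ => let: DeriveDef h _ := derive_cos_affine x s in h)
  (fun x => `|x| * phi x) (fun x => mulr_ge0 (normr_ge0 _) (normal_pdf_ge0 _ _ _))
  integrable_abs_mul_pdf.
have eI := @differentiation_under_integral R _ (measurableTypeR R) mu
  (fun s x => cos (s * x + c) * phi x) setT measurableT t (t - 1) (t + 1) At
  (fun s _ => integrable_cos_pdf s)
  (fun s x _ _ => let: DeriveDef h _ := derive_cos_affine x s in h)
  (fun x => `|x| * phi x) (fun x => mulr_ge0 (normr_ge0 _) (normal_pdf_ge0 _ _ _))
  integrable_abs_mul_pdf.
have bd s x : `]t - 1, t + 1[%classic s -> [set: R] x ->
    `|partial1of2 (fun s x => cos (s * x + c) * phi x) s x| <= `|x| * phi x.
  move=> _ _; rewrite d1 normrN !normrM.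
  rewrite (ger0_norm (normal_pdf_ge0 _ _ _)) ler_wpM2r ?normal_pdf_ge0//.
  by rewrite ler_piMr// sin_max.
apply: DeriveDef; first exact: dI bd.
rewrite -derive1E eI//.
under eq_Rintegral do rewrite d1 -mulN1r.
by rewrite RintegralZl// ?mulN1r//; exact: integrable_sin_pdf.
Qed.

(** The derivative of [sin (t * x + c) * phi x] is the difference of the two integrands, and its
    integral over the line vanishes with the boundary values. *)
Lemma gauss_integration_by_parts t : t * I t = J t.
Proof.
pose h x := sin (t * x + c) * phi x.
pose h' x := t * (cos (t * x + c) * phi x) - x * sin (t * x + c) * phi x.
have dh (x : R) : is_derive x (1 : R) h (h' x).
  have := is_derive_std_normal_pdf x => dphi.
  by apply: is_derive_eq; rewrite /h' /GRing.scale /=; ring.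
have ch : continuous h.
  move=> x; apply/differentiable_continuous/derivable1_diffP; by have [] := dh x.
have cphi : continuous phi by exact: continuous_normal_pdf.
have ch' : continuous h'.
  have caff x : {for x, continuous (fun x : R => t * x + c)}.
    by apply: cvgD; [apply: cvgM; [exact: cvg_cst|exact: cvg_id]|exact: cvg_cst].
  move=> x; apply: cvgB.
    apply: cvgM; first exact: cvg_cst.
    apply: cvgM; last exact: cphi.
    by apply: (@continuous_comp _ _ _ (fun x => t * x + c) cos); [exact: caff|exact: continuous_cos].
  apply: cvgM; last exact: cphi.
  apply: cvgM; first exact: cvg_id.
  by apply: (@continuous_comp _ _ _ (fun x => t * x + c) sin); [exact: caff|exact: continuous_sin].
have ih' : mu.-integrable setT (EFin \o (h' : measurableTypeR R -> R)).
  exact: (integrableB measurableT (integrableZl measurableT t (integrable_cos_pdf t))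
    (integrable_sin_pdf t)).
have mh' : measurable_fun [set: measurableTypeR R] h' by apply/measurable_EFinP; exact: measurable_int ih'.
have E0 : \int[mu]_x h' x = t * I t - J t.
  rewrite RintegralB//; last exact: integrable_sin_pdf.
    by rewrite RintegralZl//; exact: integrable_cos_pdf.
  exact: (integrableZl measurableT t (integrable_cos_pdf t)).
apply/eqP; rewrite -subr_eq0 -E0; apply/eqP.
(* The successor keeps the interval nondegenerate at [n = 0] and matches the [harmonic] sequence
   below. *)
pose A (n : nat) : set R := `[(- n.+1%:R), n.+1%:R]%classic.
have FTC n : (\int[mu]_(x in A n) (h' x)%:E = (h n.+1%:R - h (- n.+1%:R))%:E)%E.
  rewrite EFinB; apply: continuous_FTC2.
  - by rewrite gtrN.
  - exact: continuous_subspaceT.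
  - split.
    + by move=> x _; have [] := dh x.
    + by apply: cvg_at_right_filter; exact: ch.
    + by apply: cvg_at_left_filter; exact: ch.
  - by move=> x _; rewrite derive1E; have [_ ->] := dh x.
have [||||| _ _ lim1] := @dominated_convergence _ (measurableTypeR R) R mu setT measurableT
  (fun n x => (h' x * \1_(A n) x)%:E) (fun x => (h' x)%:E) (fun x => `|h' x|%:E).
- move=> n; apply/measurable_EFinP; apply: measurable_funM => //.
  by apply: measurable_indic; exact: measurable_itv.
- exact/measurable_EFinP.
- apply: aeW => x _; apply: cvg_near_cst; near=> n.
  rewrite indicE mem_set ?mulr1// /A /= in_itv/= -ler_norml.
  near: n; exists (Num.truncn `|x|).+1 => // n /= xn.
  have := truncnS_gt `|x|; move=> /ltW/le_trans; apply.
  by rewrite ler_nat ltnW// ltnS.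
- exact: integrable_norm ih'.
- apply: aeW => x n _; rewrite lee_fin normrM ler_piMr//.
  by rewrite indicE; case: (_ \in _); rewrite ?normr1 ?normr0.
have lim2 : (h n.+1%:R - h (- n.+1%:R)) @[n --> \oo] --> (\int[mu]_x h' x).
  apply: (@fine_cvg _ _ _ _ (fun n => (h n.+1%:R - h (- n.+1%:R))%:E)).
  rewrite fineK; last exact: integrable_fin_num ih'.
  apply: cvg_trans lim1; apply: near_eq_cvg; near=> n.
  rewrite -FTC [RHS]integral_mkcond; apply: eq_integral => x _.
  by rewrite /patch indicE; case: ifP; rewrite ?mulr1 ?mulr0.
have lim0 : (h n.+1%:R - h (- n.+1%:R)) @[n --> \oo] --> (0 : R).
  apply: norm_cvg0; apply: (@squeeze_cvgr _ _ _ _ (fun=> 0) (fun n => 4 * K * harmonic n)).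
  - apply: nearW => n; rewrite normr_ge0/=.
    apply: (le_trans (ler_normB _ _)).
    have K0 : 0 <= K by exact: normal_peak_ge0.
    (* It suffices that [expR (y ^+ 2 / 2)] is at least [1 + y ^+ 2 / 2], hence at least
       [|y| / 2]. *)
    have hb (y : R) : `|y| = n.+1%:R -> `|h y| <= 2 * K * harmonic n.
      move=> yn; rewrite /h normrM std_normal_pdfE.
      apply: (@le_trans _ _ (1 * `|K * expR (- (y ^+ 2 / 2))|)).
        by rewrite ler_wpM2r// sin_max.
      rewrite mul1r ger0_norm ?mulr_ge0 ?expR_ge0// -mulrA mulrCA ler_wpM2l//.
      rewrite /harmonic /= expRN -[leRHS]invrK lef_pV2 ?posrE ?invr_gt0 ?mulr_gt0 ?expR_gt0 ?invr_gt0 ?ltr0n//.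
      rewrite invfM invrK.
      apply: le_trans (expR_ge1Dx _); rewrite -[y ^+ 2]real_normK ?num_real// yn.
      set N : R := n.+1%:R; have N0 : 0 <= N by exact: ler0n.
      have := sqr_ge0 (N - 1); lra.
    have h1 := hb n.+1%:R (ger0_norm (ler0n _ _)).
    have h2 := hb (- n.+1%:R); rewrite normrN ger0_norm// in h2.
    have {}h2 := h2 erefl; apply: (le_trans (lerD h1 h2)).
    by rewrite -mulrDl le_eqVlt; apply/orP; left; apply/eqP; congr (_ * _); ring.
  - exact: cvg_cst.
  - rewrite -[X in _ --> X](mulr0 (4 * K)); apply: cvgM; first exact: cvg_cst.
    exact: cvg_harmonic.
exact: (cvg_unique _ lim2 lim0).
Unshelve. all: by end_near. Qed.

Lemma integral_cos_pdf t : I t = expR (- (t ^+ 2 / 2)) * cos c.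
Proof.
(* [I] solves [I' = - t I], so [F] is constant. *)
pose F s := I s * expR (s ^+ 2 / 2).
have dF s : is_derive s (1 : R) F 0.
  have dI := derive_I s.
  by apply: is_derive_eq; rewrite -gauss_integration_by_parts /GRing.scale /=; field.
have := is_derive_0_is_cst t 0 dF; rewrite /F expr0n/= mul0r expR0 mulr1.
have -> : I 0 = cos c.
  rewrite /I; under eq_Rintegral do rewrite mul0r add0r.
  rewrite RintegralZl//; last exact: integrable_normal_pdf.
  by rewrite /Rintegral integral_normal_pdf mulr1.
by move=> <-; rewrite mulrCA -expRD addrC subrr expR0 mulr1.
Qed.

Lemma gauss_cos t : Ex gauss (fun x => cos (t * x + c)) = expR (- (t ^+ 2 / 2)) * cos c.
Proof.
rewrite -integral_cos_pdf /Ex integral_normal_prob//.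
apply: (integ_bounded gauss (C := 1)); first exact: measurable_cos_affine.
by move=> x; exact: cos_max.
Qed.

End FixedPhase.
End GaussianCharacteristicFunction.

(** * Characteristic functions of independent sums *)

Section CharacteristicFunctionOfSums.
Context {d : measure_display} {T : measurableType d} {R : realType}.
Variable P : probability T R.
Context {d' : measure_display} {S : measurableType d'} {n : nat}.
Variable W : 'I_n -> T -> S.
Hypothesis mW : forall i, measurable_fun setT (W i).
Hypothesis indW : mutually_independent P W.

Lemma measurable_cos (f : T -> R) c : measurable_fun setT f ->
  measurable_fun setT (fun w => cos (f w + c)).
Proof.
move=> mf; apply: (@measurableT_comp _ _ _ _ _ _ cos).
  apply: continuous_measurable_fun; exact: continuous_cos.
exact: measurable_funD.
Qed.

Lemma measurable_comp_cos d0 (U : measurableType d0) (f : U -> R) : measurable_fun setT f ->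
  measurable_fun setT (fun w => cos (f w)).
Proof.
by move=> mf; apply: (@measurableT_comp _ _ _ _ _ _ cos) => //;
  apply: continuous_measurable_fun; exact: continuous_cos.
Qed.

Lemma measurable_comp_sin d0 (U : measurableType d0) (f : U -> R) : measurable_fun setT f ->
  measurable_fun setT (fun w => sin (f w)).
Proof.
by move=> mf; apply: (@measurableT_comp _ _ _ _ _ _ sin) => //;
  apply: continuous_measurable_fun; exact: continuous_sin.
Qed.

Lemma integ_cos (f : T -> R) c : measurable_fun setT f ->
  integ P (fun w => cos (f w + c)).
Proof.
move=> mf; apply: (integ_bounded P (measurable_cos c mf)) => w; exact: cos_max.
Qed.

Variable h : S -> R.
Hypothesis mh : measurable_fun setT h.

Let psum (r : nat) w := \sum_(i < n | (i < r)%N) h (W i w).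

Let mpsum r : measurable_fun setT (psum r).
Proof.
rewrite /psum; under eq_fun do rewrite big_mkcond.
apply: measurable_sum => i; case: (i < r)%N => //.
exact: measurableT_comp.
Qed.

Lemma ord_lt_split r (rn : (r < n)%N) (i : 'I_n) :
  (i < r.+1)%N && (i != Ordinal rn) = (i < r)%N.
Proof. by rewrite -(inj_eq val_inj) /= ltnS ltn_neqAle andbC. Qed.

Lemma ord_ge_split r (rn : (r < n)%N) (i : 'I_n) :
  (r <= i)%N && (i != Ordinal rn) = (r < i)%N.
Proof. by rewrite -(inj_eq val_inj) /= eq_sym ltn_neqAle andbC. Qed.

Lemma psumS r (rn : (r < n)%N) w : psum r.+1 w = psum r w + h (W (Ordinal rn) w).
Proof.
rewrite /psum (bigD1 (Ordinal rn)) ?ltnS//= addrC; congr (_ + _).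
by apply: eq_bigl => i; exact: ord_lt_split.
Qed.

(* The product over the later observations is what makes the induction on [r] close. *)
Lemma cos_psum_factor r : (r <= n)%N -> forall (g : 'I_n -> S -> R) c,
  (forall i, measurable_fun setT (g i)) -> (forall i s, `|g i s| <= 1) ->
  Ex P (fun w => cos (psum r w + c) * \prod_(i < n | (r <= i)%N) g i (W i w)) =
  Ex P (fun w => cos (psum r w + c)) *
    \prod_(i < n | (r <= i)%N) Ex P (fun w => g i (W i w)).
Proof.
elim: r => [_|r IH rn] g c mg g1.
  have E w : psum 0 w = 0 by rewrite /psum big_pred0.
  have igp : integ P (fun w => \prod_(i < n) g i (W i w)).
    apply: (integ_bounded P (C := 1)); last by move=> w; exact: norm_prod_le1.
    by apply: measurable_prod => i _; exact: measurableT_comp.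
  under [X in Ex _ X]eq_fun do rewrite E add0r; rewrite ExZ// indep_prod//.
  by under [X in Ex _ X * _]eq_fun do rewrite E add0r; rewrite Ex_cst.
pose i0 := Ordinal rn.
have prodE (F : 'I_n -> R) : \prod_(i < n | (r <= i)%N) F i =
    F i0 * \prod_(i < n | (r < i)%N) F i.
  rewrite (bigD1 i0) ?leqnn//=; congr (_ * _).
  by apply: eq_bigl => i; exact: ord_ge_split.
have key (f : 'I_n -> S -> R) : (forall i, measurable_fun setT (f i)) ->
    (forall i s, `|f i s| <= 1) ->
    Ex P (fun w => cos (psum r.+1 w + c) * \prod_(i < n | (r < i)%N) f i (W i w)) =
    (Ex P (fun w => cos (psum r w + c)) * Ex P (fun w => cos (h (W i0 w))) +
     Ex P (fun w => cos (psum r w + (c + pi / 2))) * Ex P (fun w => sin (h (W i0 w)))) *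
    \prod_(i < n | (r < i)%N) Ex P (fun w => f i (W i w)).
  move=> mf f1; pose gc (u : R -> R) i s := if i == i0 then u (h s) else f i s.
  have gcE u w : \prod_(i < n | (r <= i)%N) gc u i (W i w) =
      u (h (W i0 w)) * \prod_(i < n | (r < i)%N) f i (W i w).
    rewrite prodE /gc eqxx; congr (_ * _); apply: eq_bigr => i ri.
    suff -> : (i == i0) = false by []. by rewrite -(inj_eq val_inj) gtn_eqF.
  have gcE' u : \prod_(i < n | (r <= i)%N) Ex P (fun w => gc u i (W i w)) =
      Ex P (fun w => u (h (W i0 w))) * \prod_(i < n | (r < i)%N) Ex P (fun w => f i (W i w)).
    rewrite prodE /gc eqxx; congr (_ * _); apply: eq_bigr => i ri.
    suff -> : (i == i0) = false by []. by rewrite -(inj_eq val_inj) gtn_eqF.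
  have mgc u : measurable_fun setT (fun s => u (h s)) -> forall i, measurable_fun setT (gc u i).
    by move=> mu i; rewrite /gc; case: eqP.
  have gc1 u : (forall y, `|u y| <= 1) -> forall i s, `|gc u i s| <= 1.
    by move=> u1 i s; rewrite /gc; case: eqP.
  have mcos : measurable_fun setT (fun s => cos (h s)) by exact: measurable_comp_cos.
  have msin : measurable_fun setT (fun s => sin (h s)) by exact: measurable_comp_sin.
  have IHc := IH (ltnW rn) (gc cos) c (mgc _ mcos) (gc1 _ (@cos_max R)).
  have IHs := IH (ltnW rn) (gc sin) (c + pi / 2) (mgc _ msin) (gc1 _ (@sin_max R)).
  rewrite gcE' in IHc; rewrite gcE' in IHs.
  rewrite mulrDl -!mulrA -IHc -IHs -ExD.
  - congr (Ex _ _); apply/funext => w; rewrite !gcE psumS -/i0.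
    rewrite [in RHS]addrA cosDpihalf (_ : psum r w + _ + c = (psum r w + c) + h (W i0 w)).
      by rewrite cosD; ring.
    by ring.
  - apply: (integ_bounded P (C := 1)) => [|w]; last first.
      by rewrite normrM mulr_ile1// ?cos_max//; apply: norm_prod_le1 => i; exact: gc1 (@cos_max R) _ _.
    apply: measurable_funM; first exact: measurable_cos.
    under eq_fun do rewrite big_mkcond.
    apply: measurable_prod => i _; case: (r <= i)%N => //.
    by apply: (@measurableT_comp _ _ _ _ _ _ (gc cos i)) => //; exact: mgc.
  - apply: (integ_bounded P (C := 1)) => [|w]; last first.
      by rewrite normrM mulr_ile1// ?cos_max//; apply: norm_prod_le1 => i; exact: gc1 (@sin_max R) _ _.
    apply: measurable_funM; first exact: measurable_cos.
    under eq_fun do rewrite big_mkcond.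
    apply: measurable_prod => i _; case: (r <= i)%N => //.
    by apply: (@measurableT_comp _ _ _ _ _ _ (gc sin i)) => //; exact: mgc.
rewrite key//; congr (_ * _).
have mone : 'I_n -> measurable_fun setT (fun _ : S => 1 : R) by [].
have one1 : 'I_n -> forall s : S, `|1 : R| <= 1 by move=> *; rewrite normr1.
have := key (fun _ _ => 1) mone one1.
rewrite [X in _ = _ * X]big1 ?mulr1 => [<-|i _]; last exact: (Ex_cst P).
by congr (Ex _ _); apply/funext => w; rewrite big1_eq mulr1.
Qed.

(** The addition formula followed by independence. The sine of the partial sum is a cosine with
    phase [c - pi / 2], so one factorization covers both terms. *)
Lemma cos_psumS r (rn : (r < n)%N) c :
  Ex P (fun w => cos (psum r.+1 w + c)) =
  Ex P (fun w => cos (psum r w + c)) * Ex P (fun w => cos (h (W (Ordinal rn) w))) -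
  Ex P (fun w => sin (psum r w + c)) * Ex P (fun w => sin (h (W (Ordinal rn) w))).
Proof.
pose i0 := Ordinal rn.
have prodE (F : 'I_n -> R) : (forall i, i != i0 -> F i = 1) -> \prod_(i < n | (r <= i)%N) F i = F i0.
  move=> F1; rewrite (bigD1 i0) ?leqnn//= big1 ?mulr1// => i /andP[_ ii]; exact: F1.
pose gc (u : R -> R) i s := if i == i0 then u (h s) else 1.
have step (u : R -> R) (c' : R) : measurable_fun setT (fun s => u (h s)) -> (forall y, `|u y| <= 1) ->
    Ex P (fun w => cos (psum r w + c') * u (h (W i0 w))) =
    Ex P (fun w => cos (psum r w + c')) * Ex P (fun w => u (h (W i0 w))).
  move=> mu u1.
  have mgc i : measurable_fun setT (gc u i) by rewrite /gc; case: eqP.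
  have gc1 i s : `|gc u i s| <= 1 by rewrite /gc; case: eqP => // _; rewrite normr1.
  have := cos_psum_factor (ltnW rn) c' mgc gc1.
  rewrite prodE => [|i ii]; last by rewrite /gc (negPf ii) Ex_cst.
  rewrite {2}/gc eqxx => <-; congr (Ex _ _); apply/funext => w.
  by rewrite prodE /gc ?eqxx// => i /negPf ->.
have mcos : measurable_fun setT (fun s => cos (h s)) by exact: measurable_comp_cos.
have msin : measurable_fun setT (fun s => sin (h s)) by exact: measurable_comp_sin.
have E w : sin (psum r w + c) = cos (psum r w + (c - pi / 2)).
  by rewrite addrA cosBpihalf.
under [X in _ - Ex _ X * _]eq_fun do rewrite E.
rewrite -!step//; [|exact: sin_max|exact: cos_max].
rewrite -ExB.
- congr (Ex _ _); apply/funext => w; rewrite psumS -/i0 -E.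
  by rewrite addrAC cosD.
- apply: (integ_bounded P (C := 1)) => [|w]; last by rewrite normrM mulr_ile1// cos_max.
  apply: measurable_funM; first exact: measurable_cos.
  by apply: (@measurableT_comp _ _ _ _ _ _ (fun s => cos (h s))).
- apply: (integ_bounded P (C := 1)) => [|w]; last by rewrite normrM mulr_ile1// ?cos_max ?sin_max.
  apply: measurable_funM; first exact: measurable_cos.
  by apply: (@measurableT_comp _ _ _ _ _ _ (fun s => sin (h s))).
Qed.

(** The pair of cosine and sine means of a summand is replaced by [(q, 0)], one summand at a time.
    Each replacement costs at most [delta], and earlier errors are not amplified because
    [q <= 1]. *)
Lemma cos_sum_close (q delta c : R) : 0 <= q <= 1 ->
  (forall i, `|Ex P (fun w => cos (h (W i w))) - q| + `|Ex P (fun w => sin (h (W i w)))| <= delta) ->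
  `|Ex P (fun w => cos (\sum_i h (W i w) + c)) - q ^+ n * cos c| <= n%:R * delta.
Proof.
move=> /andP[q0 q1] hd.
suff : forall r, (r <= n)%N -> `|Ex P (fun w => cos (psum r w + c)) - q ^+ r * cos c| <= r%:R * delta.
  move=> /(_ n (leqnn n)); congr (`|Ex _ _ - _| <= _).
  apply/funext => w; congr (cos (_ + _)); apply: eq_bigl => i; exact: ltn_ord.
elim=> [_|r IH rn].
  have E w : psum 0 w = 0 by rewrite /psum big_pred0.
  under [X in Ex _ X]eq_fun do rewrite E add0r.
  by rewrite Ex_cst expr0 !mul1r subrr normr0 mul0r.
rewrite (cos_psumS rn).
set a := Ex P (fun w => cos (h _)); set b := Ex P (fun w => sin (h _)).
set C := Ex P (fun w => cos _) in IH *; set D := Ex P (fun w => sin _).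
have C1 : `|C| <= 1 by apply: Ex_norm_le => [|w]; [exact: integ_cos|exact: cos_max].
have D1 : `|D| <= 1.
  apply: Ex_norm_le => [|w]; last exact: sin_max.
  apply: (integ_bounded P (C := 1)) => [|w]; last exact: sin_max.
  by apply: measurable_comp_sin; exact: measurable_funD.
have -> : C * a - D * b - q ^+ r.+1 * cos c =
  C * (a - q) - D * b + q * (C - q ^+ r * cos c) by rewrite exprS; ring.
apply: (le_trans (ler_normD _ _)); rewrite -natr1 mulrDl mul1r addrC lerD//.
  rewrite normrM (ger0_norm q0); apply: le_trans (IH (ltnW rn)).
  by rewrite ler_piMl.
apply: (le_trans (ler_normB _ _)); apply: le_trans (hd (Ordinal rn)).
by rewrite !normrM lerD// ler_piMl.
Qed.

End CharacteristicFunctionOfSums.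

(** * An explicit Lyapunov bound *)

Section LyapunovBound.
Context {d : measure_display} {T : measurableType d} {R : realType}.
Variable P : probability T R.

Section OneVariable.
Variable X : T -> R.
Hypothesis mX : measurable_fun setT X.
Hypothesis X4 : integ P (fun w => X w ^+ 4).

Lemma fourth_moment_integ (k : nat) : (k <= 4)%N -> integ P (fun w => `|X w| ^+ k).
Proof.
move=> k4; apply: (@integ_le _ _ _ _ _ (fun w => 1 + X w ^+ 4)).
- by apply: measurable_funX; exact: (measurableT_comp (@normr_measurable _ _)).
- move=> w; rewrite normrX normr_id.
  have -> : X w ^+ 4 = `|X w| ^+ 4.
    by rewrite (exprM _ 2 2) (exprM `|_| 2 2) real_normK ?num_real.
  have x4 : 0 <= `|X w| ^+ 4 by rewrite exprn_ge0.
  apply: le_trans (ler_norm _).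
  have [x1|x1] := leP `|X w| 1.
    by apply: (@le_trans _ _ 1); [rewrite exprn_ile1|rewrite lerDl].
  apply: (@le_trans _ _ (`|X w| ^+ 4)); last by rewrite lerDr.
  by apply: ler_weXn2l => //; exact: ltW.
- by apply: integD => //; exact: integ_cst.
Qed.

Lemma integ_sqr : integ P (fun w => X w ^+ 2).
Proof.
have := fourth_moment_integ (isT : (2 <= 4)%N); congr (integ _ _).
by apply/funext => w; rewrite real_normK ?num_real.
Qed.

Lemma integ_id : integ P X.
Proof.
apply: (integ_le mX _ (fourth_moment_integ (isT : (1 <= 4)%N))) => w.
by rewrite expr1 normr_id.
Qed.

Variables (v F : R).
Hypothesis EX : Ex P X = 0.
Hypothesis EX2 : Ex P (fun w => X w ^+ 2) = v.
Hypothesis EX4 : Ex P (fun w => X w ^+ 4) <= F.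

Lemma Ex_cos_taylor : `|Ex P (fun w => cos (X w)) - (1 - v / 2)| <= F / 24.
Proof.
have ic : integ P (fun w => cos (X w)).
  by apply: (integ_bounded P (measurable_comp_cos mX)) => w; exact: cos_max.
have i2 : integ P (fun w => 1 - 2^-1 * X w ^+ 2).
  by apply: integB; [exact: integ_cst|apply: integZ; exact: integ_sqr].
have -> : 1 - v / 2 = Ex P (fun w => 1 - 2^-1 * X w ^+ 2).
  rewrite ExB; [|exact: integ_cst|by apply: integZ; exact: integ_sqr].
  by rewrite Ex_cst ExZ; [rewrite EX2 mulrC|exact: integ_sqr].
rewrite -ExB//; apply: le_trans (Ex_norm (integB ic i2)) _.
apply: (@le_trans _ _ (Ex P (fun w => 24^-1 * X w ^+ 4))).
  apply: Ex_le; [exact/integ_norm/integB|exact: integZ|move=> w].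
  by have := cos_taylor (X w); rewrite (mulrC 2^-1) (mulrC 24^-1).
by rewrite ExZ// mulrC ler_wpM2r.
Qed.

(** Centring removes the linear term, and the cubic remainder is split by the arithmetic-geometric
    inequality into second and fourth moments. The free weight [eta] is later taken small, before
    [n] is taken large. *)
Lemma Ex_sin_taylor (eta : R) : 0 < eta ->
  `|Ex P (fun w => sin (X w))| <= (eta * v + F / eta) / 12.
Proof.
move=> eta0.
have is_ : integ P (fun w => sin (X w)).
  by apply: (integ_bounded P (measurable_comp_sin mX)) => w; exact: sin_max.
have -> : Ex P (fun w => sin (X w)) = Ex P (fun w => sin (X w) - X w).
  by rewrite ExB// ?EX ?subr0//; exact: integ_id.
have ie : integ P (fun w => eta / 12 * X w ^+ 2 + (12 * eta)^-1 * X w ^+ 4).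
  by apply: integD; apply: integZ => //; exact: integ_sqr.
apply: le_trans (Ex_norm (integB is_ integ_id)) _.
apply: (@le_trans _ _ (Ex P (fun w => eta / 12 * X w ^+ 2 + (12 * eta)^-1 * X w ^+ 4))).
  apply: Ex_le => // [|w]; first by apply/integ_norm/integB => //; exact: integ_id.
  apply: (le_trans (sin_taylor (X w))).
  rewrite -[X w ^+ 2]real_normK ?num_real// (_ : X w ^+ 4 = `|X w| ^+ 4); last first.
    by rewrite (exprM _ 2 2) (exprM `|_| 2 2) real_normK ?num_real.
  set x := `|X w|; rewrite -subr_ge0.
  have -> : eta / 12 * x ^+ 2 + (12 * eta)^-1 * x ^+ 4 - x ^+ 3 / 6 =
     x ^+ 2 * (eta - x) ^+ 2 / (12 * eta) by field; rewrite gt_eqF.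
  by apply: divr_ge0; [apply: mulr_ge0; exact: sqr_ge0|apply: mulr_ge0 => //; exact: ltW].
rewrite ExD; [|by apply: integZ; exact: integ_sqr|exact: integZ].
rewrite !ExZ//; last exact: integ_sqr.
rewrite EX2 [leRHS]mulrDl lerD//; first by rewrite mulrAC.
rewrite mulrC invfM mulrA mulrAC ler_wpM2r// ?invr_ge0//.
by rewrite ler_wpM2r// invr_ge0 ltW.
Qed.

End OneVariable.

Context {d' : measure_display} {S : measurableType d'} {n : nat}.
Variable W : 'I_n -> T -> S.
Hypothesis mW : forall i, measurable_fun setT (W i).
Hypothesis indW : mutually_independent P W.
Variable h : S -> R.
Hypothesis mh : measurable_fun setT h.
Variables (v F : R).
Hypothesis h4 : forall i, integ P (fun w => h (W i w) ^+ 4).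
Hypothesis Eh : forall i, Ex P (fun w => h (W i w)) = 0.
Hypothesis Eh2 : forall i, Ex P (fun w => h (W i w) ^+ 2) = v.
Hypothesis Eh4 : forall i, Ex P (fun w => h (W i w) ^+ 4) <= F.

(** Each scaled summand is compared with [q = expR (- (v / n / 2))], whose [n]-th power is the
    Gaussian value. The error per summand is of order [n ^- 2], except for the [eta] term of order
    [1 / n]; multiplied by [n], the sum is the stated bound. *)
Lemma lyapunov_bound (eta c : R) : (0 < n)%N -> 0 < eta ->
  `|Ex P (fun w => cos ((Num.sqrt n%:R)^-1 * (\sum_i h (W i w)) + c)) -
    expR (- (v / 2)) * cos c| <=
  F / n%:R / 24 + v ^+ 2 / (4 * n%:R) + (eta * v + F / n%:R / eta) / 12.
Proof.
move=> n0 eta0; set N : R := n%:R.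
have N0 : 0 < N by rewrite ltr0n.
pose s := (Num.sqrt N)^-1.
have sq : s ^+ 2 = N^-1 by rewrite /s exprVn sqr_sqrtr// ltW.
have s4 : s ^+ 4 = N^-1 ^+ 2 by rewrite (exprM _ 2 2) sq.
have s0 : 0 < s by rewrite invr_gt0 sqrtr_gt0.
have v0 : 0 <= v.
  by rewrite -(Eh2 (Ordinal n0)); apply: Ex_ge0 => w; exact: sqr_ge0.
pose g y := s * h y.
have mg : measurable_fun setT g by exact: measurable_funM.
have mgW i : measurable_fun setT (fun w => g (W i w)) by exact: measurableT_comp.
have mhW i : measurable_fun setT (fun w => h (W i w)) by exact: measurableT_comp.
have E4 i w : g (W i w) ^+ 4 = N^-1 ^+ 2 * h (W i w) ^+ 4 by rewrite exprMn s4.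
have E2 i w : g (W i w) ^+ 2 = N^-1 * h (W i w) ^+ 2 by rewrite exprMn sq.
have g4 i : integ P (fun w => g (W i w) ^+ 4).
  by under eq_fun do rewrite E4; exact: integZ.
have Eg i : Ex P (fun w => g (W i w)) = 0.
  by rewrite /g ExZ ?Eh ?mulr0//; exact: integ_id.
have Eg2 i : Ex P (fun w => g (W i w) ^+ 2) = v / N.
  under [X in Ex _ X]eq_fun do rewrite E2.
  by rewrite ExZ ?Eh2 1?mulrC//; exact: integ_sqr.
have Eg4 i : Ex P (fun w => g (W i w) ^+ 4) <= F / N ^+ 2.
  under [X in Ex _ X]eq_fun do rewrite E4.
  by rewrite ExZ// mulrC -exprVn ler_wpM2r// sqr_ge0.
pose q := expR (- (v / N / 2)).
have q01 : 0 <= q <= 1.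
  rewrite expR_ge0 /= /q -[leRHS]expR0 ler_expR oppr_le0.
  by rewrite !divr_ge0// ltW.
pose delta := F / N ^+ 2 / 24 + (v / N / 2) ^+ 2 + (eta * (v / N) + F / N ^+ 2 / eta) / 12.
have hd i : `|Ex P (fun w => cos (g (W i w))) - q| + `|Ex P (fun w => sin (g (W i w)))| <= delta.
  have h1 := Ex_cos_taylor (mgW i) (g4 i) (Eg2 i) (Eg4 i).
  have h2 := Ex_sin_taylor (mgW i) (g4 i) (Eg i) (Eg2 i) (Eg4 i) eta0.
  have h3 : `|q - (1 - v / N / 2)| <= (v / N / 2) ^+ 2.
    by apply: expRN_taylor; rewrite !divr_ge0// ltW.
  rewrite /delta lerD//.
  have -> : Ex P (fun w => cos (g (W i w))) - q =
    (Ex P (fun w => cos (g (W i w))) - (1 - v / N / 2)) - (q - (1 - v / N / 2)) by ring.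
  by apply: (le_trans (ler_normB _ _)); rewrite lerD.
have := cos_sum_close mW indW mg c q01 hd.
have -> : q ^+ n = expR (- (v / 2)).
  rewrite /q -expRM_natl; congr expR; rewrite -/N; field.
  by rewrite gt_eqF.
rewrite (_ : n%:R * delta = F / N / 24 + v ^+ 2 / (4 * N) + (eta * v + F / N / eta) / 12).
  congr (`|Ex _ _ - _| <= _); apply/funext => w; congr (cos (_ + _)).
  by rewrite mulr_sumr.
by rewrite -/N /delta; field; rewrite !gt_eqF.
Qed.

End LyapunovBound.

Section StandardNormalCharacteristicFunction.
Context {R : realType}.

(** The coefficients are indexed by [nat] so that the induction on [d] can shift them without
    casts. *)
Definition lin (d : nat) (t : nat -> R) (z : d.-tuple R) : R :=
  \sum_(j < d) t j * tnth z j.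

Lemma measurable_lin d t : measurable_fun setT (@lin d t).
Proof.
apply: measurable_sum => j; apply: measurable_funM => //; exact: measurable_tnth.
Qed.

(** By Fubini the first coordinate is integrated alone; the remaining coordinates enter that
    integral only as a phase. *)
Lemma std_normal_cos (d : nat) (t : nat -> R) c :
  Ex (@std_normal R d) (fun z => cos (lin t z + c)) =
  expR (- ((\sum_(j < d) t j ^+ 2) / 2)) * cos c.
Proof.
elim: d t c => [|d IH] t c.
  rewrite big_ord0 mul0r oppr0 expR0 mul1r -[RHS](Ex_cst (@std_normal R 0)).
  by congr (Ex _ _); apply/funext => z; rewrite /lin big_ord0 add0r.
pose g := normal_prob (0 : R) 1.
pose F (z : measurableTypeR R * d.-tuple R) := cos (lin t (Defs.cons_tuple z) + c).
have mF : measurable_fun setT F.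
  apply: measurable_cos; apply: (measurableT_comp (measurable_lin t)).
  exact: measurable_cons_tuple.
have mE : measurable_fun setT (fun z : d.+1.-tuple R => cos (lin t z + c)).
  by apply: measurable_cos; exact: measurable_lin.
have iF : (g \x std_normal d)%E.-integrable setT (EFin \o F).
  apply: (integ_bounded (g \x std_normal d)%E (C := 1) mF) => z; exact: cos_max.
have FE z : F z = cos (t 0%N * z.1 + (lin (fun j => t j.+1) z.2 + c)).
  rewrite /F /lin big_ord_recl -addrA; congr (cos (_ + (_ + _))).
  by apply: eq_bigr => j _; rewrite /Defs.cons_tuple tnthS.
transitivity (Ex (std_normal d) (fun z => expR (- (t 0%N ^+ 2 / 2)) * cos (lin (fun j => t j.+1) z + c))).
  rewrite /Ex /Rintegral; congr fine.
  transitivity (\int[(g \x std_normal d)%E]_z (F z)%:E)%E.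
    by rewrite /= integral_distribution//; exact/measurable_EFinP.
  rewrite -integral21_prod_meas1//; apply: eq_integral => z _.
  rewrite /fubini_G /=; under eq_integral do rewrite FE/=.
  have := gauss_cos (lin (fun j => t j.+1) z + c) (t 0%N).
  rewrite /Ex /Rintegral => <-; rewrite fineK//.
  apply: integrable_fin_num => //.
  apply: (integ_bounded g (C := 1)) => [|x]; last exact: cos_max.
  exact: measurable_cos_affine.
rewrite ExZ; last first.
  apply: (integ_bounded (std_normal d) (C := 1)) => [|z]; last exact: cos_max.
  by apply: measurable_cos; exact: measurable_lin.
rewrite IH mulrA -expRD; congr (expR _ * _).
by rewrite big_ord_recl /= mulrDl opprD.
Qed.

End StandardNormalCharacteristicFunction.

(** * Weak convergence from characteristic functions *)

Section TrigonometricPolynomials.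
Context {R : realType}.

(** Linear combinations of shifted cosines, so that convergence of expectations follows from the
    [TrigCos] case by linearity. Closure under products comes from the product-to-sum formula. *)
Inductive trigpoly (d : nat) : ('cV[R]_d -> R) -> Prop :=
| TrigCos t c : trigpoly (fun x => cos (dot t x + c))
| TrigAdd f g : trigpoly f -> trigpoly g -> trigpoly (fun x => f x + g x)
| TrigScale a f : trigpoly f -> trigpoly (fun x => a * f x).

Variable d : nat.
Implicit Types f g : 'cV[R]_d -> R.

Lemma trigpoly_ext f g : f =1 g -> trigpoly f -> trigpoly g.
Proof. by move=> /funext ->. Qed.

Lemma trigpoly_cst a : trigpoly (fun _ : 'cV[R]_d => a).
Proof.
apply: trigpoly_ext (TrigScale a (TrigCos (0 : 'cV[R]_d) 0)) => x.
by rewrite addr0 dot0l cos0 mulr1.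
Qed.

Lemma trigpoly_mul f g : trigpoly f -> trigpoly g -> trigpoly (fun x => f x * g x).
Proof.
move=> hf hg; elim: hf => {f} [t c|f1 f2 _ IH1 _ IH2|a f _ IH].
- elim: hg => {g} [t' c'|g1 g2 _ IH1 _ IH2|a g _ IH].
  + apply: trigpoly_ext (TrigAdd (TrigScale 2^-1 (TrigCos (t + t') (c + c')))
      (TrigScale 2^-1 (TrigCos (t - t') (c - c')))) => x.
    rewrite !dotDl dotNl.
    rewrite (_ : dot t x + dot t' x + (c + c') = (dot t x + c) + (dot t' x + c')); last by ring.
    rewrite (_ : dot t x - dot t' x + (c - c') = (dot t x + c) - (dot t' x + c')); last by ring.
    by rewrite cosD cosB; field.
  + by apply: trigpoly_ext (TrigAdd IH1 IH2) => x; rewrite mulrDr.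
  + by apply: trigpoly_ext (TrigScale a IH) => x; rewrite mulrCA.
- by apply: trigpoly_ext (TrigAdd IH1 IH2) => x; rewrite mulrDl.
- by apply: trigpoly_ext (TrigScale a IH) => x; rewrite mulrA.
Qed.

Lemma trigpoly_sum I (s : seq I) (F : I -> 'cV[R]_d -> R) :
  (forall i, trigpoly (F i)) -> trigpoly (fun x => \sum_(i <- s) F i x).
Proof.
move=> hF; elim: s => [|i s IH].
  by apply: trigpoly_ext (trigpoly_cst 0) => x; rewrite big_nil.
by apply: trigpoly_ext (TrigAdd (hF i) IH) => x; rewrite big_cons.
Qed.

Lemma trigpoly_prod I (s : seq I) (F : I -> 'cV[R]_d -> R) :
  (forall i, trigpoly (F i)) -> trigpoly (fun x => \prod_(i <- s) F i x).
Proof.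
move=> hF; elim: s => [|i s IH].
  by apply: trigpoly_ext (trigpoly_cst 1) => x; rewrite big_nil.
by apply: trigpoly_ext (trigpoly_mul (hF i) IH) => x; rewrite big_cons.
Qed.

Lemma trigpoly_sin_coord (a : R) (j : 'I_d) : trigpoly (fun x => sin (a * x j 0)).
Proof.
apply: trigpoly_ext (TrigCos (a *: delta_mx j 0) (- (pi / 2))) => x.
by rewrite cosBpihalf dotZl dotC dot_delta.
Qed.

End TrigonometricPolynomials.

Section Bernstein.
Context {R : realType}.
Implicit Types u : R.

(** The binomial probability of [k] successes in [N] trials with parameter [u], defined by
    conditioning on one trial. The recursion yields the moments by induction and keeps trigonometric
    polynomials stable. *)
Fixpoint bern (N k : nat) u : R :=
  if N is N'.+1 then (1 - u) * bern N' k u + (if k is k'.+1 then u * bern N' k' u else 0)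
  else (k == 0%N)%:R.

Lemma bern_gt N k u : (N < k)%N -> bern N k u = 0.
Proof.
elim: N k => [|N IH] [|k]//= Nk; rewrite IH ?mulr0 ?add0r; last by rewrite ltnW.
by rewrite IH ?mulr0.
Qed.

Lemma bern_ge0 N k u : 0 <= u <= 1 -> 0 <= bern N k u.
Proof.
move=> /andP[u0 u1]; elim: N k => [|N IH] k /=; first by rewrite ler0n.
apply: addr_ge0; first by rewrite mulr_ge0// subr_ge0.
by case: k => // k; rewrite mulr_ge0.
Qed.

Lemma bern_sum N u (phi : nat -> R) :
  \sum_(k < N.+2) bern N.+1 k u * phi k =
  (1 - u) * (\sum_(k < N.+1) bern N k u * phi k) +
  u * (\sum_(k < N.+1) bern N k u * phi k.+1).
Proof.
under eq_bigr do rewrite /= mulrDl.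
rewrite big_split /=; congr (_ + _).
  rewrite big_ord_recr /= bern_gt// mulr0 mul0r addr0 mulr_sumr.
  by apply: eq_bigr => k _; rewrite mulrA.
rewrite big_ord_recl /= mul0r add0r mulr_sumr.
by apply: eq_bigr => k _; rewrite mulrA.
Qed.

(** One more trial shifts the centred count by [- u] or [1 - u], so each new moment is the sum of a
    quadratic polynomial in the old centred count; [sumE] evaluates such sums. *)
Lemma bern_moments N u :
  [/\ \sum_(k < N.+1) bern N k u = 1,
      \sum_(k < N.+1) bern N k u * (k%:R - N%:R * u) = 0 &
      \sum_(k < N.+1) bern N k u * (k%:R - N%:R * u) ^+ 2 = N%:R * u * (1 - u)].
Proof.
elim: N => [|N [m0 m1 m2]].
  by rewrite !big_ord1 /= !mul0r !subrr expr0n mulr0.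
have sumE (phi : nat -> R) a b c :
    (forall k : nat, phi k = a + b * (k%:R - N%:R * u) + c * (k%:R - N%:R * u) ^+ 2) ->
    \sum_(k < N.+1) bern N k u * phi k = a + c * (N%:R * u * (1 - u)).
  move=> pE.
  transitivity (a * (\sum_(k < N.+1) bern N k u) +
    b * (\sum_(k < N.+1) bern N k u * (k%:R - N%:R * u)) +
    c * (\sum_(k < N.+1) bern N k u * (k%:R - N%:R * u) ^+ 2)).
    rewrite !mulr_sumr -!big_split /=.
    by apply: eq_bigr => k _; rewrite pE; ring.
  by rewrite m0 m1 m2; ring.
split.
- have := bern_sum N u (fun=> 1); under eq_bigr do rewrite mulr1.
  by move=> ->; rewrite !(sumE (fun=> 1) 1 0 0) => [|k]; ring.
- rewrite (bern_sum N u (fun k => k%:R - N.+1%:R * u)).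
  rewrite (sumE (fun k => k%:R - N.+1%:R * u) (- u) 1 0) => [|k]; last by rewrite -natr1; ring.
  rewrite (sumE (fun k => k.+1%:R - N.+1%:R * u) (1 - u) 1 0) => [|k]; last by rewrite -!natr1; ring.
  ring.
- rewrite (bern_sum N u (fun k => (k%:R - N.+1%:R * u) ^+ 2)).
  rewrite (sumE (fun k => (k%:R - N.+1%:R * u) ^+ 2) (u ^+ 2) (- 2 * u) 1) => [|k]; last by rewrite -natr1; ring.
  rewrite (sumE (fun k => (k.+1%:R - N.+1%:R * u) ^+ 2) ((1 - u) ^+ 2) (2 * (1 - u)) 1) => [|k]; last by rewrite -!natr1; ring.
  by rewrite -natr1; ring.
Qed.

Lemma bern_variance N u : (0 < N)%N ->
  \sum_(k < N.+1) bern N k u * (k%:R / N%:R - u) ^+ 2 = u * (1 - u) / N%:R.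
Proof.
move=> N0; have [_ _ m2] := bern_moments N u.
have Nz : N%:R != 0 :> R by rewrite pnatr_eq0 -lt0n.
apply: (@mulIf _ (N%:R ^+ 2)); first by rewrite expf_neq0.
rewrite mulr_suml (eq_bigr (fun k : 'I_N.+1 => bern N k u * (k%:R - N%:R * u) ^+ 2)).
  by rewrite m2; field.
by move=> k _; field.
Qed.

Lemma trigpoly_bern d (u : 'cV[R]_d -> R) N k : trigpoly u -> trigpoly (fun x => bern N k (u x)).
Proof.
move=> hu; elim: N k => [|N IH] k /=; first exact: trigpoly_cst.
apply: TrigAdd.
  apply: trigpoly_mul => //.
  apply: trigpoly_ext (TrigAdd (trigpoly_cst _ 1) (TrigScale (-1) hu)) => x.
  by rewrite mulN1r.
case: k => [|k]; first exact: trigpoly_cst.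
exact: trigpoly_mul.
Qed.

End Bernstein.

Section Moduli.
Context {R : realType}.

(** Uniform continuity of the inverse of sine: the increment [sin (x + e) - sin x] has a positive
    minimum over the admissible [x], by strict monotonicity and compactness. *)
Lemma sin_modulus (e : R) : 0 < e -> exists2 delta : R, 0 < delta &
  forall a b : R, - (pi / 2) <= a <= pi / 2 -> - (pi / 2) <= b <= pi / 2 ->
    `|sin a - sin b| < delta -> `|a - b| < e.
Proof.
move=> e0; have [epi|pie] := leP e pi; last first.
  exists 1 => // a b /andP[a1 a2] /andP[b1 b2] _; rewrite ltr_norml; apply/andP; split; lra.
pose phi x : R := sin (x + e) - sin x.
have cphi : continuous phi.
  move=> x; apply: cvgB; last exact: continuous_sin.
  apply: (@continuous_comp _ _ _ (fun x => x + e) sin); last exact: continuous_sin.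
  by apply: cvgD; [exact: cvg_id|exact: cvg_cst].
have le1 : - (pi / 2) <= pi / 2 - e :> R by lra.
have [c /= cin cmin] := EVT_min le1 (continuous_subspaceT cphi).
move: cin; rewrite in_itv /= => /andP[c1 c2].
have phic : 0 < phi c.
  by rewrite subr_gt0 ltr_sin ?ltrDl// in_itv/=; apply/andP; split; lra.
have gap (x y : R) : - (pi / 2) <= x -> x + e <= y -> y <= pi / 2 -> phi c <= sin y - sin x.
  move=> x1 xy y1; apply: (@le_trans _ _ (phi x)).
    by apply: cmin; rewrite in_itv/=; apply/andP; split; lra.
  rewrite lerB// leNgt ltr_sin -?leNgt// in_itv/=; apply/andP; split; lra.
exists (phi c) => // a b /andP[a1 a2] /andP[b1 b2] h; rewrite ltNge; apply/negP => he.
have [ab|ba] := leP a b.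
  have := gap a b a1; rewrite distrC ger0_norm ?subr_ge0// in he.
  move=> /(_ _ b2) gp; have := gp ltac:(lra).
  have := ler_norm (sin b - sin a); rewrite distrC; lra.
have := gap b a b1; rewrite gtr0_norm ?subr_gt0// in he.
move=> /(_ _ a2) gp; have := gp ltac:(lra).
have := ler_norm (sin a - sin b); lra.
Qed.

(** Heine's theorem with only one of the points confined to the cube. The second must be free
    because the interpolation nodes used below range over a larger cube. *)
Lemma cube_modulus d (f : 'cV[R]_d -> R) (B eta : R) : continuous f -> 0 < eta ->
  exists2 delta : R, 0 < delta & forall x y : 'cV[R]_d, (forall j, `|x j 0| <= B) ->
    (forall j, `|x j 0 - y j 0| < delta) -> `|f x - f y| <= eta.
Proof.
move=> cf eta0.
pose K := [set v : 'rV[R]_d | forall i, `[(- B), B]%classic (v ord0 i)].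
have cK : compact K.
  by apply: (@rV_compact _ _ (fun=> `[(- B), B]%classic)) => i; exact: segment_compact.
pose Pd (delta : R) (v : 'rV[R]_d) := forall y : 'cV[R]_d,
  (forall j, `|v 0 j - y j 0| < delta) -> `|f v^T - f y| <= eta.
have /(_ R (0^'+) Pd _) := (compact_near_coveringP K).1 cK.
have H : forall x, K x -> \forall x' \near x & i \near 0^'+, Pd i x'.
  move=> v0 _; have e2 : 0 < eta / 2 by lra.
  have /cvgrPdist_lt/(_ _ e2) := cf v0^T.
  rewrite near_simpl => /nbhs_ballP[r /= r0 hr].
  have hr' (z : 'cV[R]_d) : (forall j, `|v0 0 j - z j 0| < r) -> `|f v0^T - f z| < eta / 2.
    by move=> hz; apply: hr; split => // i j; rewrite !ord1 /ball /= mxE; exact: hz.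
  have r2 : 0 < r / 2 by lra.
  exists (ball v0 (r / 2), [set i : R | i < r / 2]) => /=.
    split; first exact: nbhsx_ballx.
    exact: nbhs_right_lt.
  move=> [v i] /= [[_ vb] ir] y hy.
  have vb' j : `|v0 0 j - v 0 j| < r / 2 by exact: vb.
  have h1 : `|f v0^T - f v^T| < eta / 2.
    by apply: hr' => j; rewrite mxE; apply: lt_le_trans (vb' j) _; lra.
  have h2 : `|f v0^T - f y| < eta / 2.
    apply: hr' => j; apply: le_lt_trans (ler_distD (v 0 j) _ _) _.
    have := vb' j; have := hy j; lra.
  apply: le_trans (ler_distD (f v0^T) _ _) _; rewrite distrC; lra.
move=> /(_ H) [e /= e0 he].
have e2 : 0 < e / 2 by lra.
exists (e / 2) => // x y xB xy.
have := he (e / 2); rewrite /= sub0r normrN gtr0_norm// => /(_ _ e2) h.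
have {}h := h ltac:(lra).
rewrite -(trmxK x); apply: h => [i|j]; last by rewrite mxE; exact: xy.
by rewrite /= mxE in_itv/= -ler_norml.
Qed.

End Moduli.

Section Approximation.
Context {R : realType}.

(* The approximant is the multivariate Bernstein polynomial of [f] in the variables
   [(1 + sin (x_j / L)) / 2], which is a trigonometric polynomial; being a convex
   combination of values of [f], it inherits the bound [C] on the whole space. *)
Lemma trig_approx d (f : 'cV[R]_d -> R) (C L eta : R) : continuous f ->
  (forall x, `|f x| <= C) -> 0 < L -> 0 < eta ->
  exists2 h, trigpoly h & (forall x, `|h x| <= C) /\
    forall x : 'cV[R]_d, (forall j, `|x j 0| <= L) -> `|h x - f x| <= eta.
Proof.
move=> cf fC L0 eta0.
have C0 : 0 <= C by exact: le_trans (normr_ge0 _) (fC 0).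
have e2 : 0 < eta / 2 by lra.
have [d1 d10 hd1] := cube_modulus L cf e2.
have dL : 0 < d1 / L by rewrite divr_gt0.
have [d2 d20 hd2] := sin_modulus dL.
(* Halved because [sin (x_j / L) = 2 * u j x - 1] doubles distances. *)
pose D := d2 / 2.
have D0 : 0 < D by rewrite divr_gt0.
(* With at least [B] trials, the Chebyshev error [2 * C * d / (D ^+ 2 * N)] is at most [eta / 2]. *)
pose B : R := 2 * C * d%:R / (D ^+ 2 * (eta / 2)).
have B0 : 0 <= B.
  by apply: divr_ge0; apply: mulr_ge0; rewrite ?mulr_ge0 ?sqr_ge0// ltW.
pose N := (Num.truncn B).+1.
have N0 : (0 < N)%N by [].
have NR : 0 < N%:R :> R by rewrite ltr0n.
have NB : B <= N%:R by apply/ltW; exact: truncnS_gt.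
pose u (j : 'I_d) (x : 'cV[R]_d) : R := (1 + sin (L^-1 * x j 0)) / 2.
have u01 j x : 0 <= u j x <= 1.
  have := sin_geN1 (L^-1 * x j 0); have := sin_le1 (L^-1 * x j 0).
  by move=> h1 h2; apply/andP; split; rewrite /u; lra.
(* The point at which every variable [u j] takes the value [nu j / N]. *)
pose pt (nu : {ffun 'I_d -> 'I_N.+1}) : 'cV[R]_d :=
  \col_j (L * asin (2 * ((nu j)%:R / N%:R) - 1)).
pose w (nu : {ffun 'I_d -> 'I_N.+1}) x := \prod_j bern N (nu j) (u j x).
pose h x := \sum_nu f (pt nu) * w nu x.
have w0 nu x : 0 <= w nu x by apply: prodr_ge0 => j _; exact: bern_ge0.
have w1 x : \sum_nu w nu x = 1.
  rewrite -(bigA_distr_bigA (fun j (k : 'I_N.+1) => bern N k (u j x))) big1// => j _.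
  by have [-> _ _] := bern_moments N (u j x).
have wvar x j : \sum_nu w nu x * ((nu j)%:R / N%:R - u j x) ^+ 2 <= N%:R^-1.
  pose F i (k : 'I_N.+1) := bern N k (u i x) *
    (if i == j then (k%:R / N%:R - u j x) ^+ 2 else 1).
  have FE nu : w nu x * ((nu j)%:R / N%:R - u j x) ^+ 2 = \prod_i F i (nu i).
    rewrite /F big_split /=; congr (_ * _).
    rewrite (bigD1 j)//= eqxx big1 ?mulr1// => i /negPf -> //.
  under eq_bigr do rewrite FE.
  rewrite -(bigA_distr_bigA F) (bigD1 j)//= [X in _ * X]big1 ?mulr1 => [|i ij].
    rewrite /F eqxx bern_variance// ler_pdivrMr// mulVf ?gt_eqF//.
    have /andP[a b] := u01 j x; nra.
  rewrite /F (negPf ij); under eq_bigr do rewrite mulr1.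
  by have [-> _ _] := bern_moments N (u i x).
exists h.
  apply: trigpoly_sum => nu; apply: TrigScale; apply: trigpoly_prod => j.
  apply: trigpoly_bern.
  apply: trigpoly_ext (TrigAdd (trigpoly_cst _ 2^-1) (TrigScale 2^-1 (trigpoly_sin_coord L^-1 j))) => x.
  by rewrite /u mulrDl mul1r [2^-1 * _]mulrC.
split=> [x|x xL].
  apply: (le_trans (ler_norm_sum _ _ _)); rewrite -[leRHS]mulr1 -(w1 x) mulr_sumr.
  by apply: ler_sum => nu _; rewrite normrM (ger0_norm (w0 _ _)) ler_wpM2r.
have -> : h x - f x = \sum_nu (f (pt nu) - f x) * w nu x.
  rewrite -[f x in LHS]mulr1 -(w1 x) mulr_sumr -sumrB.
  by apply: eq_bigr => nu _; rewrite mulrBl.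
apply: (le_trans (ler_norm_sum _ _ _)).
pose c := 2 * C / D ^+ 2.
have c0 : 0 <= c by apply: divr_ge0; rewrite ?sqr_ge0 ?mulr_ge0.
apply: (@le_trans _ _ (\sum_nu (eta / 2 * w nu x +
    \sum_j c * (w nu x * ((nu j)%:R / N%:R - u j x) ^+ 2)))).
  apply: ler_sum => nu _; rewrite normrM (ger0_norm (w0 _ _)).
  have -> : eta / 2 * w nu x + \sum_j c * (w nu x * ((nu j)%:R / N%:R - u j x) ^+ 2) =
     (eta / 2 + \sum_j c * ((nu j)%:R / N%:R - u j x) ^+ 2) * w nu x.
    by rewrite mulrDl mulr_suml; congr (_ + _); apply: eq_bigr => j _; ring.
  rewrite ler_wpM2r//.
  have s0 : 0 <= \sum_j c * ((nu j)%:R / N%:R - u j x) ^+ 2.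
    by apply: sumr_ge0 => j _; rewrite mulr_ge0 ?sqr_ge0.
  (* Near nodes are close to [x] through the modulus of sine, which applies because
     [|x_j / L| <= 1 <= pi / 2]. For a far node some coordinate deviates by [D], and the quadratic
     term of that coordinate already exceeds [2 * C]. *)
  have [near|] := pselect (forall j, `|(nu j)%:R / N%:R - u j x| < D).
    apply: (@le_trans _ _ (eta / 2)); last by rewrite lerDl.
    rewrite distrC; apply: hd1 => // j.
    have nu01 : 0 <= ((nu j)%:R / N%:R : R) <= 1.
      by rewrite divr_ge0//= ler_pdivrMr// mul1r ler_nat -ltnS.
    have y11 : 2 * ((nu j)%:R / N%:R) - 1 \in `[(-1 : R), 1].
      by rewrite in_itv/=; case/andP: nu01 => ? ?; apply/andP; split; lra.
    have y11' : -1 <= (2 * ((nu j)%:R / N%:R) - 1 : R) <= 1 by move: y11; rewrite in_itv.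
    rewrite mxE.
    have -> : x j 0 - L * asin (2 * ((nu j)%:R / N%:R) - 1) =
      L * (L^-1 * x j 0 - asin (2 * ((nu j)%:R / N%:R) - 1)) by field; rewrite gt_eqF.
    rewrite normrM (gtr0_norm L0) -ltr_pdivlMl// [X in _ < X]mulrC; apply: hd2.
    - have := pihalf_ge1 R; have := xL j; rewrite -ler_norml.
      rewrite normrM gtr0_norm ?invr_gt0// => xj pi1.
      by rewrite ler_pdivrMl// (le_trans xj)// ler_peMr// ltW.
    - by rewrite asin_geNpi2// asin_lepi2.
    - rewrite asinK//.
      have -> : sin (L^-1 * x j 0) - (2 * ((nu j)%:R / N%:R) - 1) =
        - (2 * ((nu j)%:R / N%:R - u j x)) by rewrite /u; field; rewrite gt_eqF.
      by rewrite normrN normrM ger0_norm//; have := near j; rewrite /D; lra.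
  move=> /existsNP[j /negP]; rewrite -leNgt => far.
  apply: (@le_trans _ _ (2 * C)).
    by apply: (le_trans (ler_normB _ _)); have := fC (pt nu); have := fC x; lra.
  apply: (@le_trans _ _ (\sum_j c * ((nu j)%:R / N%:R - u j x) ^+ 2)); last by rewrite lerDr ltW.
  rewrite (bigD1 j)//= -[leLHS]addr0 lerD//; last first.
    by apply: sumr_ge0 => i _; rewrite mulr_ge0 ?sqr_ge0.
  rewrite /c mulrAC ler_pdivlMr ?exprn_gt0// ler_wpM2l ?mulr_ge0//.
  by rewrite -[leRHS]real_normK ?num_real// ler_pXn2r// nnegrE// ltW.
rewrite big_split /= -mulr_sumr w1 mulr1 exchange_big /=.
apply: (@le_trans _ _ (eta / 2 + \sum_(j < d) c * N%:R^-1)).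
  by rewrite lerD2l; apply: ler_sum => j _; rewrite -mulr_sumr ler_wpM2l.
rewrite sumr_const card_ord -mulr_natr.
have : c * N%:R^-1 * d%:R <= eta / 2.
  rewrite mulrAC ler_pdivrMr// [leRHS]mulrC -ler_pdivrMr//.
  apply: le_trans NB; rewrite /B /c le_eqVlt; apply/orP; left; apply/eqP.
  by field; rewrite !gt_eqF.
lra.
Qed.

End Approximation.

Section WeakConvergence.
Context {R : realType}.

Lemma trigpoly_integ (disp : measure_display) (T : measurableType disp)
    (P : probability T R) d (Z : T -> 'cV[R]_d) (h : 'cV[R]_d -> R) :
  (forall j, measurable_fun setT (fun w => Z w j 0)) -> trigpoly h ->
  integ P (fun w => h (Z w)).
Proof.
move=> mZ; elim => {h} [t c|f g _ If _ Ig|a f _ If].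
- apply: integ_cos.
  rewrite (_ : (fun w => dot t (Z w)) = fun w => \sum_j t j 0 * Z w j 0).
    by apply: measurable_sum => j; exact: measurable_funM.
  by apply/funext => w; rewrite dotE.
- exact: integD.
- exact: integZ.
Qed.

Lemma trig_approx_seq d (f : 'cV[R]_d -> R) (C : R) : continuous f ->
  (forall x, `|f x| <= C) ->
  exists h : nat -> 'cV[R]_d -> R, forall N, trigpoly (h N) /\
    (forall x, `|h N x| <= C) /\
    forall x : 'cV[R]_d, (forall j, `|x j 0| <= N.+1%:R) -> `|h N x - f x| <= N.+1%:R^-1.
Proof.
move=> cf fC.
have /boolp.choice[h hh] : forall N : nat, exists g : 'cV[R]_d -> R, trigpoly g /\
    (forall x, `|g x| <= C) /\
    forall x : 'cV[R]_d, (forall j, `|x j 0| <= N.+1%:R) -> `|g x - f x| <= N.+1%:R^-1.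
  move=> N; have [||g g1 g2] := @trig_approx R d f C N.+1%:R N.+1%:R^-1 cf fC.
  - by rewrite ltr0n.
  - by rewrite invr_gt0 ltr0n.
  - by exists g.
by exists h.
Qed.

Lemma trig_approx_cvg d (f : 'cV[R]_d -> R) (h : nat -> 'cV[R]_d -> R) (x : 'cV[R]_d) :
  (forall N (x : 'cV[R]_d), (forall j, `|x j 0| <= N.+1%:R) -> `|h N x - f x| <= N.+1%:R^-1) ->
  h N x @[N --> \oo] --> f x.
Proof.
move=> hf; apply/cvgrPdist_le => e e0; near=> N.
rewrite distrC; apply: (@le_trans _ _ N.+1%:R^-1).
  apply: hf => j; apply: (@le_trans _ _ (\sum_i `|x i 0|)).
    by rewrite (bigD1 j)//= lerDl sumr_ge0.
  apply: (@le_trans _ _ N%:R); last by rewrite ler_nat.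
  near: N; exists (Num.truncn (\sum_i `|x i 0|)).+1 => // N /= xN.
  by apply: le_trans (ltW (truncnS_gt _)) _; rewrite ler_nat.
rewrite -[leRHS]invrK lef_pV2 ?posrE ?invr_gt0//.
apply: (@le_trans _ _ N%:R); last by rewrite ler_nat.
near: N; exists (Num.truncn (e^-1)).+1 => // N /= xN.
by apply: le_trans (ltW (truncnS_gt _)) _; rewrite ler_nat.
Unshelve. all: by end_near. Qed.

(** Only the coordinates of [Z] are given as measurable. Trigonometric polynomials of them are
    measurable, and [f] is a pointwise limit of such polynomials. *)
Lemma measurable_continuous_comp (disp : measure_display) (T : measurableType disp)
    d (Z : T -> 'cV[R]_d) (f : 'cV[R]_d -> R) (P : probability T R) (C : R) :
  (forall j, measurable_fun setT (fun w => Z w j 0)) -> continuous f ->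
  (forall x, `|f x| <= C) -> measurable_fun setT (fun w => f (Z w)).
Proof.
move=> mZ cf fC; have [h hh] := trig_approx_seq cf fC.
apply: (measurable_fun_cvg (h := fun N w => h N (Z w))).
  by move=> N; have [hN _] := hh N; exact: (integ_meas (trigpoly_integ P mZ hN)).
by move=> w _; apply: trig_approx_cvg => N; have [_ []] := hh N.
Qed.

Lemma std_normal_trig d (t : 'cV[R]_d) c :
  Ex (@std_normal R d) (fun z => cos (dot t (\col_j tnth z j) + c)) =
  expR (- (dot t t / 2)) * cos c.
Proof.
pose s n := if insub n is Some j then t j 0 else 0 : R.
have sE (j : 'I_d) : s j = t j 0 by rewrite /s valK.
have -> : dot t t = \sum_(j < d) s j ^+ 2.
  by rewrite dotE; apply: eq_bigr => j _; rewrite sE expr2.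
rewrite -std_normal_cos; congr (Ex _ _); apply/funext => z; congr (cos (_ + _)).
by rewrite dotE /lin; apply: eq_bigr => j _; rewrite sE mxE.
Qed.

Variables (disp : nat -> measure_display) (T : forall n, measurableType (disp n)).
Variable P : forall n, probability (T n) R.
Variable d : nat.
Variable Z : forall n, T n -> 'cV[R]_d.
Hypothesis mZ : forall n (j : 'I_d), measurable_fun setT (fun w : T n => Z w j 0).
Hypothesis Hcf : forall (t : 'cV[R]_d) c, Ex (P n) (fun w => cos (dot t (Z w) + c)) @[n --> \oo] -->
  expR (- (dot t t / 2)) * cos c.
Hypothesis Htight : forall n, (0 < n)%N -> forall j : 'I_d,
  integ (P n) (fun w => Z w j 0 ^+ 2) /\ Ex (P n) (fun w => Z w j 0 ^+ 2) <= 1.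

Let nu := @std_normal R d.
Let col (z : d.-tuple R) : 'cV[R]_d := \col_j tnth z j.

Let mcol j : measurable_fun setT (fun z => col z j 0).
Proof.
by rewrite /col; under eq_fun do rewrite mxE; exact: measurable_tnth.
Qed.

Lemma trigpoly_cvg h : trigpoly h ->
  Ex (P n) (fun w => h (Z w)) @[n --> \oo] --> Ex nu (fun z => h (col z)).
Proof.
elim => {h} [t c|f g hf If hg Ig|a f hf If].
- by rewrite std_normal_trig; exact: Hcf.
- rewrite ExD; [|exact: trigpoly_integ..].
  apply: cvg_trans (cvgD If Ig); apply: near_eq_cvg; apply: nearW => n.
  by rewrite ExD//; exact: trigpoly_integ.
- rewrite ExZ; last exact: trigpoly_integ.
  apply: cvg_trans (cvgM (cvg_cst a) If); apply: near_eq_cvg; apply: nearW => n.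
  by rewrite ExZ//; exact: trigpoly_integ.
Qed.

(** A three-epsilon argument in which [bound] is uniform in [n]. Inside the cube of half-side
    [K = N.+1] the approximation error is at most [K^-1]. Outside it some coordinate exceeds [K], so
    [2 * C] is dominated by [2 * C / K ^+ 2] times its square, whose mean [Htight] controls. *)
Lemma weak_convergence (f : 'cV[R]_d -> R) (C : R) : continuous f ->
  (forall x, `|f x| <= C) ->
  Ex (P n) (fun w => f (Z w)) @[n --> \oo] --> Ex nu (fun z => f (col z)).
Proof.
move=> cf fC; have [h hh] := trig_approx_seq cf fC.
have C0 : 0 <= C by exact: le_trans (normr_ge0 _) (fC 0).
have fint disp' (T' : measurableType disp') (P' : probability T' R) (Z' : T' -> 'cV[R]_d) :
    (forall j, measurable_fun setT (fun w => Z' w j 0)) -> integ P' (fun w => f (Z' w)).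
  move=> mZ0; apply: (integ_bounded P' (C := C)) => //.
  exact: (measurable_continuous_comp P' mZ0 cf fC).
have hnu : Ex nu (fun z => h N (col z)) @[N --> \oo] --> Ex nu (fun z => f (col z)).
  apply: (@Ex_dominated _ _ _ nu (fun N z => h N (col z)) _ (fun=> C)).
  - by move=> N; have [hN _] := hh N; exact: (integ_meas (trigpoly_integ nu mcol hN)).
  - exact: (integ_meas (fint _ _ nu _ mcol)).
  - by move=> z; apply: trig_approx_cvg => N; have [_ []] := hh N.
  - exact: integ_cst.
  - by move=> N z; have [_ [hC _]] := hh N.
have bound n N : (0 < n)%N ->
    `|Ex (P n) (fun w => f (Z w)) - Ex (P n) (fun w => h N (Z w))| <=
    (1 + 2 * C * d%:R) * N.+1%:R^-1.
  move=> n0; have [hN [hC hf]] := hh N.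
  have i1 := fint _ _ (P n) _ (@mZ n); have i2 := trigpoly_integ (P n) (@mZ n) hN.
  rewrite -ExB//; apply: le_trans (Ex_norm (integB i1 i2)) _.
  pose K : R := N.+1%:R.
  have K1 : 1 <= K by rewrite ler1n.
  have K0 : 0 < K by rewrite ltr0n.
  have is_ : integ (P n) (fun w => K^-1 + \sum_j 2 * C / K ^+ 2 * Z w j 0 ^+ 2).
    apply: integD; first exact: integ_cst.
    by apply: integ_sum => j; apply: integZ; have [] := Htight n0 j.
  apply: (@le_trans _ _ (Ex (P n) (fun w => K^-1 + \sum_j 2 * C / K ^+ 2 * Z w j 0 ^+ 2))).
    apply: Ex_le => // [|w]; first exact/integ_norm/integB.
    have c0 : 0 <= 2 * C / K ^+ 2 by apply: divr_ge0; rewrite ?sqr_ge0 ?mulr_ge0.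
    have s0 : 0 <= \sum_j 2 * C / K ^+ 2 * Z w j 0 ^+ 2.
      by apply: sumr_ge0 => j _; rewrite mulr_ge0 ?sqr_ge0.
    have [small|] := pselect (forall j, `|Z w j 0| <= K).
      by rewrite distrC (le_trans (hf _ small))// lerDl.
    move=> /existsNP[j /negP]; rewrite -ltNge => big.
    apply: (@le_trans _ _ (2 * C)).
      by apply: (le_trans (ler_normB _ _)); have := fC (Z w); have := hC (Z w); lra.
    rewrite -[leLHS]add0r lerD ?invr_ge0 ?(ltW K0)//.
    rewrite (bigD1 j)//= -[leLHS]addr0 lerD//; last first.
      by apply: sumr_ge0 => i _; rewrite mulr_ge0 ?sqr_ge0.
    rewrite mulrAC ler_pdivlMr ?exprn_gt0// ler_wpM2l ?mulr_ge0//.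
    rewrite -[leRHS]real_normK ?num_real//.
    by apply: lerXn2r; rewrite ?nnegrE //; exact: ltW.
  rewrite ExD; [|exact: integ_cst|].
  - rewrite Ex_cst Ex_sum => [|j]; last by apply: integZ; have [] := Htight n0 j.
    rewrite [leRHS]mulrDl mul1r lerD2l.
    apply: (@le_trans _ _ (\sum_(j < d) 2 * C / K ^+ 2)).
      apply: ler_sum => j _; have [ij Ej] := Htight n0 j.
      rewrite ExZ// -[leRHS]mulr1 ler_wpM2l//.
      by apply: divr_ge0; rewrite ?sqr_ge0 ?mulr_ge0.
    rewrite sumr_const card_ord -[leLHS]mulr_natr [leLHS]mulrAC.
    rewrite ler_wpM2l ?mulr_ge0 ?ler0n//.
    by rewrite lef_pV2 ?posrE ?exprn_gt0// ler_eXnr.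
  - by apply: integ_sum => j; apply: integZ; have [] := Htight n0 j.
apply/cvgrPdist_le => e e0.
have e3 : 0 < e / 3 by lra.
have [N [N1 N2]] : exists N, (1 + 2 * C * d%:R) * N.+1%:R^-1 <= e / 3 /\
    `|Ex nu (fun z => f (col z)) - Ex nu (fun z => h N (col z))| <= e / 3.
  have l1 : (1 + 2 * C * d%:R) * harmonic N @[N --> \oo] --> (0 : R).
    rewrite -[X in _ --> X](mulr0 (1 + 2 * C * d%:R)); apply: cvgM; first exact: cvg_cst.
    exact: cvg_harmonic.
  move/cvgrPdist_le : l1 => /(_ _ e3) l1.
  move/cvgrPdist_le : hnu => /(_ _ e3) l2.
  near \oo => N; exists N; split.
    have : `|0 - (1 + 2 * C * d%:R) * harmonic N| <= e / 3 by near: N.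
    rewrite sub0r normrN; apply: le_trans; exact: ler_norm.
  by near: N.
have [hN _] := hh N.
have := trigpoly_cvg hN => /cvgrPdist_le/(_ _ e3) l3.
near=> n.
have n0 : (0 < n)%N by near: n; exists 1%N.
have b := bound n N n0.
have l : `|Ex nu (fun z => h N (col z)) - Ex (P n) (fun w => h N (Z w))| <= e / 3 by near: n.
set a1 := Ex nu _ in N2 *; set a2 := Ex nu _ in N2 l; set a3 := Ex (P n) _ in b *.
set a4 := Ex (P n) _ in b l.
have -> : a1 - a3 = (a1 - a2) + (a2 - a4) - (a3 - a4) by ring.
apply: (le_trans (ler_normB _ _)).
apply: (@le_trans _ _ (e / 3 + e / 3 + e / 3)); last by lra.
by rewrite lerD// ?(le_trans b)//; apply: (le_trans (ler_normD _ _)); rewrite lerD.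
Unshelve. all: by end_near. Qed.

End WeakConvergence.

(** * Sample moments of the linear model *)

Section SampleMoments.
Context {d : measure_display} {T : measurableType d} {R : realType}.
Variable P : probability T R.
Variables (n p : nat) (X : 'I_n -> 'I_p -> T -> R) (eps : 'I_n -> T -> R).
Variables (X0 : 'I_p -> T -> R) (eps0 : T -> R) (M sigma : R).
Hypothesis mX : forall i j, measurable_fun setT (X i j).
Hypothesis meps : forall i, measurable_fun setT (eps i).
Hypothesis mX0 : forall j, measurable_fun setT (X0 j).
Hypothesis meps0 : measurable_fun setT eps0.
Hypothesis bX0 : {ae P, forall w, forall j, `|X0 j w| <= M}.
Hypothesis indW : mutually_independent P (fun i w => (rvec (X i) w, eps i w)).
Hypothesis lawW : forall i, same_law P (fun w => (rvec (X i) w, eps i w))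
  (fun w => (rvec X0 w, eps0 w)).
Hypothesis ce0 : cond_exp P (rvec X0) eps0 (cst 0).
Hypothesis cv0 : cond_var P (rvec X0) eps0 (cst (sigma ^+ 2)).

Local Notation S := ((p.-tuple R * R)%type).
Let W i w : S := (rvec (X i) w, eps i w).
Let W0 w : S := (rvec X0 w, eps0 w).
Let G := second_moment P X0.

Lemma measurable_rvec q (f : 'I_q -> T -> R) : (forall j, measurable_fun setT (f j)) ->
  measurable_fun setT (rvec f).
Proof.
move=> mf; apply/measurable_fun_tnthP => j.
rewrite (_ : _ \o _ = f j)//; apply/funext => w.
by rewrite /= tnth_mktuple.
Qed.

Let mW i : measurable_fun setT (W i).
Proof. by apply: measurable_fun_pair => //; exact: measurable_rvec. Qed.

Let mW0 : measurable_fun setT W0.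
Proof. by apply: measurable_fun_pair => //; exact: measurable_rvec. Qed.

Let lawW0 i : same_law P W0 (W i).
Proof. by move=> B mB; rewrite lawW. Qed.

Lemma Ex_transfer (phi : S -> R) i : measurable_fun setT phi ->
  integ P (fun w => phi (W0 w)) ->
  integ P (fun w => phi (W i w)) /\ Ex P (fun w => phi (W i w)) = Ex P (fun w => phi (W0 w)).
Proof.
move=> mphi iphi; split; first exact: (same_law_integ mW0 (mW i) (lawW0 i) mphi).
exact/esym/(same_law_Ex mW0 (mW i) (lawW0 i) mphi).
Qed.

Lemma integ_mul_sqr (f g : T -> R) : measurable_fun setT f -> measurable_fun setT g ->
  integ P (fun w => f w ^+ 2) -> integ P (fun w => g w ^+ 2) ->
  integ P (fun w => f w * g w).
Proof.
move=> mf mg f2 g2; apply: (integ_le _ _ (integD f2 g2)); first exact: measurable_funM.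
move=> w; rewrite normrM [leRHS]ger0_norm; last by rewrite addr_ge0 ?sqr_ge0.
rewrite -[f w ^+ 2]real_normK ?num_real// -[g w ^+ 2]real_normK ?num_real//.
have := sqr_ge0 (`|f w| - `|g w|); have := normr_ge0 (f w); have := normr_ge0 (g w); nra.
Qed.

Lemma integ_of_sqr (f : T -> R) : measurable_fun setT f ->
  integ P (fun w => f w ^+ 2) -> integ P f.
Proof.
move=> mf f2; have -> : f = fun w => f w * 1 by apply/funext => w; rewrite mulr1.
apply: integ_mul_sqr => //.
by under eq_fun do rewrite expr1n; exact: integ_cst.
Qed.

(** Off-diagonal terms factor by independence and vanish since [u] is centred; the [n] diagonal
    terms have equal means. *)
Lemma iid_sum_product (u v : S -> R) : measurable_fun setT u -> measurable_fun setT v ->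
  integ P (fun w => u (W0 w) ^+ 2) -> integ P (fun w => v (W0 w) ^+ 2) ->
  Ex P (fun w => u (W0 w)) = 0 ->
  integ P (fun w => (\sum_i u (W i w)) * (\sum_i v (W i w))) /\
  Ex P (fun w => (\sum_i u (W i w)) * (\sum_i v (W i w))) =
    n%:R * Ex P (fun w => u (W0 w) * v (W0 w)).
Proof.
move=> mu mv u2 v2 u0.
have mu2 : measurable_fun setT (fun s => u s ^+ 2) by exact: measurable_funX.
have mv2 : measurable_fun setT (fun s => v s ^+ 2) by exact: measurable_funX.
have muW i : measurable_fun setT (fun w => u (W i w)) by exact: (measurableT_comp mu (mW i)).
have mvW i : measurable_fun setT (fun w => v (W i w)) by exact: (measurableT_comp mv (mW i)).
have muW0 : measurable_fun setT (fun w => u (W0 w)) by exact: (measurableT_comp mu mW0).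
have mvW0 : measurable_fun setT (fun w => v (W0 w)) by exact: (measurableT_comp mv mW0).
have u2i i : integ P (fun w => u (W i w) ^+ 2) by have [] := Ex_transfer i mu2 u2.
have v2i i : integ P (fun w => v (W i w) ^+ 2) by have [] := Ex_transfer i mv2 v2.
have uvi i l : integ P (fun w => u (W i w) * v (W l w)) by exact: integ_mul_sqr.
have E w : (\sum_i u (W i w)) * (\sum_i v (W i w)) = \sum_i \sum_l u (W i w) * v (W l w).
  by rewrite mulr_suml; apply: eq_bigr => i _; rewrite mulr_sumr.
split.
  by under eq_fun do rewrite E; apply: integ_sum => i; exact: integ_sum.
under [X in Ex _ X]eq_fun do rewrite E.
rewrite Ex_sum => [|i]; last exact: integ_sum.
rewrite (eq_bigr (fun=> Ex P (fun w => u (W0 w) * v (W0 w)))).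
  by rewrite sumr_const card_ord mulr_natl.
move=> i _; rewrite Ex_sum// (bigD1 i)//= big1 ?addr0 => [|l li].
  have muv : measurable_fun setT (fun s => u s * v s) by exact: measurable_funM.
  by have [] := Ex_transfer i muv (integ_mul_sqr muW0 mvW0 u2 v2).
rewrite (indep_pair mW indW (i := i) (l := l)) //; last 3 first.
- by rewrite eq_sym.
- exact: integ_of_sqr.
- exact: integ_of_sqr.
have [_ ->] := Ex_transfer i mu (integ_of_sqr muW0 u2).
by rewrite u0 mul0r.
Qed.

Lemma second_momentE q (Y : 'I_q -> T -> R) j l :
  second_moment P Y j l = Ex P (fun w => Y j w * Y l w).
Proof. by rewrite mxE unlock. Qed.

Let mtnth j : measurable_fun setT (fun s : S => tnth s.1 j).
Proof. exact: (measurableT_comp (measurable_tnth j) measurable_fst). Qed.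

Let bX0' : {ae P, forall w, forall j, `|X0 j w| <= `|M|}.
Proof. by apply: filterS bX0 => w h j; exact: le_trans (h j) (ler_norm _). Qed.

Lemma integ_XX j l : integ P (fun w => X0 j w * X0 l w).
Proof.
apply: (integ_le_ae _ _ (integ_cst P (`|M| * `|M|))).
  exact: measurable_funM.
by apply: filterS bX0' => w h; rewrite !normrM !normr_id ler_pM.
Qed.

Let me2 : integ P (fun w => eps0 w ^+ 2) /\ orthog P (rvec X0) (fun w => eps0 w ^+ 2 - sigma ^+ 2).
Proof.
have h := cond_var_orthog (measurable_rvec mX0) ce0 cv0; split=> //.
have [hi _] := h; have := integD hi (integ_cst P (sigma ^+ 2)).
by congr (integ _ _); apply/funext => w; rewrite /= subrK.
Qed.

Let oe : orthog P (rvec X0) eps0.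
Proof.
have := cond_exp_orthog (measurable_rvec mX0) ce0.
by congr (orthog _ _ _); apply/funext => w; rewrite /= subr0.
Qed.

Let Xprod (c : R) (phi : p.-tuple R -> R) (Y : T -> R) : measurable_fun setT phi ->
  {ae P, forall w, `|phi (rvec X0 w)| <= c} -> orthog P (rvec X0) Y ->
  integ P (fun w => phi (rvec X0 w) * Y w) /\ Ex P (fun w => phi (rvec X0 w) * Y w) = 0.
Proof.
move=> mphi bphi oY; have [Yi _] := oY.
have i1 : integ P (fun w => phi (rvec X0 w) * Y w).
  apply: (integ_le_ae _ _ (integZ c Yi)).
    apply: measurable_funM; last exact: integ_meas Yi.
    exact: (measurableT_comp mphi (measurable_rvec mX0)).
  by apply: filterS bphi => w h; rewrite !normrM ler_wpM2r// (le_trans h)// ler_norm.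
by split=> //; apply: (orthog_mul (measurable_rvec mX0) oY mphi i1).
Qed.

Let xe j (s : S) := tnth s.1 j * s.2.

Let mxe j : measurable_fun setT (xe j).
Proof. by apply: measurable_funM => //; exact: measurable_snd. Qed.

Let xeE j w : xe j (W0 w) = X0 j w * eps0 w.
Proof. by rewrite /xe /= tnth_mktuple. Qed.

(** A product of covariates is an almost surely bounded function of the covariate vector, so
    [eps0 w ^+ 2] may be replaced by [sigma ^+ 2] under the expectation. *)
Let Exe j l : [/\ integ P (fun w => xe j (W0 w) * xe l (W0 w)),
   Ex P (fun w => xe j (W0 w) * xe l (W0 w)) = sigma ^+ 2 * G j l &
   Ex P (fun w => xe j (W0 w)) = 0].
Proof.
have [e2 o2] := me2.
pose phi (z : p.-tuple R) := tnth z j * tnth z l.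
have mphi : measurable_fun setT phi by apply: measurable_funM; exact: measurable_tnth.
have bphi : {ae P, forall w, `|phi (rvec X0 w)| <= `|M| * `|M|}.
  by apply: filterS bX0' => w h; rewrite /phi !tnth_mktuple normrM ler_pM.
have [i1 E1] := Xprod mphi bphi o2.
have i2 : integ P (fun w => sigma ^+ 2 * (X0 j w * X0 l w)) by apply: integZ; exact: integ_XX.
have FE : (fun w => xe j (W0 w) * xe l (W0 w)) = fun w =>
    phi (rvec X0 w) * (eps0 w ^+ 2 - sigma ^+ 2) + sigma ^+ 2 * (X0 j w * X0 l w).
  by apply/funext => w; rewrite !xeE /phi !tnth_mktuple; ring.
have bphi1 : {ae P, forall w, `|tnth (rvec X0 w) j| <= `|M|}.
  by apply: filterS bX0' => w h; rewrite tnth_mktuple.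
have [_ E2] := Xprod (measurable_tnth j) bphi1 oe.
split.
- by rewrite FE; exact: integD.
- by rewrite FE ExD// E1 add0r ExZ ?second_momentE//; exact: integ_XX.
- by rewrite -E2; congr (Ex _ _); apply/funext => w; rewrite xeE tnth_mktuple.
Qed.

Let score w : 'cV[R]_p := (design X w)^T *m rcol eps w.

Lemma scoreE w j : score w j 0 = \sum_i xe j (W i w).
Proof.
rewrite /score mxE; apply: eq_bigr => i _.
by rewrite !mxE /xe /= tnth_mktuple.
Qed.

(** Used with [H] the inverse of [G], where the double sum becomes the trace of the identity. *)
Lemma score_form (H : 'M[R]_p) :
  integ P (fun w => bform H (score w) (score w)) /\
  Ex P (fun w => bform H (score w) (score w)) =
    n%:R * sigma ^+ 2 * \sum_j \sum_l H j l * G j l.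
Proof.
have sq j : integ P (fun w => xe j (W0 w) ^+ 2).
  by have [] := Exe j j; under eq_fun do rewrite -expr2.
have key j l := iid_sum_product (mxe j) (mxe l) (sq j) (sq l) (let: And3 _ _ h := Exe j j in h).
have E w : bform H (score w) (score w) =
    \sum_j \sum_l H j l * ((\sum_i xe j (W i w)) * (\sum_i xe l (W i w))).
  by rewrite bformE; apply: eq_bigr => j _; apply: eq_bigr => l _; rewrite !scoreE.
have iH j l : integ P (fun w => H j l * ((\sum_i xe j (W i w)) * (\sum_i xe l (W i w)))).
  by apply: integZ; have [] := key j l.
split.
  by under eq_fun do rewrite E; apply: integ_sum => j; exact: integ_sum.
under [X in Ex _ X]eq_fun do rewrite E.
rewrite Ex_sum => [|j]; last exact: integ_sum.
rewrite mulr_sumr; apply: eq_bigr => j _.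
rewrite Ex_sum// mulr_sumr; apply: eq_bigr => l _.
have [i1 E1] := key j l; have [_ E2 _] := Exe j l.
by rewrite ExZ// E1 E2; ring.
Qed.

Lemma second_moment_form q (Y : 'I_q -> T -> R) (x : 'cV[R]_q) :
  (forall j l, integ P (fun w => Y j w * Y l w)) ->
  integ P (fun w => (\sum_j x j 0 * Y j w) ^+ 2) /\
  bform (second_moment P Y) x x = Ex P (fun w => (\sum_j x j 0 * Y j w) ^+ 2).
Proof.
move=> iY.
have E w : (\sum_j x j 0 * Y j w) ^+ 2 = \sum_j \sum_l (x j 0 * x l 0) * (Y j w * Y l w).
  rewrite expr2 mulr_suml; apply: eq_bigr => j _.
  by rewrite mulr_sumr; apply: eq_bigr => l _; ring.
split.
  by under eq_fun do rewrite E; apply: integ_sum => j; apply: integ_sum => l; exact: integZ.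
under [X in Ex _ X]eq_fun do rewrite E.
rewrite Ex_sum => [|j]; last by apply: integ_sum => l; exact: integZ.
rewrite bformE; apply: eq_bigr => j _; rewrite Ex_sum => [|l]; last exact: integZ.
by apply: eq_bigr => l _; rewrite ExZ// second_momentE mulrC.
Qed.

Lemma second_moment_sym q (Y : 'I_q -> T -> R) : (second_moment P Y)^T = second_moment P Y.
Proof.
apply/matrixP => j l; rewrite mxE !second_momentE; congr (Ex _ _).
by apply/funext => w; rewrite mulrC.
Qed.

Lemma second_moment_psd q (Y : 'I_q -> T -> R) :
  (forall j l, integ P (fun w => Y j w * Y l w)) -> psdmx (second_moment P Y).
Proof.
move=> iY; split; first exact: second_moment_sym.
move=> x; rewrite -/(bform _ _ _); have [_ ->] := second_moment_form x iY.
by apply: Ex_ge0 => w; exact: sqr_ge0.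
Qed.

Let gram w : 'M[R]_p := n%:R^-1 *: ((design X w)^T *m design X w).

Definition gram_error w := \sum_j \sum_l (gram w - G) j l ^+ 2.

Let xx j l (s : S) := tnth s.1 j * tnth s.1 l - G j l.

(** Each of the [p ^ 2] entries is a centred average of [n] i.i.d. terms with second moment at most
    [M ^+ 4]. *)
Lemma gram_error_mean : (0 < n)%N ->
  integ P gram_error /\ Ex P gram_error <= p%:R ^+ 2 * M ^+ 4 / n%:R.
Proof.
move=> n0; have N0 : n%:R != 0 :> R by rewrite pnatr_eq0 -lt0n.
have mxx j l : measurable_fun setT (xx j l).
  by apply: measurable_funB => //; exact: measurable_funM.
have xxE j l w : xx j l (W0 w) = X0 j w * X0 l w - G j l by rewrite /xx /= !tnth_mktuple.
have bXX j l : {ae P, forall w, `|X0 j w * X0 l w| <= `|M| * `|M|}.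
  by apply: filterS bX0' => w h; rewrite normrM ler_pM.
have mXX j l : measurable_fun setT (fun w => X0 j w * X0 l w) by exact: measurable_funM.
have i4 j l : integ P (fun w => (X0 j w * X0 l w) ^+ 2).
  apply: (integ_le_ae _ _ (integ_cst P ((`|M| * `|M|) ^+ 2))); first exact: measurable_funX.
  apply: filterS (bXX j l) => w h; rewrite normrX /= [leRHS]ger0_norm ?sqr_ge0//.
  by rewrite lerXn2r// ?nnegrE ?mulr_ge0.
have E4 j l : Ex P (fun w => (X0 j w * X0 l w) ^+ 2) <= M ^+ 4.
  rewrite -[leRHS](Ex_cst P); apply: Ex_ae_le => //; first exact: integ_cst.
  apply: filterS (bXX j l) => w h.
  rewrite (_ : M ^+ 4 = (`|M| * `|M|) ^+ 2); last first.
    by rewrite -expr2 real_normK ?num_real// -exprM.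
  by rewrite -[leLHS]real_normK ?num_real// lerXn2r// ?nnegrE ?mulr_ge0.
have sqE j l w : xx j l (W0 w) ^+ 2 =
    (X0 j w * X0 l w) ^+ 2 + (G j l ^+ 2 - 2 * G j l * (X0 j w * X0 l w)).
  by rewrite xxE; ring.
have i5 j l : integ P (fun w => G j l ^+ 2 - 2 * G j l * (X0 j w * X0 l w)).
  by apply: integB; [exact: integ_cst|apply: integZ; exact: integ_XX].
have sq j l : integ P (fun w => xx j l (W0 w) ^+ 2).
  by under eq_fun do rewrite sqE; exact: integD.
have Esq j l : Ex P (fun w => xx j l (W0 w) ^+ 2) <= M ^+ 4.
  under [X in Ex _ X]eq_fun do rewrite sqE.
  rewrite ExD// ExB; [|exact: integ_cst|by apply: integZ; exact: integ_XX].
  rewrite Ex_cst ExZ; last exact: integ_XX.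
  rewrite -second_momentE -/G.
  have := E4 j l; have := sqr_ge0 (G j l); lra.
have E0 j l : Ex P (fun w => xx j l (W0 w)) = 0.
  under [X in Ex _ X]eq_fun do rewrite xxE.
  rewrite ExB; [|exact: integ_XX|exact: integ_cst].
  by rewrite (Ex_cst P (G j l)) -second_momentE subrr.
have key j l := iid_sum_product (mxx j l) (mxx j l) (sq j l) (sq j l) (E0 j l).
have E w j l : (gram w - G) j l ^+ 2 =
    n%:R^-1 ^+ 2 * ((\sum_i xx j l (W i w)) * (\sum_i xx j l (W i w))).
  rewrite -expr2 -exprMn; congr (_ ^+ 2).
  rewrite /xx sumrB sumr_const card_ord mulrBr -[G j l *+ n]mulr_natl mulKf//.
  rewrite !mxE; congr (_ * _ - _); apply: eq_bigr => i _.
  by rewrite !mxE /= !tnth_mktuple.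
have iE j l : integ P (fun w => n%:R^-1 ^+ 2 * ((\sum_i xx j l (W i w)) * (\sum_i xx j l (W i w)))).
  by apply: integZ; have [] := key j l.
have errE : gram_error = fun w => \sum_j \sum_l n%:R^-1 ^+ 2 *
    ((\sum_i xx j l (W i w)) * (\sum_i xx j l (W i w))).
  by apply/funext => w; apply: eq_bigr => j _; apply: eq_bigr => l _; exact: E.
split; first by rewrite errE; apply: integ_sum => j; exact: integ_sum.
rewrite errE Ex_sum => [|j]; last exact: integ_sum.
apply: (@le_trans _ _ (\sum_(j < p) \sum_(l < p) M ^+ 4 / n%:R)).
  apply: ler_sum => j _; rewrite Ex_sum//; apply: ler_sum => l _.
  have [i1 E1] := key j l; rewrite ExZ// E1.
  rewrite (_ : _ * _ = Ex P (fun w => xx j l (W0 w) * xx j l (W0 w)) / n%:R); last by field.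
  rewrite ler_wpM2r ?invr_ge0 ?ler0n//.
  by under [X in Ex _ X]eq_fun do rewrite -expr2.
rewrite !sumr_const !card_ord -[leLHS]mulr_natl -[X in p%:R * X]mulr_natl.
by rewrite le_eqVlt; apply/orP; left; apply/eqP; ring.
Qed.

Lemma noise_combination (x : 'cV[R]_p) :
  let xi (s : S) := s.2 * \sum_j x j 0 * tnth s.1 j in
  [/\ measurable_fun setT xi, integ P (fun w => xi (W0 w) ^+ 2),
    Ex P (fun w => xi (W0 w)) = 0 &
    Ex P (fun w => xi (W0 w) ^+ 2) = sigma ^+ 2 * bform G x x].
Proof.
move=> xi.
have xiE s : xi s = \sum_j x j 0 * xe j s.
  by rewrite /xi mulr_sumr; apply: eq_bigr => j _; rewrite /xe; ring.
have xi2 w : xi (W0 w) ^+ 2 = \sum_j \sum_l (x j 0 * x l 0) * (xe j (W0 w) * xe l (W0 w)).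
  rewrite xiE expr2 mulr_suml; apply: eq_bigr => j _.
  by rewrite mulr_sumr; apply: eq_bigr => l _; ring.
have mxW j : measurable_fun setT (fun w => xe j (W0 w)) by exact: (measurableT_comp (mxe j) mW0).
have sq j : integ P (fun w => xe j (W0 w) ^+ 2).
  by have [] := Exe j j; under eq_fun do rewrite -expr2.
have i2 j l : integ P (fun w => (x j 0 * x l 0) * (xe j (W0 w) * xe l (W0 w))).
  by apply: integZ; have [] := Exe j l.
split.
- rewrite (_ : xi = fun s => \sum_j x j 0 * xe j s); last exact/funext.
  by apply: measurable_sum => j; exact: measurable_funM.
- by under eq_fun do rewrite xi2; apply: integ_sum => j; exact: integ_sum.
- under [X in Ex _ X]eq_fun do rewrite xiE.
  rewrite Ex_sum => [|j]; last by apply: integZ; exact: integ_of_sqr.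
  rewrite big1// => j _; rewrite ExZ; last exact: integ_of_sqr.
  by have [_ _ ->] := Exe j j; rewrite mulr0.
- under [X in Ex _ X]eq_fun do rewrite xi2.
  rewrite Ex_sum => [|j]; last exact: integ_sum.
  rewrite bformE mulr_sumr; apply: eq_bigr => j _; rewrite Ex_sum// mulr_sumr.
  apply: eq_bigr => l _; have [i3 E3 _] := Exe j l.
  by rewrite ExZ// E3; ring.
Qed.

(** A unit diagonal forces the smallest eigenvalue to be at most 1 and the largest eigenvalue of the
    signal block to be at least 1, which is how [rho1] and [mu1] are obtained. *)
Lemma second_moment_diag i j : ('E_P[X i j] = 0)%E -> ('V_P[X i j] = 1)%E ->
  second_moment P X0 j j = 1.
Proof.
move=> E0 V1; rewrite second_momentE -(second_moment_of_variance E0 V1).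
pose phi (s : S) := tnth s.1 j * tnth s.1 j.
have mphi : measurable_fun setT phi by exact: measurable_funM.
have iphi : integ P (fun w => phi (rvec X0 w, eps0 w)).
  have := integ_XX j j; congr (integ _ _); apply/funext => w.
  by rewrite /phi /= tnth_mktuple.
have [_] := Ex_transfer i mphi iphi; rewrite /phi => h.
transitivity (Ex P (fun w => phi (rvec X0 w, eps0 w))).
  by congr (Ex _ _); apply/funext => w; rewrite /phi /= tnth_mktuple.
rewrite -h; congr (Ex _ _); apply/funext => w.
by rewrite /= tnth_mktuple expr2.
Qed.

End SampleMoments.

(** * From the good event to the normal equations *)

Section OracleEvent.
Context {R : realType}.

(** The operator norm is at most the Frobenius norm: Cauchy-Schwarz between [x] and [E *m x], then
    once for each row. *)
Lemma sqr_bform_le p (E : 'M[R]_p) (x : 'cV[R]_p) :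
  bform E x x ^+ 2 <= (\sum_j \sum_l E j l ^+ 2) * dot x x ^+ 2.
Proof.
rewrite bform_dot; apply: (le_trans (dot_cauchy_schwarz _ _)).
rewrite [dot x x ^+ 2]expr2 mulrCA ler_wpM2l ?dot_ge0//.
rewrite dotE mulr_suml; apply: ler_sum => j _; rewrite -expr2.
pose r : 'cV[R]_p := (row j E)^T.
have -> : (E *m x) j 0 = dot r x.
  by rewrite dotE mxE; apply: eq_bigr => l _; rewrite !mxE.
apply: (le_trans (dot_cauchy_schwarz _ _)); rewrite ler_wpM2r ?dot_ge0//.
rewrite dotE le_eqVlt; apply/orP; left; apply/eqP.
by apply: eq_bigr => l _; rewrite !mxE expr2.
Qed.

Lemma dot_col_mx k m (b c : 'cV[R]_k) (b' c' : 'cV[R]_m) :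
  dot (col_mx b b') (col_mx c c') = dot b c + dot b' c'.
Proof. by rewrite /dot tr_col_mx mul_row_col mxE. Qed.

Lemma bform_usub k m (G : 'M[R]_(k + m)) (b : 'cV[R]_k) :
  bform G (col_mx b 0) (col_mx b 0) = bform (ulsubmx G) b b.
Proof.
rewrite !bform_dot -{1}(submxK G) mul_block_col !mulmx0 !addr0 dot_col_mx.
by rewrite dot0l addr0.
Qed.

Lemma bform_dsub k m (G : 'M[R]_(k + m)) (c : 'cV[R]_m) :
  bform G (col_mx 0 c) (col_mx 0 c) = bform (drsubmx G) c c.
Proof.
rewrite !bform_dot -{1}(submxK G) mul_block_col !mulmx0 !add0r dot_col_mx.
by rewrite dot0l add0r.
Qed.

Lemma scad_oracle_event (n k m : nat) (X : 'M[R]_(n, k + m))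
    (eps : 'cV[R]_n) (beta bh : 'cV[R]_(k + m)) (G : 'M[R]_(k + m))
    (a lambda rho mu b K : R) :
  2 < a -> 0 < lambda -> (0 < n)%N -> (0 < k)%N -> 0 < rho -> rho <= 1 -> 1 <= mu ->
  0 < b -> 0 <= K ->
  dsubmx beta = 0 -> (forall j, b <= `|usubmx beta j 0|) ->
  (forall c, scad_objective (X *m beta + eps) X lambda a bh <=
             scad_objective (X *m beta + eps) X lambda a c) ->
  psdmx G -> (forall x, rho * dot x x <= bform G x x) ->
  (forall x2, bform (drsubmx G) x2 x2 <= mu * dot x2 x2) ->
  \sum_j \sum_l (n%:R^-1 *: (X^T *m X) - G) j l ^+ 2 <= rho ^+ 2 / 4 ->
  bform (invmx G) (X^T *m eps) (X^T *m eps) <= K * n%:R * (k + m)%:R ->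
  16 * K * ((k + m)%:R / (n%:R * (rho * b ^+ 2))) +
    2 * (a + 1) * (k%:R * lambda ^+ 2 / (rho * b ^+ 2)) < 1 / 4 ->
  k%:R * lambda ^+ 2 / (rho * b ^+ 2) < (4 * a ^+ 2)^-1 ->
  100 * K * (mu * (k + m)%:R / (n%:R * rho ^+ 2 * lambda ^+ 2)) < 1 ->
  dsubmx bh = 0 /\
  (lsubmx X)^T *m lsubmx X *m (usubmx bh - usubmx beta) = (lsubmx X)^T *m eps.
Proof.
move=> a2 l0 n0 k0 rho0 rho1 mu1 b0 K0 beta2 bmin hmin Gp Grho Gmu err SK H1 H2 H3.
have N0 : 0 < n%:R :> R by rewrite ltr0n.
set N : R := n%:R in err SK H1 H3 N0 *.
set p : R := (k + m)%:R in SK H1 H3.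
have p0 : 0 <= p by rewrite ler0n.
have [Gs _] := Gp.
have uG : G \in unitmx.
  apply: posdef_unitmx => // x x0; apply: lt_le_trans (Grho x).
  by rewrite mulr_gt0.
set E := N^-1 *: (X^T *m X) - G in err.
(* The Gram error thus costs at most half of the form of [G], which explains the factor 1/2 in the
   lower bound on the empirical form and the factor 2 in the upper one. *)
have Eb x : `|bform E x x| <= rho / 2 * dot x x.
  rewrite -(ler_pXn2r (n := 2))// ?nnegrE; last first.
    by rewrite mulr_ge0 ?dot_ge0// divr_ge0// ltW.
  rewrite real_normK ?num_real//; apply: (le_trans (sqr_bform_le _ _)).
  rewrite exprMn ler_wpM2r ?sqr_ge0//; apply: (le_trans err).
  by rewrite le_eqVlt; apply/orP; left; apply/eqP; field.
have XE x : dot (X *m x) (X *m x) = N * (bform G x x + bform E x x).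
  have -> : bform E x x = N^-1 * dot (X *m x) (X *m x) - bform G x x.
    rewrite /E bformB; congr (_ - _).
    by rewrite bform_dot -scalemxAl dotZr dot_mull mulmxA.
  by rewrite addrC subrK mulVKf// gt_eqF.
pose S := bform (invmx G) (X^T *m eps) (X^T *m eps).
have S0 : 0 <= S.
  pose v := X^T *m eps.
  have -> : S = bform G (invmx G *m v) (invmx G *m v).
    by rewrite /S !bform_dot mulKVmx// dotC.
  by have [_] := Gp; apply.
have b2 : 0 < rho * b ^+ 2 by rewrite mulr_gt0// exprn_gt0.
have l2 : 0 < lambda ^+ 2 by rewrite exprn_gt0.
have r2 : 0 < rho ^+ 2 by rewrite exprn_gt0.
have r21 : rho ^+ 2 <= rho by rewrite expr2 ler_piMl// ltW.
have SN : 16 * S / N ^+ 2 <= 16 * K * p / N.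
  rewrite (_ : 16 * K * p / N = 16 * (K * N * p) / N ^+ 2).
    by rewrite ler_wpM2r ?invr_ge0 ?sqr_ge0// ler_wpM2l.
  by field; rewrite gt_eqF.
have H3' : 100 * K * mu * p < N * (rho ^+ 2 * lambda ^+ 2).
  have D0 : 0 < N * rho ^+ 2 * lambda ^+ 2 by rewrite !mulr_gt0.
  have := H3; rewrite mulrA ltr_pdivrMr// mul1r !mulrA; exact.
(* This follows from the condition on the null block because [mu >= 1] and [rho ^+ 2 <= rho]. *)
have N3 : 16 * K * p / N < rho * lambda ^+ 2.
  rewrite ltr_pdivrMr// [ltRHS]mulrC.
  apply: le_lt_trans (lt_le_trans H3' _).
    have : 0 <= K * p * (mu - 1) by rewrite !mulr_ge0 ?subr_ge0.
    have : 0 <= K * p by rewrite mulr_ge0.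
    lra.
  by rewrite ler_wpM2l ?(ltW N0)// ler_wpM2r// ltW.
apply: (@scad_oracle_normal_equations R n k m X eps beta bh G a lambda rho mu b S) => //.
- move=> x; rewrite XE; have := Eb x; rewrite ler_norml => /andP[h _].
  rewrite -mulrA ler_wpM2l ?(ltW N0)//; have := Grho x; lra.
- move=> x2; rewrite XE -/N; set x := col_mx 0 x2.
  have dx : dot x x = dot x2 x2 by rewrite /x dot_col_mx dot0l add0r.
  have h1 : bform G x x <= mu * dot x2 x2 by rewrite /x bform_dsub.
  have h2 : bform E x x <= rho / 2 * dot x2 x2.
    by rewrite -dx; apply: le_trans (Eb x); exact: ler_norm.
  have h3 : rho / 2 * dot x2 x2 <= mu * dot x2 x2.
    by rewrite ler_wpM2r ?dot_ge0//; lra.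
  rewrite (_ : 2 * N * mu * dot x2 x2 = N * (mu * dot x2 x2 + mu * dot x2 x2)); last by ring.
  by rewrite ler_wpM2l ?(ltW N0)//; lra.
- by move=> x2; rewrite bform_dsub.
- by move=> x; exact: inv_form_cauchy_schwarz.
- have h : (16 * K * (p / (N * (rho * b ^+ 2))) +
    2 * (a + 1) * (k%:R * lambda ^+ 2 / (rho * b ^+ 2))) * (rho * b ^+ 2) < 1 / 4 * (rho * b ^+ 2).
    by rewrite ltr_pM2r.
  have -> : rho * b ^+ 2 / 4 = 1 / 4 * (rho * b ^+ 2) by field.
  apply: le_lt_trans h.
  have -> : (16 * K * (p / (N * (rho * b ^+ 2))) +
    2 * (a + 1) * (k%:R * lambda ^+ 2 / (rho * b ^+ 2))) * (rho * b ^+ 2) =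
    16 * K * p / N + 2 * k%:R * (a + 1) * lambda ^+ 2.
    by field; rewrite !gt_eqF.
  by rewrite lerD2r.
(* Since [k >= 1] and [rho <= 1], the second ratio bounds [lambda ^+ 2 / b ^+ 2] by
   [(4 * a ^+ 2)^-1]. *)
- have a0 : 0 < a by lra.
  have h : (2 * a * lambda) ^+ 2 < b ^+ 2.
    rewrite (_ : (2 * a * lambda) ^+ 2 = lambda ^+ 2 * (4 * a ^+ 2)); last by ring.
    have a4 : 0 < 4 * a ^+ 2 by rewrite mulr_gt0// exprn_gt0.
    rewrite -ltr_pdivlMr//; move: H2; rewrite ltr_pdivrMr// => H2.
    apply: le_lt_trans (lt_le_trans H2 _).
      by rewrite ler_peMl ?(ltW l2)// ler1n.
    rewrite mulrC ler_wpM2r ?invr_ge0 ?(ltW a4)//.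
    by rewrite ler_piMl ?sqr_ge0.
  have : 2 * a * lambda < b.
    move: h; rewrite ltr_pXn2r// nnegrE ?(ltW b0)//.
    by rewrite !mulr_ge0// ltW.
  lra.
- exact: le_lt_trans SN N3.
- rewrite -/N; apply: (@le_lt_trans _ _ (N * (100 * K * mu * p))).
    rewrite (_ : N * (100 * K * mu * p) = 100 * (K * N * p) * mu); last by ring.
    by rewrite ler_wpM2r ?(le_trans _ mu1)// ler_wpM2l.
  rewrite (_ : N ^+ 2 * lambda ^+ 2 = N * (N * (1 * lambda ^+ 2))); last by ring.
  rewrite ltr_pM2l//; apply: lt_le_trans H3' _.
  rewrite ler_wpM2l ?(ltW N0)// ler_wpM2r ?(ltW l2)//.
  exact: le_trans r21 rho1.
Qed.

End OracleEvent.

(** * Moments and characteristic function of the oracle score *)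

Section LinearModelSample.
Context {d : measure_display} {T : measurableType d} {R : realType}.
Variable P : probability T R.
Variables (n k m : nat) (X : 'I_n -> 'I_(k + m) -> T -> R) (eps : 'I_n -> T -> R).
Variables (X0 : 'I_(k + m) -> T -> R) (eps0 : T -> R) (M sigma : R).
Hypothesis mX : forall i j, measurable_fun setT (X i j).
Hypothesis meps : forall i, measurable_fun setT (eps i).
Hypothesis mX0 : forall j, measurable_fun setT (X0 j).
Hypothesis meps0 : measurable_fun setT eps0.
Hypothesis bX0 : {ae P, forall w, forall j, `|X0 j w| <= M}.
Hypothesis indW : mutually_independent P (fun i w => (rvec (X i) w, eps i w)).
Hypothesis lawW : forall i, same_law P (fun w => (rvec (X i) w, eps i w))
  (fun w => (rvec X0 w, eps0 w)).
Hypothesis ce0 : cond_exp P (rvec X0) eps0 (cst 0).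
Hypothesis cv0 : cond_var P (rvec X0) eps0 (cst (sigma ^+ 2)).

Local Notation S := (((k + m).-tuple R * R)%type).
Let W i w : S := (rvec (X i) w, eps i w).
Let W0 w : S := (rvec X0 w, eps0 w).
Let G := second_moment P X0.

Let mW i : measurable_fun setT (W i).
Proof. by apply: measurable_fun_pair => //; exact: measurable_rvec. Qed.

Let mW0 : measurable_fun setT W0.
Proof. by apply: measurable_fun_pair => //; exact: measurable_rvec. Qed.

Let lawW0 i : same_law P W0 (W i).
Proof. by move=> B mB; rewrite lawW. Qed.

Variables (i0 : 'I_n) (Z : T -> R) (sigma4 rho : R).
Hypothesis ce4 : cond_exp P (rvec (fun j => X i0 (lshift m j))) (fun w => eps i0 w ^+ 4) Z.
Hypothesis Z4 : {ae P, forall w, Z w <= sigma4}.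
Hypothesis rho0 : 0 < rho.
Hypothesis Grho : forall x, rho * dot x x <= bform G x x.

Let xi (b : 'cV[R]_k) (s : S) := s.2 * \sum_j (col_mx b 0 : 'cV[R]_(k + m)) j 0 * tnth s.1 j.

Let xiE b s : xi b s = s.2 * \sum_j b j 0 * tnth s.1 (lshift m j).
Proof.
rewrite /xi big_split_ord /= [X in _ + X]big1 ?addr0 => [|j _].
  by congr (_ * _); apply: eq_bigr => j _; rewrite col_mxEu.
by rewrite col_mxEd mxE mul0r.
Qed.

(** For the first observation the variable is [l (V w) * eps i0 w], with [l] depending only on the
    covariates that [ce4] conditions on, so the fourth power of the error may be replaced by [Z], at
    most [sigma4]. Of the remaining [l ^+ 4], one square is bounded by [D] almost surely and the
    other is averaged into the form of [G]. Equality in law extends the bound to every [i]. *)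
Lemma noise_fourth_moment (b : 'cV[R]_k) i :
  integ P (fun w => xi b (W i w) ^+ 4) /\
  Ex P (fun w => xi b (W i w) ^+ 4) <=
    `|sigma4| * (dot b b * (k%:R * M ^+ 2) * bform (ulsubmx G) b b).
Proof.
have [mxi _ _ _] := noise_combination mX0 meps0 bX0 ce0 cv0 (col_mx b 0).
have mxi4 : measurable_fun setT (fun s => xi b s ^+ 4) by apply: measurable_funX.
pose V := rvec (fun j => X i0 (lshift m j)).
have mV : measurable_fun setT V by exact: measurable_rvec.
pose l (z : k.-tuple R) := \sum_j b j 0 * tnth z j.
have ml : measurable_fun setT l.
  by apply: measurable_sum => j; apply: measurable_funM => //; exact: measurable_tnth.
pose D := dot b b * (k%:R * M ^+ 2).
have D0 : 0 <= D by apply: mulr_ge0; [exact: dot_ge0|apply: mulr_ge0; [exact: ler0n|exact: sqr_ge0]].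
pose lp (s : S) := \sum_j b j 0 * tnth s.1 (lshift m j).
have mlp : measurable_fun setT lp.
  apply: measurable_sum => j; apply: measurable_funM => //.
  exact: (measurableT_comp (measurable_tnth _) measurable_fst).
have lV w : lp (W i0 w) = l (V w).
  by apply: eq_bigr => j _; rewrite !tnth_mktuple.
have bl0 : {ae P, forall w, lp (W0 w) ^+ 2 <= D}.
  apply: filterS bX0 => w h.
  pose y : 'cV[R]_k := \col_j X0 (lshift m j) w.
  have -> : lp (W0 w) = dot b y.
    by rewrite dotE; apply: eq_bigr => j _; rewrite /= tnth_mktuple mxE.
  apply: (le_trans (dot_cauchy_schwarz _ _)); rewrite ler_wpM2l ?dot_ge0//.
  rewrite dotE mulr_natl -[k in leRHS]card_ord -sumr_const; apply: ler_sum => j _.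
  rewrite mxE -expr2 -real_normK ?num_real// lerXn2r ?nnegrE//.
  by apply: le_trans (h (lshift m j)).
(* The bound on the covariates is assumed for [X0] and is carried to the observation [i0] through a
   measurable set. *)
have bl : {ae P, forall w, l (V w) ^+ 2 <= D}.
  have mQ : measurable [set s : S | lp s ^+ 2 <= D].
    rewrite (_ : mkset _ = ~` [set s | D < lp s ^+ 2]).
      by apply: measurableC; apply: measurable_gt; exact: measurable_funX.
    by apply/seteqP; split => s /=; rewrite leNgt => /negP.
  have := same_law_ae mW0 (mW i0) (lawW0 i0) mQ bl0.
  by apply: filterS => w /=; rewrite lV.
have bl4 : {ae P, forall w, `|l (V w) ^+ 4| <= D ^+ 2}.
  apply: filterS bl => w h; rewrite (exprM _ 2 2) ger0_norm ?sqr_ge0//.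
  by rewrite lerXn2r ?nnegrE ?sqr_ge0.
have [e4 Zi _ _] := ce4.
have mlV : measurable_fun setT (fun w => l (V w)) by exact: (measurableT_comp ml mV).
have ml4 : measurable_fun setT (fun w => l (V w) ^+ 4) by exact: measurable_funX.
have il2 : integ P (fun w => l (V w) ^+ 2).
  apply: (integ_le_ae _ _ (integ_cst P D)); first exact: measurable_funX.
  by apply: filterS bl => w h; rewrite !ger0_norm ?sqr_ge0.
have il4 : integ P (fun w => l (V w) ^+ 4).
  apply: (integ_le_ae ml4 _ (integ_cst P (D ^+ 2))).
  by apply: filterS bl4 => w h; rewrite [leRHS]ger0_norm ?sqr_ge0.
have mulb Y : integ P Y -> integ P (fun w => l (V w) ^+ 4 * Y w).
  move=> Yi; apply: (integ_le_ae _ _ (integZ (D ^+ 2) Yi)).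
    by apply: measurable_funM => //; exact: integ_meas Yi.
  by apply: filterS bl4 => w h; rewrite normrM [leRHS]normrM ler_wpM2r// (le_trans h)// ler_norm.
have oE := cond_exp_orthog mV ce4.
have EZ : Ex P (fun w => l (V w) ^+ 4 * eps i0 w ^+ 4) = Ex P (fun w => l (V w) ^+ 4 * Z w).
  apply/eqP; rewrite -subr_eq0 -ExB; [|exact: mulb|exact: mulb].
  have ml4' : measurable_fun setT (fun z => l z ^+ 4) by exact: measurable_funX.
  have ib : integ P (fun w => l (V w) ^+ 4 * (eps i0 w ^+ 4 - Z w)) by apply: mulb; exact: integB.
  rewrite -[X in _ == X](orthog_mul mV oE ml4' ib).
  by apply/eqP; congr (Ex _ _); apply/funext => w; rewrite mulrBr.
have xW0 w : xi b (W i0 w) ^+ 4 = l (V w) ^+ 4 * eps i0 w ^+ 4.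
  by rewrite xiE -/(lp _) lV exprMn mulrC.
have ix0 : integ P (fun w => xi b (W i0 w) ^+ 4).
  by under eq_fun do rewrite xW0; exact: mulb.
have ixW0 : integ P (fun w => xi b (W0 w) ^+ 4).
  exact: (same_law_integ (mW i0) mW0 (lawW i0) mxi4 ix0).
have [iW EW] := Ex_transfer mX meps mX0 meps0 lawW i mxi4 ixW0.
have [_ EW0] := Ex_transfer mX meps mX0 meps0 lawW i0 mxi4 ixW0.
split; first exact: iW.
rewrite EW -EW0; under [X in Ex _ X]eq_fun do rewrite xW0.
rewrite EZ; apply: (@le_trans _ _ (`|sigma4| * Ex P (fun w => l (V w) ^+ 4))).
  rewrite -ExZ//; apply: Ex_ae_le; [exact: mulb|exact: integZ|].
  apply: filterS Z4 => w h; rewrite mulrC ler_wpM2r//.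
    by rewrite (exprM _ 2 2) sqr_ge0.
  exact: le_trans h (ler_norm _).
rewrite ler_wpM2l//; apply: (@le_trans _ _ (D * Ex P (fun w => l (V w) ^+ 2))).
  rewrite -ExZ//; apply: Ex_ae_le => //; first exact: integZ.
  by apply: filterS bl => w h; rewrite (exprM _ 2 2) [leLHS]expr2 ler_wpM2r ?sqr_ge0.
rewrite ler_wpM2l//.
have mlp2 : measurable_fun setT (fun s => lp s ^+ 2) by exact: measurable_funX.
have [ilx Elx] := second_moment_form (col_mx b 0) (integ_XX mX0 bX0).
have lpE w : \sum_j (col_mx b 0 : 'cV[R]_(k + m)) j 0 * X0 j w = lp (W0 w).
  rewrite big_split_ord /= [X in _ + X]big1 ?addr0 => [|j _].
    by apply: eq_bigr => j _; rewrite col_mxEu tnth_mktuple.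
  by rewrite col_mxEd mxE mul0r.
have ilp : integ P (fun w => lp (W0 w) ^+ 2).
  by move: ilx; congr (integ _ _); apply/funext => w; rewrite lpE.
have [_ Elp] := Ex_transfer mX meps mX0 meps0 lawW i0 mlp2 ilp.
rewrite -bform_usub Elx; under [X in _ <= Ex _ X]eq_fun do rewrite lpE.
rewrite -Elp le_eqVlt; apply/orP; left; apply/eqP; congr (Ex _ _); apply/funext => w.
by rewrite -/(W i0 w) lV.
Qed.

Variables (q : nat) (B : 'M[R]_(q, k)).
Hypothesis sigma0 : 0 < sigma.
Hypothesis BG : B *m ulsubmx G *m B^T = (sigma ^- 2)%:M.

Definition oracle_score w : 'cV[R]_q :=
  (Num.sqrt n%:R)^-1 *: (B *m ((lsubmx (design X w))^T *m rcol eps w)).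

Let vec t := B^T *m t : 'cV[R]_k.

Let bform_vec t : bform (ulsubmx G) (vec t) (vec t) = sigma ^- 2 * dot t t.
Proof.
rewrite /vec bform_dot dot_mull trmxK mulmxA mulmxA BG.
by rewrite mul_scalar_mx dotZr.
Qed.

Let dot_score t w : dot t (oracle_score w) = (Num.sqrt n%:R)^-1 * \sum_i xi (vec t) (W i w).
Proof.
rewrite /oracle_score dotZr; congr (_ * _).
rewrite dotC dot_mull dotC -/(vec t) dotE; move: (vec t) => v.
rewrite [RHS](eq_bigr (fun i => \sum_j eps i w * (v j 0 * X i (lshift m j) w))); last first.
  move=> i _; rewrite xiE mulr_sumr; apply: eq_bigr => j _.
  by rewrite /= tnth_mktuple.
rewrite exchange_big /=; apply: eq_bigr => j _; rewrite mxE mulr_sumr.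
by apply: eq_bigr => i _; rewrite !mxE; ring.
Qed.

(** The bound of [noise_fourth_moment] at [vec t] with [v = dot t t]: the form of the signal block
    equals [v / sigma ^+ 2] there, and the squared norm is at most that divided by [rho]. *)
Let fourth_const (v : R) := `|sigma4| * (v / (sigma ^+ 2 * rho) * (k%:R * M ^+ 2) * (v / sigma ^+ 2)).

Lemma oracle_score_cos (t : 'cV[R]_q) (c eta : R) : 0 < eta ->
  `|Ex P (fun w => cos (dot t (oracle_score w) + c)) - expR (- (dot t t / 2)) * cos c| <=
  fourth_const (dot t t) / n%:R / 24 + dot t t ^+ 2 / (4 * n%:R) +
  (eta * dot t t + fourth_const (dot t t) / n%:R / eta) / 12.
Proof.
move=> eta0; set v := dot t t; set F := fourth_const v.
have n0 : (0 < n)%N by case: (n) i0 => [[]|].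
have s2 : 0 < sigma ^+ 2 by rewrite exprn_gt0.
have [mxi i2 E1 E2] := noise_combination mX0 meps0 bX0 ce0 cv0 (col_mx (vec t) 0).
have mxi2 : measurable_fun setT (fun s => xi (vec t) s ^+ 2) by exact: measurable_funX.
have i1 : integ P (fun w => xi (vec t) (W0 w)).
  by apply: integ_of_sqr => //; exact: (measurableT_comp mxi mW0).
have ev : bform (ulsubmx G) (vec t) (vec t) = v / sigma ^+ 2 by rewrite bform_vec mulrC.
have := lyapunov_bound mW indW (h := xi (vec t)) mxi (v := v) (F := F).
under [X in `|Ex _ X - _|]eq_fun do rewrite dot_score.
move=> /(_ _ _ _ _ eta c n0 eta0); apply.
- by move=> i; have [] := noise_fourth_moment (vec t) i.
- by move=> i; have [_ ->] := Ex_transfer mX meps mX0 meps0 lawW i mxi i1.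
- move=> i; have [_ ->] := Ex_transfer mX meps mX0 meps0 lawW i mxi2 i2.
  by rewrite E2 bform_usub -/G ev mulrC divfK// gt_eqF.
- move=> i; have [_] := noise_fourth_moment (vec t) i; move/le_trans; apply.
  rewrite ev /F /fourth_const ler_wpM2l//; apply: ler_pM => //.
  + by apply: mulr_ge0; [exact: dot_ge0|apply: mulr_ge0; [exact: ler0n|exact: sqr_ge0]].
  + by rewrite divr_ge0 ?dot_ge0// ltW.
  apply: ler_wpM2r; first by apply: mulr_ge0; [exact: ler0n|exact: sqr_ge0].
  rewrite invfM mulrA ler_pdivlMr// -ev -bform_usub mulrC.
  apply: le_trans (Grho _).
  by rewrite dot_col_mx ler_wpM2l ?(ltW rho0)// lerDl dot_ge0.
Qed.

Lemma oracle_score_variance (t : 'cV[R]_q) :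
  integ P (fun w => dot t (oracle_score w) ^+ 2) /\
  Ex P (fun w => dot t (oracle_score w) ^+ 2) = dot t t.
Proof.
have n0 : (0 < n)%N by case: (n) i0 => [[]|].
have N0 : 0 < n%:R :> R by rewrite ltr0n.
have s2 : 0 < sigma ^+ 2 by rewrite exprn_gt0.
have [mxi i2 E1 E2] := noise_combination mX0 meps0 bX0 ce0 cv0 (col_mx (vec t) 0).
have [i3 E3] := iid_sum_product mX meps mX0 meps0 indW lawW mxi mxi i2 i2 E1.
have E w : dot t (oracle_score w) ^+ 2 =
    n%:R^-1 * ((\sum_i xi (vec t) (W i w)) * (\sum_i xi (vec t) (W i w))).
  by rewrite dot_score exprMn exprVn sqr_sqrtr ?(ltW N0)// -expr2.
split; first by under eq_fun do rewrite E; exact: integZ.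
under [X in Ex _ X]eq_fun do rewrite E.
rewrite ExZ// E3 mulKf ?gt_eqF//.
under [X in Ex _ X]eq_fun do rewrite -expr2.
by rewrite E2 bform_usub -/G bform_vec mulrA mulfV ?mul1r// gt_eqF.
Qed.

End LinearModelSample.

(** * Replacing the statistic by the oracle score *)

Section OracleReplacement.
Context {d : measure_display} {T : measurableType d} {R : realType}.
Variable P : probability T R.
Variables (n k m : nat) (X : 'I_n -> 'I_(k + m) -> T -> R) (eps : 'I_n -> T -> R).
Variables (X0 : 'I_(k + m) -> T -> R) (eps0 : T -> R) (M sigma : R).
Hypothesis mX : forall i j, measurable_fun setT (X i j).
Hypothesis meps : forall i, measurable_fun setT (eps i).
Hypothesis mX0 : forall j, measurable_fun setT (X0 j).
Hypothesis meps0 : measurable_fun setT eps0.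
Hypothesis bX0 : {ae P, forall w, forall j, `|X0 j w| <= M}.
Hypothesis indW : mutually_independent P (fun i w => (rvec (X i) w, eps i w)).
Hypothesis lawW : forall i, same_law P (fun w => (rvec (X i) w, eps i w))
  (fun w => (rvec X0 w, eps0 w)).
Hypothesis ce0 : cond_exp P (rvec X0) eps0 (cst 0).
Hypothesis cv0 : cond_var P (rvec X0) eps0 (cst (sigma ^+ 2)).
Variables (bh : 'I_(k + m) -> T -> R) (beta : 'cV[R]_(k + m)) (lambda a rho mu b K C : R).
Variables (q : nat) (B : 'M[R]_(q, k)) (f : 'cV[R]_q -> R).
Hypothesis mbh : forall j, measurable_fun setT (bh j).
Hypothesis a2 : 2 < a.
Hypothesis l0 : 0 < lambda.
Hypothesis n0 : (0 < n)%N.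
Hypothesis k0 : (0 < k)%N.
Hypothesis rho0 : 0 < rho.
Hypothesis rho1 : rho <= 1.
Hypothesis mu1 : 1 <= mu.
Hypothesis b0 : 0 < b.
Hypothesis K0 : 0 < K.
Hypothesis beta2 : dsubmx beta = 0.
Hypothesis bmin : forall j, b <= `|usubmx beta j 0|.
Hypothesis hmin : forall w c,
  scad_objective (response X eps beta w) (design X w) lambda a (rcol bh w) <=
  scad_objective (response X eps beta w) (design X w) lambda a c.
Let G := second_moment P X0.
Hypothesis Grho : forall x, rho * dot x x <= bform G x x.
Hypothesis Gmu : forall x2, bform (drsubmx G) x2 x2 <= mu * dot x2 x2.
Hypothesis R1 : 16 * K * ((k + m)%:R / (n%:R * (rho * b ^+ 2))) +
    2 * (a + 1) * (k%:R * lambda ^+ 2 / (rho * b ^+ 2)) < 1 / 4.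
Hypothesis R2 : k%:R * lambda ^+ 2 / (rho * b ^+ 2) < (4 * a ^+ 2)^-1.
Hypothesis R3 : 100 * K * (mu * (k + m)%:R / (n%:R * rho ^+ 2 * lambda ^+ 2)) < 1.
Hypothesis cf : continuous f.
Hypothesis fC : forall x, `|f x| <= C.

Let X1 i := rcol (fun j => X i (lshift m j)).

Definition score_statistic w : 'cV[R]_q := (Num.sqrt n%:R)^-1 *:
  (B *m \sum_(i < n) (X1 i w *m (X1 i w)^T *m (usubmx (rcol bh w) - usubmx beta))).

Lemma gram_sum w : \sum_i (X1 i w *m (X1 i w)^T) = (lsubmx (design X w))^T *m lsubmx (design X w).
Proof.
apply/matrixP => j l; rewrite summxE !mxE; apply: eq_bigr => i _.
by rewrite !mxE big_ord1 !mxE.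
Qed.

Lemma measurable_oracle_score j : measurable_fun setT (fun w => oracle_score X eps B w j 0).
Proof.
rewrite (_ : (fun w => _) = fun w => (Num.sqrt n%:R)^-1 *
    \sum_l B j l * \sum_i X i (lshift m l) w * eps i w).
  apply: measurable_funM => //; apply: measurable_sum => l; apply: measurable_funM => //.
  by apply: measurable_sum => i; exact: measurable_funM.
apply/funext => w; rewrite /oracle_score !mxE; congr (_ * _); apply: eq_bigr => l _.
by rewrite !mxE; congr (_ * _); apply: eq_bigr => i _; rewrite !mxE.
Qed.

Lemma measurable_score_statistic j : measurable_fun setT (fun w => score_statistic w j 0).
Proof.
rewrite (_ : (fun w => _) = fun w => (Num.sqrt n%:R)^-1 *
    \sum_l B j l * \sum_i \sum_r X i (lshift m l) w * X i (lshift m r) w *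
      (bh (lshift m r) w - usubmx beta r 0)).
  apply: measurable_funM => //; apply: measurable_sum => l; apply: measurable_funM => //.
  apply: measurable_sum => i; apply: measurable_sum => r; apply: measurable_funM.
    exact: measurable_funM.
  exact: measurable_funB.
apply/funext => w; rewrite /score_statistic !mxE; congr (_ * _); apply: eq_bigr => l _.
congr (_ * _); rewrite summxE; apply: eq_bigr => i _; rewrite mxE.
by apply: eq_bigr => r _; rewrite !mxE big_ord1 !mxE.
Qed.

Let score w := (design X w)^T *m rcol eps w.
Let Sform w := bform (invmx G) (score w) (score w).
Let gerr := gram_error P X X0.

Let Gpsd : psdmx G.
Proof. by apply: second_moment_psd => j l; exact: (integ_XX mX0 bX0). Qed.

Let uG : G \in unitmx.
Proof.
have [Gs _] := Gpsd; apply: posdef_unitmx => // x x0; apply: lt_le_trans (Grho x).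
by rewrite mulr_gt0.
Qed.

Let p0 : 0 < (k + m)%:R :> R.
Proof. by rewrite ltr0n addn_gt0 k0. Qed.

Lemma score_form_mean : integ P Sform /\ Ex P Sform = n%:R * sigma ^+ 2 * (k + m)%:R.
Proof.
have [iS ES] := score_form mX meps mX0 meps0 bX0 indW lawW ce0 cv0 (invmx G).
split=> //; rewrite ES; congr (_ * _).
have [Gs _] := Gpsd.
transitivity (\tr (invmx G *m G)).
  rewrite /mxtrace; apply: eq_bigr => j _; rewrite mxE; apply: eq_bigr => l _.
  by congr (_ * _); rewrite -/G -[in LHS]Gs [LHS]mxE.
by rewrite mulVmx// mxtrace1.
Qed.

Lemma Sform_ge0 w : 0 <= Sform w.
Proof.
rewrite /Sform -[score w](mulKVmx uG); move: (invmx G *m score w) => y.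
rewrite [bform _ _ _]bform_dot mulKmx// dotC -bform_dot.
by have [_] := Gpsd; apply.
Qed.

Lemma gram_error_ge0 w : 0 <= gerr w.
Proof. by apply: sumr_ge0 => j _; apply: sumr_ge0 => l _; exact: sqr_ge0. Qed.

Lemma statistic_eq_oracle w : gerr w <= rho ^+ 2 / 4 -> Sform w <= K * n%:R * (k + m)%:R ->
  score_statistic w = oracle_score X eps B w.
Proof.
move=> hg hS.
have [_ e] := scad_oracle_event a2 l0 n0 k0 rho0 rho1 mu1 b0 (ltW K0) beta2 bmin (hmin w)
  Gpsd Grho Gmu hg hS R1 R2 R3.
by rewrite /score_statistic -mulmx_suml gram_sum e.
Qed.

(** Chebyshev's and Markov's inequalities in integrated form. The difference is 0 on the good event
    and at most [2 * C] elsewhere, where one of the two nonnegative terms of [u] is already at least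
    [2 * C]; the mean of [u] gives the bound. *)
Lemma oracle_replacement :
  `|Ex P (fun w => f (score_statistic w)) - Ex P (fun w => f (oracle_score X eps B w))| <=
  2 * C * (4 * M ^+ 4 * ((k + m)%:R ^+ 2 / (n%:R * rho ^+ 2)) + sigma ^+ 2 / K).
Proof.
have N0 : 0 < n%:R :> R by rewrite ltr0n.
have C0 : 0 <= C by exact: le_trans (normr_ge0 _) (fC 0).
have C20 : 0 <= 2 * C by rewrite mulr_ge0.
have ms := measurable_continuous_comp P measurable_score_statistic cf fC.
have mo := measurable_continuous_comp P measurable_oracle_score cf fC.
have is_ : integ P (fun w => f (score_statistic w)) by exact: (integ_bounded P ms).
have io : integ P (fun w => f (oracle_score X eps B w)) by exact: (integ_bounded P mo).
have [ig Eg] := gram_error_mean mX meps mX0 meps0 bX0 indW lawW n0.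
have [iS ES] := score_form_mean.
have r2 : 0 < rho ^+ 2 by rewrite exprn_gt0.
have Knp : 0 < K * n%:R * (k + m)%:R by rewrite !mulr_gt0.
pose u w := 2 * C * (4 / rho ^+ 2) * gerr w + 2 * C / (K * n%:R * (k + m)%:R) * Sform w.
have iu : integ P u by apply: integD; exact: integZ.
rewrite -ExB//; apply: le_trans (Ex_norm (integB is_ io)) _.
apply: (@le_trans _ _ (Ex P u)).
  apply: Ex_le => // [|w]; first exact/integ_norm/integB.
  have u1 : 0 <= 2 * C * (4 / rho ^+ 2) * gerr w.
    apply: mulr_ge0; last exact: gram_error_ge0.
    by apply: mulr_ge0 => //; apply: divr_ge0 => //; exact: ltW.
  have u2 : 0 <= 2 * C / (K * n%:R * (k + m)%:R) * Sform w.
    by apply: mulr_ge0; [apply: divr_ge0 => //; exact: ltW|exact: Sform_ge0].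
  have d2 : `|f (score_statistic w) - f (oracle_score X eps B w)| <= 2 * C.
    apply: (le_trans (ler_normB _ _)).
    by have := fC (score_statistic w); have := fC (oracle_score X eps B w); lra.
  have [hg|hg] := leP (gerr w) (rho ^+ 2 / 4); last first.
    apply: (le_trans d2); apply: (@le_trans _ _ (2 * C * (4 / rho ^+ 2) * gerr w)).
      rewrite -[leLHS]mulr1 -[leRHS]mulrA ler_wpM2l//.
      rewrite mulrAC ler_pdivlMr// mul1r mulrC -ler_pdivrMr//; exact: ltW.
    by rewrite lerDl.
  have [hS|hS] := leP (Sform w) (K * n%:R * (k + m)%:R); last first.
    apply: (le_trans d2).
    apply: (@le_trans _ _ (2 * C / (K * n%:R * (k + m)%:R) * Sform w)).
      rewrite mulrAC -[leLHS]mulr1 -[leRHS]mulrA ler_wpM2l//.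
      by rewrite ler_pdivlMr// mul1r ltW.
    by rewrite lerDr.
  by rewrite statistic_eq_oracle// subrr normr0 addr_ge0.
rewrite ExD; [|exact: integZ|exact: integZ].
rewrite !ExZ// ES [leRHS]mulrDr lerD//.
  rewrite -!mulrA ler_wpM2l// ler_wpM2l//.
  apply: (@le_trans _ _ (4 / rho ^+ 2 * ((k + m)%:R ^+ 2 * M ^+ 4 / n%:R))).
    rewrite [leLHS]mulrA ler_wpM2l//.
    by rewrite divr_ge0 ?(ltW r2)//.
  rewrite le_eqVlt; apply/orP; left; apply/eqP; field.
  by rewrite !gt_eqF.
rewrite le_eqVlt; apply/orP; left; apply/eqP; field.
by rewrite -natrD (gt_eqF K0) (gt_eqF p0) (gt_eqF N0).
Qed.

End OracleReplacement.

(** * Asymptotic normality *)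

Section Normalization.
Context {R : realType}.

Lemma min_abs_le p (b : 'cV[R]_p) j : min_abs b <= `|b j 0|.
Proof. by apply: ge_inf; [exists 0 => _ [i _ <-]|exists j]. Qed.

Lemma min_abs_gt0 p (b : 'cV[R]_p) : (0 < p)%N -> (forall j, b j 0 != 0) -> 0 < min_abs b.
Proof.
move=> p0 b0; pose i0 := Ordinal p0.
case: (@arg_minP _ _ _ i0 xpredT (fun j => `|b j 0|) isT) => i _ imin.
apply: (@lt_le_trans _ _ `|b i 0|); first by rewrite normr_gt0.
apply: lb_le_inf; first by exists `|b i0 0|; exists i0.
by move=> _ [j _ <-]; exact: imin.
Qed.

(** The inner product [invsqrtmx G *m G *m invsqrtmx G] collapses to the identity, and then the
    outer roots normalize [s ^+ 2 *: (A *m A^T)], invertible because [A] has full row rank. This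
    makes the covariance of the oracle score the identity. *)
Lemma normalizer_identity d k (A : 'M[R]_(d, k)) (G : 'M[R]_k) (s : R) : 0 < s ->
  row_free A -> psdmx G -> G \in unitmx ->
  let B := invsqrtmx (s ^+ 2 *: (A *m A^T)) *m A *m invsqrtmx G in
  B *m G *m B^T = (s ^- 2)%:M.
Proof.
move=> s0 fA Gp uG B; have s2 : 0 < s ^+ 2 by rewrite exprn_gt0.
pose H := s ^+ 2 *: (A *m A^T).
have Hform v : bform H v v = s ^+ 2 * dot (A^T *m v) (A^T *m v).
  by rewrite bform_dot -scalemxAl dotZr -mulmxA dot_mull trmxK.
have Hs : H^T = H by rewrite linearZ /= trmx_mul trmxK.
have Hp : psdmx H.
  by split=> // v; rewrite -/(bform _ _ _) Hform mulr_ge0 ?dot_ge0// ltW.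
have uH : H \in unitmx.
  apply: posdef_unitmx => // v v0; rewrite Hform mulr_gt0//.
  rewrite lt_neqAle dot_ge0 andbT eq_sym; apply: contraL v0 => /eqP/dot_eq0 e.
  suff -> : v = 0 by rewrite dot0l ltxx.
  apply: trmx_inj; rewrite trmx0; apply/eqP; rewrite -(mulmx_free_eq0 _ fA).
  by rewrite -[A]trmxK -trmx_mul e trmx0.
have [Cs CHC] := invsqrtmxP Hp uH; have [Ds DGD] := invsqrtmxP Gp uG.
rewrite /B -/H; set C := invsqrtmx H in Cs CHC *; set D := invsqrtmx G in Ds DGD *.
rewrite !trmx_mul Cs Ds.
have -> : C *m A *m D *m G *m (D *m (A^T *m C)) = C *m A *m (D *m G *m D) *m A^T *m C.
  by rewrite !mulmxA.
rewrite DGD mulmx1 -[C *m A *m A^T]mulmxA.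
have : s ^- 2 *: (C *m H *m C) = (s ^- 2)%:M by rewrite CHC scalemx1.
rewrite /H -scalemxAr -scalemxAl scalerA mulVf ?scale1r//.
by rewrite gt_eqF.
Qed.

Lemma cvg0_near_lt (u : nat -> R) (e : R) : u n @[n --> \oo] --> 0 -> 0 < e ->
  \forall n \near \oo, u n < e.
Proof.
move=> /cvgrPdist_lt h e0; have := h e e0; apply: filterS => n.
by rewrite sub0r normrN; apply: le_lt_trans; exact: ler_norm.
Qed.

Lemma cvg0_sqr (u : nat -> R) : u n @[n --> \oo] --> 0 -> u n ^+ 2 @[n --> \oo] --> 0.
Proof.
move=> h; rewrite -[X in _ --> X](mulr0 (0 : R)).
by under eq_fun do rewrite expr2; exact: cvgM.
Qed.

End Normalization.

Section ConstantsAndRates.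
Context {R : realType}.

Lemma bform_delta p (G : 'M[R]_p) j : bform G (delta_mx j 0) (delta_mx j 0) = G j j.
Proof.
rewrite bform_dot dotC dot_delta mxE (bigD1 j)//= big1 ?addr0 => [|i ij].
  by rewrite mxE !eqxx mulr1.
by rewrite mxE (negbTE ij) mulr0.
Qed.

Lemma dot_delta1 p (j : 'I_p) : dot (delta_mx j 0) (delta_mx j 0) = 1 :> R.
Proof. by rewrite dot_delta mxE !eqxx. Qed.

Lemma eig_min_le_diag p (G : 'M[R]_p) j : G^T = G -> eig_min G <= G j j.
Proof.
by move=> /(ge_eig_min (delta_mx j 0)); rewrite dot_delta1 mulr1 bform_delta.
Qed.

Lemma diag_le_eig_max p (G : 'M[R]_p) j : G^T = G -> G j j <= eig_max G.
Proof.
by move=> /(le_eig_max (delta_mx j 0)); rewrite dot_delta1 mulr1 bform_delta.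
Qed.

(** Squaring the three rates removes the roots and gives exactly the ratios required by
    [scad_oracle_event]. *)
Lemma rates_near (k p : nat -> nat) (rho b lambda mu : nat -> R) (a K : R) :
  2 < a -> 0 < K -> (forall n, 0 < rho n) -> (forall n, 0 < b n) ->
  (forall n, 0 < lambda n) -> (forall n, (0 < n)%N -> 1 <= mu n) ->
  Num.sqrt (p n)%:R / (Num.sqrt (n%:R * rho n) * b n) @[n --> \oo] --> 0 ->
  lambda n * Num.sqrt (k n)%:R / (Num.sqrt (rho n) * b n) @[n --> \oo] --> 0 ->
  Num.sqrt (mu n * (p n)%:R) / (Num.sqrt n%:R * rho n * lambda n) @[n --> \oo] --> 0 ->
  \forall n \near \oo,
    [/\ 16 * K * ((p n)%:R / (n%:R * (rho n * b n ^+ 2))) +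
          2 * (a + 1) * ((k n)%:R * lambda n ^+ 2 / (rho n * b n ^+ 2)) < 1 / 4,
        (k n)%:R * lambda n ^+ 2 / (rho n * b n ^+ 2) < (4 * a ^+ 2)^-1 &
        100 * K * (mu n * (p n)%:R / (n%:R * rho n ^+ 2 * lambda n ^+ 2)) < 1].
Proof.
move=> a2 K0 rho0 b0 l0 mu1 /cvg0_sqr h1 /cvg0_sqr h2 /cvg0_sqr h3.
have a0 : 0 < a by lra.
(* With [(128 * K)^-1] and [(16 * (a + 1))^-1] as thresholds, each summand of the first inequality
   stays below 1/8. *)
have K1 : 0 < (128 * K)^-1 by rewrite invr_gt0 mulr_gt0.
have K2 : 0 < (100 * K)^-1 by rewrite invr_gt0 mulr_gt0.
have A1 : 0 < (16 * (a + 1))^-1 by rewrite invr_gt0; lra.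
have A2 : 0 < (4 * a ^+ 2)^-1 by rewrite invr_gt0 mulr_gt0// exprn_gt0.
near=> n.
have n0 : (0 < n)%N by near: n; exact: nbhs_infty_gt.
have E1 : (p n)%:R / (n%:R * (rho n * b n ^+ 2)) < (128 * K)^-1.
  have : (Num.sqrt (p n)%:R / (Num.sqrt (n%:R * rho n) * b n)) ^+ 2 < (128 * K)^-1.
    by near: n; exact: cvg0_near_lt h1 K1.
  by rewrite expr_div_n exprMn !sqr_sqrtr ?mulr_ge0 ?(ltW (rho0 n))// -mulrA.
have E2 : (k n)%:R * lambda n ^+ 2 / (rho n * b n ^+ 2) < Num.min (16 * (a + 1))^-1 (4 * a ^+ 2)^-1.
  have : (lambda n * Num.sqrt (k n)%:R / (Num.sqrt (rho n) * b n)) ^+ 2 <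
      Num.min (16 * (a + 1))^-1 (4 * a ^+ 2)^-1.
    by near: n; apply: (cvg0_near_lt h2); rewrite lt_min A1.
  by rewrite expr_div_n !exprMn !sqr_sqrtr ?(ltW (rho0 n))// [lambda n ^+ 2 * _]mulrC.
have E3 : mu n * (p n)%:R / (n%:R * rho n ^+ 2 * lambda n ^+ 2) < (100 * K)^-1.
  have : (Num.sqrt (mu n * (p n)%:R) / (Num.sqrt n%:R * rho n * lambda n)) ^+ 2 < (100 * K)^-1.
    by near: n; exact: cvg0_near_lt h3 K2.
  have m0 : 0 <= mu n by apply: le_trans (mu1 n n0).
  by rewrite expr_div_n !exprMn !sqr_sqrtr ?mulr_ge0.
move: E2; rewrite lt_min => /andP[E2 E2']; split => //.
- rewrite -[ltRHS](_ : 16 * K * (128 * K)^-1 + 2 * (a + 1) * (16 * (a + 1))^-1 = _).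
    apply: ltrD; rewrite ltr_pM2l//; [exact: mulr_gt0|lra].
  by field; rewrite !gt_eqF//; lra.
- by rewrite mulrC -ltr_pdivlMr ?mulr_gt0// div1r.
Unshelve. all: by end_near. Qed.

End ConstantsAndRates.

Section AsymptoticNormality.
Context {R : realType}.
Variables (disp : nat -> measure_display) (T : forall n, measurableType (disp n)).
Variables (P : forall n, probability (T n) R) (k m : nat -> nat).
Variables (X : forall n, 'I_n -> 'I_(k n + m n) -> T n -> R) (eps : forall n, 'I_n -> T n -> R).
Variables (X0 : forall n, 'I_(k n + m n) -> T n -> R) (eps0 : forall n, T n -> R).
Variables (beta : forall n, 'cV[R]_(k n + m n)) (lambda : nat -> R) (a sigma M sigma4 : R).
Variables (bh : forall n, 'I_(k n + m n) -> T n -> R) (d : nat) (A : forall n, 'M[R]_(d, k n)).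
Hypothesis mX : forall n i j, measurable_fun setT (@X n i j).
Hypothesis meps : forall n i, measurable_fun setT (@eps n i).
Hypothesis mX0 : forall n j, measurable_fun setT (@X0 n j).
Hypothesis meps0 : forall n, measurable_fun setT (@eps0 n).
Hypothesis mbh : forall n j, measurable_fun setT (@bh n j).
Hypothesis a2 : 2 < a.
Hypothesis sigma0 : 0 < sigma.
Hypothesis l0 : forall n, 0 < lambda n.
Hypothesis beta1 : forall n j, usubmx (beta n) j 0 != 0.
Hypothesis beta2 : forall n, dsubmx (beta n) = 0.
Hypothesis hmin : forall n w c,
  scad_objective (response (@X n) (@eps n) (beta n) w) (design (@X n) w)
    (lambda n) a (rcol (@bh n) w) <=
  scad_objective (response (@X n) (@eps n) (beta n) w) (design (@X n) w) (lambda n) a c.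
Hypothesis d0 : (0 < d)%N.
Hypothesis fA : forall n, row_free (A n).
Hypothesis bX0 : forall n, {ae P n, forall w, forall j, `|X0 j w| <= M}.
Hypothesis ce4 : forall n (i : 'I_n), i = 0%N :> nat ->
  exists2 Z : T n -> R,
    cond_exp (P n) (rvec (fun j => X i (lshift (m n) j))) (fun w => eps i w ^+ 4) Z
    & {ae P n, forall w, Z w <= sigma4}.
Hypothesis indW : forall n, mutually_independent (P n) (fun i w => (rvec (@X n i) w, eps i w)).
Hypothesis lawW : forall n i, same_law (P n) (fun w => (rvec (@X n i) w, eps i w))
  (fun w => (rvec (@X0 n) w, eps0 w)).
Hypothesis EX : forall n i j, ('E_(P n)[@X n i j] = 0)%E.
Hypothesis VX : forall n i j, ('V_(P n)[@X n i j] = 1)%E.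
Hypothesis ce0 : forall n, cond_exp (P n) (rvec (@X0 n)) (@eps0 n) (cst 0).
Hypothesis cv0 : forall n, cond_var (P n) (rvec (@X0 n)) (@eps0 n) (cst (sigma ^+ 2)).

Let p n := (k n + m n)%N.
Let G n := second_moment (P n) (@X0 n).
Let rho n := eig_min (G n).
Let mu n := Num.max (eig_max (ulsubmx (G n))) (eig_max (drsubmx (G n))).
Let b n := min_abs (usubmx (beta n)).
Let B n := invsqrtmx (sigma ^+ 2 *: (A n *m (A n)^T)) *m A n *m invsqrtmx (ulsubmx (G n)).

Hypothesis rho0 : forall n, 0 < rho n.
Hypothesis rate_p : (p n)%:R ^+ 2 / (n%:R * rho n ^+ 2) @[n --> \oo] --> 0.
Hypothesis rate_pb : Num.sqrt (p n)%:R / (Num.sqrt (n%:R * rho n) * b n) @[n --> \oo] --> 0.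
Hypothesis rate_lb :
  lambda n * Num.sqrt (k n)%:R / (Num.sqrt (rho n) * b n) @[n --> \oo] --> 0.
Hypothesis rate_l :
  Num.sqrt (mu n * (p n)%:R) / (Num.sqrt n%:R * rho n * lambda n) @[n --> \oo] --> 0.

Let k0 n : (0 < k n)%N.
Proof. by apply: leq_trans d0 _; rewrite -(eqP (fA n)) rank_leq_col. Qed.

Let Gs n : (G n)^T = G n. Proof. exact: second_moment_sym. Qed.

Let Gpsd n : psdmx (G n).
Proof. by apply: second_moment_psd => j l; exact: (integ_XX (@mX0 n) (bX0 n)). Qed.

Let ulGs n : (ulsubmx (G n))^T = ulsubmx (G n).
Proof. by rewrite trmx_ulsub Gs. Qed.

Let Grho n x : rho n * dot x x <= bform (G n) x x.
Proof. exact: ge_eig_min. Qed.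

Let Gmu n x : bform (drsubmx (G n)) x x <= mu n * dot x x.
Proof.
apply: le_trans (le_eig_max _ _) _; first by rewrite trmx_drsub Gs.
by rewrite ler_wpM2r ?dot_ge0// le_max lexx orbT.
Qed.

Let Gdiag n j : (0 < n)%N -> G n j j = 1.
Proof.
by move=> n0; exact: (second_moment_diag (@mX n) (@meps n) (@mX0 n) (meps0 (n:=n)) (bX0 n)
  (@lawW n) (EX (Ordinal n0) j) (VX (Ordinal n0) j)).
Qed.

Let rho1 n : (0 < n)%N -> rho n <= 1.
Proof.
by move=> n0; rewrite -(Gdiag (lshift _ (Ordinal (k0 n))) n0); exact: eig_min_le_diag.
Qed.

Let mu1 n : (0 < n)%N -> 1 <= mu n.
Proof.
move=> n0; rewrite -(Gdiag (lshift _ (Ordinal (k0 n))) n0) le_max; apply/orP; left.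
by have := diag_le_eig_max (Ordinal (k0 n)) (ulGs n); rewrite !mxE.
Qed.

Let BG n : B n *m ulsubmx (G n) *m (B n)^T = (sigma ^- 2)%:M.
Proof.
have pos (x : 'cV[R]_(k n)) : rho n * dot x x <= bform (ulsubmx (G n)) x x.
  by have := Grho (col_mx x (0 : 'cV_(m n))); rewrite bform_usub dot_col_mx dot0l addr0.
apply: normalizer_identity => //.
  split=> // x; rewrite -/(bform _ _ _); apply: le_trans (pos x).
  by rewrite mulr_ge0 ?dot_ge0// ltW.
by apply: posdef_unitmx => // x x0; apply: lt_le_trans (pos x); rewrite mulr_gt0.
Qed.

Let b0 n : 0 < b n.
Proof. by apply: min_abs_gt0; [exact: k0|exact: beta1]. Qed.

Let Z n := oracle_score (@X n) (@eps n) (B n).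

Let mZ n j : measurable_fun setT (fun w => @Z n w j 0).
Proof. exact: measurable_oracle_score. Qed.

(** Apart from the [eta] term, every error is a multiple of [k / (n * rho)] or [1 / n], and both are
    at most the single rate [r = p ^ 2 / (n * rho ^ 2)]. *)
Lemma oracle_score_characteristic (t : 'cV[R]_d) c :
  Ex (P n) (fun w => cos (dot t (@Z n w) + c)) @[n --> \oo] -->
  expR (- (dot t t / 2)) * cos c.
Proof.
set v := dot t t; have v0 : 0 <= v := dot_ge0 _.
have s2 : 0 < sigma ^+ 2 by rewrite exprn_gt0.
pose c0 := `|sigma4| * (v ^+ 2 * M ^+ 2 / sigma ^+ 2 ^+ 2).
have c00 : 0 <= c0.
  by apply: mulr_ge0 => //; apply: divr_ge0; [apply: mulr_ge0|]; exact: sqr_ge0.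
(* This choice keeps [eta * v] at most [e], so that term costs at most [e / 12]; [D] collects the
   coefficients of [r] in the others. *)
apply/cvgrPdist_lt => e e0; pose eta := e / (v + 1).
have eta0 : 0 < eta by apply: divr_gt0 => //; lra.
pose D := c0 / 24 + v ^+ 2 / 4 + c0 / eta / 12.
have D0 : 0 <= D.
  have := divr_ge0 c00 (ltW eta0); have := sqr_ge0 v; rewrite /D; lra.
have e1 : 0 < e / 2 / (D + 1) by rewrite !divr_gt0//; lra.
have R0 := cvg0_near_lt rate_p e1.
near=> n.
have n0 : (0 < n)%N by near: n; exact: nbhs_infty_gt.
have N0 : 0 < n%:R :> R by rewrite ltr0n.
have r_small : (p n)%:R ^+ 2 / (n%:R * rho n ^+ 2) < e / 2 / (D + 1) by near: n.
set r := _ / (_ * _) in r_small.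
have [Y ceY Y4] := @ce4 n (Ordinal n0) erefl.
rewrite distrC; apply: le_lt_trans (oracle_score_cos (@mX n) (@meps n) (@mX0 n) (meps0 (n:=n))
  (bX0 n) (@indW n) (@lawW n) (ce0 n) (cv0 n) ceY Y4 (rho0 n) (@Grho n) sigma0 (BG n) t c eta0) _.
rewrite -/v.
have [r0 hr1] := (rho0 n, rho1 n0).
have r2 : 0 < rho n ^+ 2 by rewrite exprn_gt0.
have r2r : rho n ^+ 2 <= rho n by rewrite expr2 ler_piMl// ltW.
have kp : (k n <= p n ^ 2)%N.
  by apply: (@leq_trans (p n)); [exact: leq_addr|rewrite -{1}[p n]expn1 leq_pexp2l// addn_gt0 k0].
have p1 : (1 <= p n ^ 2)%N by rewrite (leq_trans _ kp).
(* Used with [c' = k n], [u = rho n] and with [c' = 1], [u = 1]; the latter relies on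
   [rho n <= 1]. *)
have pr c' u : (c' <= p n ^ 2)%N -> 0 < u -> rho n ^+ 2 <= u -> c'%:R / (n%:R * u) <= r.
  move=> cp u0 ru; rewrite /r -natrX; apply: ler_pM => //.
  - by rewrite invr_ge0 mulr_ge0// ltW.
  - by rewrite ler_nat.
  by rewrite lef_pV2 ?posrE ?mulr_gt0// ler_wpM2l.
have kr : (k n)%:R / (n%:R * rho n) <= r by exact: pr.
have nr : n%:R^-1 <= r.
  by have := pr 1 1 p1 ltr01 (le_trans r2r hr1); rewrite mulr1 div1r.
have -> : `|sigma4| * (v / (sigma ^+ 2 * rho n) * ((k n)%:R * M ^+ 2) * (v / sigma ^+ 2)) / n%:R =
    c0 * ((k n)%:R / (n%:R * rho n)).
  by rewrite /c0; field; rewrite !gt_eqF.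
have -> : v ^+ 2 / (4 * n%:R) = v ^+ 2 / 4 * n%:R^-1 by field; rewrite gt_eqF.
have H1 : c0 * ((k n)%:R / (n%:R * rho n)) <= c0 * r by exact: ler_wpM2l.
have H2 : v ^+ 2 / 4 * n%:R^-1 <= v ^+ 2 / 4 * r by rewrite ler_wpM2l// divr_ge0 ?sqr_ge0.
have H3 : c0 * ((k n)%:R / (n%:R * rho n)) / eta <= c0 * r / eta.
  by rewrite ler_wpM2r// invr_ge0 ltW.
have H4 : eta * v <= e.
  by rewrite /eta mulrAC ler_pdivrMr; [rewrite ler_pM2l//; lra|lra].
have H5 : D * r <= e / 2.
  have D1 : 0 < D + 1 by lra.
  move: r_small; rewrite ltr_pdivlMr// => /ltW; apply: le_trans; rewrite mulrC ler_wpM2l//.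
    by rewrite divr_ge0 ?sqr_ge0// mulr_ge0// ltW.
  lra.
have H6 : D * r = c0 * r / 24 + v ^+ 2 / 4 * r + c0 * r / eta / 12 by rewrite /D; ring.
lra.
Unshelve. all: by end_near. Qed.

Lemma oracle_score_cvg (f : 'cV[R]_d -> R) (C : R) : continuous f ->
  (forall x, `|f x| <= C) ->
  Ex (P n) (fun w => f (@Z n w)) @[n --> \oo] -->
  Ex (@std_normal R d) (fun z => f (\col_j tnth z j)).
Proof.
move=> cf fC; apply: (weak_convergence (@mZ) _ _ cf fC).
  exact: oracle_score_characteristic.
move=> n n0 j; have [Y ceY Y4] := @ce4 n (Ordinal n0) erefl.
have [] := oracle_score_variance (@mX n) (@meps n) (@mX0 n) (meps0 (n:=n))
  (bX0 n) (@indW n) (@lawW n) (ce0 n) (cv0 n) (Ordinal n0) sigma0 (BG n) (delta_mx j 0).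
rewrite dot_delta1.
rewrite (_ : (fun w => _) = (fun w => @Z n w j 0 ^+ 2)); first by move=> ? ->.
by apply/funext => w; rewrite dotC dot_delta.
Qed.

Lemma score_statistic_cvg (f : 'cV[R]_d -> R) (C : R) : continuous f ->
  (forall x, `|f x| <= C) ->
  Ex (P n) (fun w => f (score_statistic (@X n) (@bh n) (beta n) (B n) w)) @[n --> \oo] -->
  Ex (@std_normal R d) (fun z => f (\col_j tnth z j)).
Proof.
move=> cf fC; have C0 : 0 <= C by exact: le_trans (normr_ge0 _) (fC 0).
have s2 : 0 < sigma ^+ 2 by rewrite exprn_gt0.
(* This [K] makes the persistent part [2 * C * sigma ^+ 2 / K] at most [e / 4]. For large [n] the
   Gram part is also at most [e / 4], and the oracle score contributes less than [e / 2]. The [+ 1]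
   covers [C = 0]. *)
apply/cvgrPdist_lt => e e0; pose K := 8 * (C + 1) * sigma ^+ 2 / e.
have K0 : 0 < K by rewrite divr_gt0// !mulr_gt0//; lra.
have M4 : 0 <= M ^+ 4 by rewrite (exprM M 2 2) sqr_ge0.
have D0 : 0 <= 8 * C * M ^+ 4 by rewrite mulr_ge0// mulr_ge0.
have e1 : 0 < e / 4 / (8 * C * M ^+ 4 + 1) by rewrite !divr_gt0//; lra.
have R3 := rates_near a2 K0 rho0 b0 l0 mu1 rate_pb rate_lb rate_l.
have R0 := cvg0_near_lt rate_p e1.
have e2 : 0 < e / 2 by lra.
have /cvgrPdist_lt /(_ _ e2) R4 := oracle_score_cvg cf fC.
near=> n.
have n0 : (0 < n)%N by near: n; exact: nbhs_infty_gt.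
have [r1 r2 r3] : [/\ 16 * K * ((p n)%:R / (n%:R * (rho n * b n ^+ 2))) +
          2 * (a + 1) * ((k n)%:R * lambda n ^+ 2 / (rho n * b n ^+ 2)) < 1 / 4,
        (k n)%:R * lambda n ^+ 2 / (rho n * b n ^+ 2) < (4 * a ^+ 2)^-1 &
        100 * K * (mu n * (p n)%:R / (n%:R * rho n ^+ 2 * lambda n ^+ 2)) < 1] by near: n.
have r0 : (p n)%:R ^+ 2 / (n%:R * rho n ^+ 2) < e / 4 / (8 * C * M ^+ 4 + 1) by near: n.
have r4 : `|Ex (@std_normal R d) (fun z => f (\col_j tnth z j)) - Ex (P n) (fun w => f (@Z n w))| < e / 2.
  by near: n.
have := oracle_replacement (@mX n) (@meps n) (@mX0 n) (meps0 (n:=n))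
  (bX0 n) (@indW n) (@lawW n) (ce0 n) (cv0 n) (B n) (@mbh n) a2 (l0 n) n0 (k0 n) (rho0 n) (rho1 n0)
  (mu1 n0) (b0 n) K0 (beta2 n) (@min_abs_le _ _ _) (@hmin n) (@Grho n) (@Gmu n) r1 r2 r3 cf fC.
rewrite -/(@Z n) -/(p n).
set Es := Ex (P n) _; set Eo := Ex (P n) _; set r := _ / _ in r0 *.
move=> H1.
have H2 : 2 * C * (sigma ^+ 2 / K) <= e / 4.
  have -> : 2 * C * (sigma ^+ 2 / K) = C * e / (4 * (C + 1)).
    by rewrite /K; field; rewrite !gt_eqF//; lra.
  by rewrite ler_pdivrMr; [nra|lra].
have H3 : 8 * C * M ^+ 4 * r <= e / 4.
  have D1 : 0 < 8 * C * M ^+ 4 + 1 by lra.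
  move: r0; rewrite ltr_pdivlMr// => /ltW; apply: le_trans; rewrite mulrC ler_wpM2l//.
    by rewrite divr_ge0 ?sqr_ge0// mulr_ge0// sqr_ge0.
  lra.
have -> : forall x, x - Es = (x - Eo) + (Eo - Es) by move=> x; ring.
apply: le_lt_trans (ler_normD _ _) _; rewrite [`|Eo - Es|]distrC.
have H4 : 2 * C * (4 * M ^+ 4 * r + sigma ^+ 2 / K) = 8 * C * M ^+ 4 * r + 2 * C * (sigma ^+ 2 / K) by ring.
move: r4 H1; rewrite -/Eo H4; lra.
Unshelve. all: by end_near. Qed.

End AsymptoticNormality.

Theorem theorem6 (R : realType)
  (disp : nat -> measure_display) (T : forall n, measurableType (disp n))
  (P : forall n, probability (T n) R)
  (k m : nat -> nat)
  (X : forall n, 'I_n -> 'I_(k n + m n) -> {RV (P n) >-> R})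
  (eps : forall n, 'I_n -> {RV (P n) >-> R})
  (X0 : forall n, 'I_(k n + m n) -> {RV (P n) >-> R})
  (eps0 : forall n, {RV (P n) >-> R})
  (beta : forall n, 'cV[R]_(k n + m n))
  (lambda : nat -> R) (a sigma M sigma4 : R)
  (betahat : forall n, 'I_(k n + m n) -> {RV (P n) >-> R})
  (d : nat) (A : forall n, 'M[R]_(d, k n))
  (p := fun n => (k n + m n)%N)
  (rho1 := fun n => eig_min (second_moment (P n) (@X0 n)))
  (G1 := fun n => second_moment (P n) (fun j => X0 n (lshift (m n) j)))
  (G2 := fun n => second_moment (P n) (fun j => X0 n (rshift (k n) j)))
  (X1 := fun n (i : 'I_n) => rcol (fun j => X n i (lshift (m n) j))) :
  2 < a -> 0 < sigma -> (forall n, 0 < lambda n) ->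
  (forall n j, usubmx (beta n) j 0 != 0) ->
  (forall n, dsubmx (beta n) = 0) ->
  (forall n w b,
     scad_objective (response (@X n) (@eps n) (beta n) w) (design (@X n) w)
       (lambda n) a (rcol (@betahat n) w) <=
     scad_objective (response (@X n) (@eps n) (beta n) w) (design (@X n) w)
       (lambda n) a b) ->
  (0 < d)%N ->
  (forall n, row_free (A n)) ->
  (forall n, {ae P n, forall w, forall j, `|X0 n j w| <= M}) ->
  (forall n (i : 'I_n), i = 0%N :> nat ->
     exists2 Z : T n -> R,
       cond_exp (P n) (rvec (fun j => X n i (lshift (m n) j)))
         (fun w => eps n i w ^+ 4) Z
       & {ae P n, forall w, Z w <= sigma4}) ->
  (* (i) *)
  (forall n, mutually_independent (P n)
     (fun i w => (rvec (@X n i) w, eps n i w))) ->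
  (forall n i, same_law (P n) (fun w => (rvec (@X n i) w, eps n i w))
     (fun w => (rvec (@X0 n) w, eps0 n w))) ->
  (forall n i j, 'E_(P n)[X n i j] = 0)%E ->
  (forall n i j, 'V_(P n)[X n i j] = 1)%E ->
  (forall n, cond_exp (P n) (rvec (@X0 n)) (eps0 n) (cst 0)) ->
  (forall n, cond_var (P n) (rvec (@X0 n)) (eps0 n) (cst (sigma ^+ 2))) ->
  (* (ii) *)
  (forall n, 0 < rho1 n) ->
  (p n)%:R ^+ 2 / (n%:R * rho1 n ^+ 2) @[n --> \oo] --> 0 ->
  (k n)%:R * lambda n ^+ 2 / rho1 n @[n --> \oo] --> 0 ->
  (* (iii) *)
  Num.sqrt (p n)%:R / (Num.sqrt (n%:R * rho1 n) * min_abs (usubmx (beta n)))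
    @[n --> \oo] --> 0 ->
  lambda n * Num.sqrt (k n)%:R / (Num.sqrt (rho1 n) * min_abs (usubmx (beta n)))
    @[n --> \oo] --> 0 ->
  (* (iv) *)
  Num.sqrt (Num.max (eig_max (G1 n)) (eig_max (G2 n)) * (p n)%:R)
    / (Num.sqrt n%:R * rho1 n * lambda n) @[n --> \oo] --> 0 ->
  cvg_in_distribution P
    (fun n w =>
       (Num.sqrt n%:R)^-1 *:
         (invsqrtmx (sigma ^+ 2 *: (A n *m (A n)^T)) *m A n *m invsqrtmx (G1 n)
          *m \sum_(i < n) (X1 n i w *m (X1 n i w)^T
               *m (usubmx (rcol (@betahat n) w) - usubmx (beta n)))))
    (@std_normal R d).
Proof.
move=> a2 sigma0 l0 beta1 beta2 hmin d0 fA bX0 ce4 indW lawW EX VX ce0 cv0 rho0.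
move=> rate_p _ rate_pb rate_lb rate_l f cf [C fC].
have G1E n : ulsubmx (second_moment (P n) (@X0 n)) = G1 n by apply/matrixP => i j; rewrite !mxE.
have G2E n : drsubmx (second_moment (P n) (@X0 n)) = G2 n by apply/matrixP => i j; rewrite !mxE.
have mX n i j : measurable_fun setT (X n i j) by [].
have meps n i : measurable_fun setT (eps n i) by [].
have mX0 n j : measurable_fun setT (X0 n j) by [].
have meps0 n : measurable_fun setT (eps0 n) by [].
have mbh n j : measurable_fun setT (betahat n j) by [].
pose B n := invsqrtmx (sigma ^+ 2 *: (A n *m (A n)^T)) *m A n *m invsqrtmx (G1 n).
have := score_statistic_cvg mX meps mX0 meps0 mbh a2 sigma0 l0 beta1 beta2 hmin d0 fA bX0 ce4
  indW lawW EX VX ce0 cv0 rho0 rate_p rate_pb rate_lb _ cf fC.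
under eq_fun do rewrite G1E G2E.
move=> /(_ rate_l).
under [X in X @ _ --> _ -> _]eq_fun do rewrite G1E.
move=> h.
rewrite expectationE; last first.
  apply: (integ_bounded (std_normal d) (C := C)) => //.
  apply: (measurable_continuous_comp (std_normal d) _ cf fC) => j.
  by under eq_fun do rewrite mxE; exact: measurable_tnth.
rewrite (_ : (fun n => _) = fun n => (Ex (P n) (fun w => f (score_statistic (X n)
    (betahat n) (beta n) (B n) w)))%:E).
  by apply: cvg_EFin; [exact: nearW|exact: h].
apply/funext => n; rewrite expectationE//.
apply: (integ_bounded (P n) (C := C)); last by move=> w; exact: fC.
apply: (measurable_continuous_comp (P n) _ cf fC) => j.
exact: (measurable_score_statistic (mX n) (beta n) (B n) (mbh n) j).
Qed.
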